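(* There is a polynomial-time algorithm that decides whether a given homogeneous cubic polynomial with nonnegative coefficients in $n$ variables is log concave on $\mathbb{R}^n_{\geq 0}$.
   Context: A polynomial $g\in\mathbb{R}[x_1,\dots,x_n]$ with nonnegative coefficients is log concave if $\log(g)$ is a concave function on $\mathbb{R}^n_{>0}$; equivalently, $\nabla^2\log(g)\preceq 0$ at all points of $\mathbb{R}^n_{\geq 0}$ where it is defined (the zero polynomial, with $\log 0=-\infty$, counts as log concave). The polynomial is given by the list of its coefficients; the number of variables $n$ is part of the input. *)

(* Defs.v *)
From HB Require Import structures.
From mathcomp Require Import all_boot all_order all_algebra.
From mathcomp Require Import mpoly.
From mathcomp Require Import reals constructive_ereal.
From mathcomp Require exp.

Set Implicit Arguments.
Unset Strict Implicit.
Unset Printing Implicit Defensive.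

Import Order.TTheory GRing.Theory Num.Theory.
Local Open Scope ring_scope.

(* Deterministic multi-tape Turing machines with two-way infinite tapes. *)

Inductive move := MoveL | Stay | MoveR.

(* [tleft] and [tright] list the cells on either side of the head, nearest
   first; the cells beyond the end of these lists are blank. *)
Record tape (G : Type) := Tape { tleft : seq G; thead : G; tright : seq G }.

Definition act (G : Type) (blank : G) (a : G * move) (t : tape G) : tape G :=
  let: (s, m) := a in
  match m with
  | MoveL => Tape (behead (tleft t)) (head blank (tleft t)) (s :: tright t)
  | Stay => Tape (tleft t) s (tright t)
  | MoveR => Tape (s :: tleft t) (head blank (tright t)) (behead (tright t))
  end.

(* The tape alphabet is the input alphabet [Sigma], together with additional
   working symbols and the blank [None].  A state whose [verdict] is [Some b]
   is a halting state with answer [b]. *)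
Record machine (Sigma : finType) := Machine {
  work : finType;
  state : finType;
  ntapes : nat;
  start : state;
  verdict : state -> option bool;
  delta : state -> {ffun 'I_ntapes.+1 -> option (Sigma + work)%type} ->
          state * {ffun 'I_ntapes.+1 -> option (Sigma + work)%type * move}
}.

Section Run.
Context (Sigma : finType) (M : machine Sigma).

Definition tsymbol : finType := option (Sigma + work M)%type.

Definition config : Type :=
  (state M * {ffun 'I_(ntapes M).+1 -> tape tsymbol})%type.

Definition step (c : config) : config :=
  let: (q, ts) := c in
  if verdict q is Some _ then c else
  let: (q', acts) := delta q [ffun i => thead (ts i)] in
  (q', [ffun i => act None (acts i) (ts i)]).

(* The input is written on tape 0, with the head on its first symbol. *)
Definition init (w : seq Sigma) : config :=
  let w' : seq tsymbol := [seq Some (inl a) | a <- w] in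
  (start M,
   [ffun i => if i == ord0 then Tape [::] (head None w') (behead w')
              else Tape [::] None [::]]).

Definition answers_within (t : nat) (w : seq Sigma) (b : bool) : Prop :=
  verdict (iter t step (init w)).1 = Some b.

End Run.

(* [Some b] is a bit and [None] a separator. *)
Definition letter : finType := option bool.

(* Least significant bit first, without leading zeros; [bits 0] is empty. *)
Definition bits (k : nat) : seq letter :=
  mkseq (fun i => Some (odd (k %/ 2 ^ i))) (up_log 2 k.+1).

(* Numerator and denominator in lowest terms, both in binary.  There is no
   sign: only nonnegative rationals are encoded. *)
Definition encode_rat (q : rat) : seq letter :=
  bits `|numq q|%N ++ None :: bits `|denq q|%N ++ [:: None].

Definition cubic_indices (n : nat) : seq ('I_n * 'I_n * 'I_n) :=
  [seq ijk : 'I_n * 'I_n * 'I_n <-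
     [seq (ij, k) | ij <- [seq (i, j) | i <- enum 'I_n, j <- enum 'I_n],
                    k <- enum 'I_n]
  | (ijk.1.1 <= ijk.1.2)%N && (ijk.1.2 <= ijk.2)%N].

(* The coefficients of all the monomials x_i x_j x_k with i <= j <= k, in
   lexicographic order of (i, j, k); vanishing coefficients are listed too. *)
Definition cubic_coeffs (n : nat) (g : {mpoly rat[n]}) : seq rat :=
  [seq g@_(U_(ijk.1.1) + U_(ijk.1.2) + U_(ijk.2))%MM | ijk <- cubic_indices n].

(* The number of variables, in unary, followed by the list of coefficients. *)
Definition encode_cubic (n : nat) (g : {mpoly rat[n]}) : seq letter :=
  nseq n (Some true) ++ None :: flatten (map encode_rat (cubic_coeffs g)).

(* [exp.lne] is the extended logarithm, with value [-oo] at 0. *)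
Definition log_concave (R : realType) (n : nat) (g : {mpoly R[n]}) : Prop :=
  forall (x y : 'I_n -> R) (t : R),
    (forall i, 0 < x i) -> (forall i, 0 < y i) -> 0 < t < 1 ->
    (t%:E * exp.lne (g.@[x])%:E + (1 - t)%:E * exp.lne (g.@[y])%:E
     <= exp.lne (g.@[fun i => t * x i + (1 - t) * y i])%:E)%E.

(* Main.v *)
Require Import Defs.
From mathcomp Require Import all_boot all_order all_algebra.
From mathcomp Require Import mpoly reals.
From mathcomp Require Import constructive_ereal complex.
From mathcomp Require exp.
From mathcomp Require Import zify ring lra.

(* Let T be the symmetric trilinear form with g(x) = T(x, x, x), scaled to integer
   coefficients by clearing denominators.  Then g is log concave iff the quadratic
   forms T(e_k, -, -), for all k, and T(1, -, -), where 1 is the all-ones vector,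
   satisfy the reverse Cauchy-Schwarz inequality B(1, v)^2 >= B(1, 1) B(v, v), i.e.
   have at most one positive eigenvalue.

   Necessity: log concavity at x > 0 gives T(x, u, v)^2 >= T(x, u, u) T(x, v, v) for
   u > 0; let x tend to e_k, or take x = 1.  Sufficiency (Oppenheim's trickling down):
   for x > 0 put M = T(x, -, -), D = diag(T(e_k, x, x) / x_k) and L = D - M, a weighted
   graph Laplacian.  The inequalities for the forms T(e_k, -, -) sum up to
   L <= L D^-1 L, and the one for T(1, -, -) says that the graph is connected, so that
   L w = D v is solvable when T(x, x, v) = 0; then M is nonpositive at v.

   Each inequality is the positive semidefiniteness of an integer matrix, which is read
   off the signs of the coefficients of its characteristic polynomial.  These are
   computed by the Faddeev-LeVerrier recursion without divisions, with entries of
   polynomial bit length.  The computation is a composition of functions on binary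
   trees, compiled to a Turing machine that keeps serialized trees on stacks. *)

Set Implicit Arguments.
Unset Strict Implicit.
Unset Printing Implicit Defensive.

(** * Programs on stacks and their Turing machines *)

(** The trickling-down step is spectral. On the vertices with [D > 0], [L <= L D^-1 L] says that
    every eigenvalue [m] of the normalized Laplacian [D^-1 L] satisfies [m <= m^2], so that it is 0
    or at least 1. Connectivity makes 0 simple, with eigenvector [x], hence [D^-1 M = 1 - D^-1 L]
    has no positive eigenvalue but 1. This is why n + 1 forms suffice instead of one for every point
    [x]. Vertices with [deg k = 0] are isolated and are carried along by the convention [_ / 0 = 0].
    Signs of coefficients decide semidefiniteness because a symmetric matrix has a real spectrum:
    the product of the [1 + d_i t] has constant term 1, so with nonnegative coefficients it has no
    positive root. On the machine side the obstacle is that composition and iteration need bounds on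
    the size of intermediate values, not only on running times. Hence [PT] carries both, and every
    loop comes with a bound on its accumulator. *)

Inductive reg := RI | RS | RA | RB | RK.

(** [RI] must be tape 0, where the machine finds its input. [RS] holds the serialized trees; the
    others are scratch space, [RK] also serving as a counter. *)
Definition ord_reg (r : reg) : 'I_5 :=
  match r with
  | RI => inord 0 | RS => inord 1 | RA => inord 2 | RB => inord 3 | RK => inord 4
  end.

Record store := Store {
  sI : seq letter; sS : seq letter; sA : seq letter; sB : seq letter; sK : seq letter }.

Definition get (st : store) (r : reg) : seq letter :=
  match r with RI => sI st | RS => sS st | RA => sA st | RB => sB st | RK => sK st end.

Definition set (st : store) (r : reg) (v : seq letter) : store :=
  let: Store i s a b k := st in
  match r with
  | RI => Store v s a b k
  | RS => Store i v a b k
  | RA => Store i s v b k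
  | RB => Store i s a v k
  | RK => Store i s a b v
  end.

(** Every program ends with a boolean, which takes the place of test expressions: [Ite] and [While]
    branch on the outcome of a whole program, and the body of a [While] is its own test. *)
Inductive prog :=
  | Push of reg & letter
  | Pop of reg
  | Test of reg & letter
  | Ret of bool
  | Ite of prog & prog & prog
  | While of prog.

(** The step counts are exact machine steps. Composition costs nothing because the exit of one
    program is identified with the start state of the next. *)
Inductive exec : prog -> store -> nat -> store -> bool -> Prop :=
  | exec_push r a st : exec (Push r a) st 2 (set st r (a :: get st r)) true
  | exec_pop r st : exec (Pop r) st 2 (set st r (behead (get st r))) true
  | exec_test r a st : exec (Test r a) st 1 st (ohead (get st r) == Some a)
  | exec_ret b st : exec (Ret b) st 1 st b
  | exec_ite p q1 q2 st t st' b t' st'' b' :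
      exec p st t st' b -> exec (if b then q1 else q2) st' t' st'' b' ->
      exec (Ite p q1 q2) st (t + t') st'' b'
  | exec_while_false p st t st' :
      exec p st t st' false -> exec (While p) st t st' false
  | exec_while_true p st t st' t' st'' b :
      exec p st t st' true -> exec (While p) st' t' st'' b ->
      exec (While p) st (t + t') st'' b.

Notation Seq p q := (Ite p q q).

(** The working alphabet is empty: blanks are [None], and the separator [Some (inl None)] is
    distinct from them. *)
Definition cell : finType := option (letter + void)%type.

(** * Compilation of programs into transition functions *)

Fixpoint pstate (p : prog) : finType :=
  match p with
  | Push _ _ | Pop _ => bool
  | Test _ _ | Ret _ => unit
  | Ite p q1 q2 => (pstate p + (pstate q1 + pstate q2))%type
  | While p => pstate p
  end.

Fixpoint pstart (p : prog) : pstate p :=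
  match p return pstate p with
  | Push _ _ | Pop _ => false
  | Test _ _ | Ret _ => tt
  | Ite p q1 q2 => inl (pstart p)
  | While p => pstart p
  end.

Notation reads := {ffun 'I_5 -> cell}.
Notation actions := {ffun 'I_5 -> cell * move}.

Definition idle (h : reads) : actions := [ffun i => (h i, Stay)].

Definition act_on (r : reg) (a : cell * move) (h : reads) : actions :=
  [ffun i => if i == ord_reg r then a else (h i, Stay)].

Definition ite_state (p q1 q2 : prog) (q : pstate p + bool) :
    pstate (Ite p q1 q2) + bool :=
  match q with
  | inl q => inl (inl q)
  | inr true => inl (inr (inl (pstart q1)))
  | inr false => inl (inr (inr (pstart q2)))
  end.

Definition ite_left (p q1 q2 : prog) (q : pstate q1 + bool) :
    pstate (Ite p q1 q2) + bool :=
  match q with inl q => inl (inr (inl q)) | inr b => inr b end.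

Definition ite_right (p q1 q2 : prog) (q : pstate q2 + bool) :
    pstate (Ite p q1 q2) + bool :=
  match q with inl q => inl (inr (inr q)) | inr b => inr b end.

Definition while_state (p : prog) (q : pstate p + bool) : pstate (While p) + bool :=
  match q with
  | inl q => inl q
  | inr true => inl (pstart p)
  | inr false => inr false
  end.

Fixpoint pdelta (p : prog) : pstate p -> reads -> (pstate p + bool) * actions :=
  match p return pstate p -> reads -> (pstate p + bool) * actions with
  | Push r a => fun q h =>
      if q then (inr true, act_on r (Some (inl a), Stay) h)
      else (inl true, act_on r (h (ord_reg r), MoveL) h)
  | Pop r => fun q h =>
      if q then (inr true, idle h)
      else (inl true, act_on r (None, MoveR) h)
  | Test r a => fun _ h => (inr (h (ord_reg r) == Some (inl a)), idle h)
  | Ret b => fun _ h => (inr b, idle h)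
  | Ite p q1 q2 => fun q h =>
      match q with
      | inl q => let: (q', acts) := @pdelta p q h in (ite_state q1 q2 q', acts)
      | inr (inl q) => let: (q', acts) := @pdelta q1 q h in (@ite_left p q1 q2 q', acts)
      | inr (inr q) => let: (q', acts) := @pdelta q2 q h in (@ite_right p q1 q2 q', acts)
      end
  | While p => fun q h => let: (q', acts) := @pdelta p q h in (while_state q', acts)
  end.

Definition machine_of (p : prog) : machine letter :=
  @Machine letter void (pstate p + bool)%type 4 (inl (pstart p))
    (fun q => match q with inl _ => None | inr b => Some b end)
    (fun q h => match q with inl q => pdelta q h | inr b => (inr b, idle h) end).

Notation tapes := {ffun 'I_5 -> tape cell}.

Definition pstep p (q : pstate p) (ts : tapes) : (pstate p + bool) * tapes :=
  let: (q', acts) := pdelta q [ffun i => Defs.thead (ts i)] in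
  (q', [ffun i => act None (acts i) (ts i)]).

(** Only non-halting states step here, so that a run of a component embeds into the run of a larger
    program, where its exits are renamed. *)
Inductive reach p : nat -> (pstate p + bool) * tapes -> (pstate p + bool) * tapes -> Prop :=
  | reach0 c : reach 0 c c
  | reachS t q ts c : reach t (pstep q ts) c -> reach t.+1 (inl q, ts) c.

Lemma reach_trans p t1 t2 (c1 c2 c3 : (pstate p + bool) * tapes) :
  reach t1 c1 c2 -> reach t2 c2 c3 -> reach (t1 + t2) c1 c3.
Proof. by elim=> // t q ts c _ IH /IH; rewrite addSn => /reachS. Qed.

Lemma reach_embed p p' (e : pstate p + bool -> pstate p' + bool) (e' : pstate p -> pstate p') :
  (forall q, e (inl q) = inl (e' q)) ->
  (forall q h, pdelta (e' q) h = let: (q', acts) := pdelta q h in (e q', acts)) ->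
  forall t c1 c2, reach t c1 c2 -> reach t (e c1.1, c1.2) (e c2.1, c2.2).
Proof.
move=> eE dE t c1 c2; elim=> [c|{}t q ts c _]; first exact: reach0.
rewrite /= eE => IH; apply: reachS; move: IH; rewrite /pstep dE.
by case: (pdelta q _).
Qed.

Definition blank_cells : pred (seq cell) := all (pred1 None).

(* The head is on the top of the stack, and every cell to its left is blank. *)
Definition tape_rep (t : tape cell) (s : seq letter) : Prop :=
  blank_cells (tleft t) /\
  exists2 z, blank_cells z & Defs.thead t :: tright t = [seq Some (inl a) | a <- s] ++ z.

Definition rep (ts : tapes) (st : store) : Prop :=
  forall r, tape_rep (ts (ord_reg r)) (get st r).

Lemma act_stay (t : tape cell) : act None (Defs.thead t, Stay) t = t.
Proof. by case: t. Qed.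

Lemma rep_idle ts st : rep ts st ->
  rep [ffun i => act None (idle [ffun i => Defs.thead (ts i)] i) (ts i)] st.
Proof. by move=> H r; rewrite !ffunE act_stay. Qed.

Lemma get_set st r v r' : get (set st r v) r' =
  if ord_reg r' == ord_reg r then v else get st r'.
Proof.
by case: st => ? ? ? ? ?; case: r; case: r'; rewrite -val_eqE /= !inordK.
Qed.

Lemma rep_upd ts st r t v (f : {ffun 'I_5 -> tape cell}) :
  rep ts st -> tape_rep t v -> (forall i, f i = if i == ord_reg r then t else ts i) ->
  rep f (set st r v).
Proof. by move=> H Ht fE r'; rewrite get_set fE; case: eqP. Qed.

Lemma tape_rep_head t s : tape_rep t s ->
  Defs.thead t = omap inl (ohead s).
Proof. by case=> _ [[|z0 z] bz]; case: s => [|a s] //= [-> _]; move: bz => //= /andP[/eqP]. Qed.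

Lemma tape_rep_push t s a : tape_rep t s ->
  tape_rep (act None (Some (inl a), Stay) (act None (Defs.thead t, MoveL) t)) (a :: s).
Proof.
case: t => l h r [bl [z bz /= E]]; split; last by exists z; rewrite //= -E.
by case: l bl => //= ? ? /andP[].
Qed.

Lemma tape_rep_pop t s : tape_rep t s -> tape_rep (act None (None, MoveR) t) (behead s).
Proof.
case: t => l h r [bl [z bz E]]; split; first by rewrite /= bl.
suff [z' bz' ->] : exists2 z', blank_cells z' &
    head None r :: behead r = [seq Some (inl a) | a <- behead s] ++ z' by exists z'.
case: s E => [|a [|b s]] /=.
- by case: z bz => //= z0 [|z1 z] /andP[_ bz] [_ ->]; [exists [:: None] | exists (z1 :: z)].
- by case=> _ ->; case: z bz => [|z0 z] bz; [exists [:: None] | exists (z0 :: z)].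
- by case=> _ ->; exists z.
Qed.

Lemma pstep_single p q r a (ts : tapes) q' :
  pdelta q [ffun i => Defs.thead (ts i)] = (q', act_on r a [ffun i => Defs.thead (ts i)]) ->
  exists f : {ffun 'I_5 -> tape cell}, pstep (p := p) q ts = (q', f) /\
  forall i, f i = if i == ord_reg r then act None a (ts i) else ts i.
Proof.
move=> E; rewrite /pstep E; eexists; split; first by reflexivity.
by move=> i; rewrite !ffunE; case: eqP => // _; rewrite act_stay.
Qed.

Lemma set_get st r : set st r (get st r) = st.
Proof. by case: st => ? ? ? ? ?; case: r. Qed.

Theorem exec_reach p st t st' b : exec p st t st' b ->
  forall ts, rep ts st -> exists2 ts', rep ts' st' & reach t (inl (pstart p), ts) (inr b, ts').
Proof.
elim=> {p st t st' b}.
- move=> r a st ts H.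
  have [|f1 [E1 F1]] := @pstep_single (Push r a) false r (Defs.thead (ts (ord_reg r)), MoveL) ts (inl true).
    by rewrite /= !ffunE.
  have [|f2 [E2 F2]] := @pstep_single (Push r a) true r (Some (inl a), Stay) f1 (inr true).
    by [].
  exists f2; last by apply: reachS; rewrite E1; apply: reachS; rewrite E2; apply: reach0.
  apply: rep_upd H (tape_rep_push a (H r)) _ => i; rewrite F2 F1.
  by case: eqP => // ->.
- move=> r st ts H.
  have [|f1 [E1 F1]] := @pstep_single (Pop r) false r (None, MoveR) ts (inl true).
    by [].
  exists [ffun i => act None (idle [ffun i => Defs.thead (f1 i)] i) (f1 i)].
    apply: rep_idle; apply: rep_upd H (tape_rep_pop (H r)) _ => i; rewrite F1.
    by case: eqP => // ->.
  by apply: reachS; rewrite E1; apply: reachS; apply: reach0.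
- move=> r a st ts H; eexists; first exact: rep_idle H.
  apply: reachS; rewrite /pstep /= ffunE (tape_rep_head (H r)).
  have -> : (omap inl (ohead (get st r)) == Some (inl a) :> cell) = (ohead (get st r) == Some a).
    by case: (ohead _).
  exact: reach0.
- by move=> b st ts H; eexists; [exact: rep_idle H | apply: reachS; exact: reach0].
- move=> p q1 q2 st t st' b t' st'' b' _ IH1 _ IH2 ts H.
  have {IH1} [ts' H' R1] := IH1 ts H.
  have {IH2} [ts'' H'' R2] := IH2 ts' H'.
  exists ts'' => //.
  have R := @reach_embed p (Ite p q1 q2) (ite_state q1 q2) inl (fun _ => erefl) (fun _ _ => erefl) _ _ _ R1.
  apply: reach_trans R _; move: R2; case: b {R1} => R2.
    exact: (@reach_embed q1 (Ite p q1 q2) (@ite_left p q1 q2) (fun q => inr (inl q)) (fun _ => erefl) (fun _ _ => erefl) _ _ _ R2).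
  exact: (@reach_embed q2 (Ite p q1 q2) (@ite_right p q1 q2) (fun q => inr (inr q)) (fun _ => erefl) (fun _ _ => erefl) _ _ _ R2).
- move=> p st t st' _ IH ts /IH[ts' H' R]; exists ts' => //.
  exact: (@reach_embed p (While p) (@while_state p) id (fun _ => erefl) (fun _ _ => erefl) _ _ _ R).
- move=> p st t st' t' st'' b _ IH1 _ IH2 ts /IH1[ts' /IH2[ts'' H'' R2] R1]; exists ts'' => //.
  apply: reach_trans R2.
  exact: (@reach_embed p (While p) (@while_state p) id (fun _ => erefl) (fun _ _ => erefl) _ _ _ R1).
Qed.

Lemma reach_step p t c c' : @reach p t c c' ->
  iter t (@step _ (machine_of p)) c = c'.
Proof.
elim=> // {}t q ts {}c' _ <-; rewrite iterSr; congr (iter _ _ _).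
Qed.

(** Halting states are fixed by [step], so any later time gives the same answer. *)
Theorem exec_answers p w t st b :
  exec p (Store w [::] [::] [::] [::]) t st b ->
  forall t', t <= t' -> answers_within (machine_of p) t' w b.
Proof.
move=> /exec_reach H t' tt'.
have [ts' _ /reach_step E] : exists2 ts', rep ts' st &
    reach t (inl (pstart p), (@init _ (machine_of p) w).2) (inr b, ts').
  apply: H => r; rewrite ffunE -(inj_eq val_inj).
  case: r; rewrite /= inordK //=; try by (split => //; exists [:: None]).
  by split=> //; case: w => [|a w]; [exists [:: None] | exists [::]; rewrite // cats0].
rewrite /answers_within -(subnK tt') iterD [X in iter _ _ X]E.
by elim: (t' - t) => //= n; case: (iter _ _ _) => q ts /=; case: q.
Qed.

(** * Polynomial-time functions on encoded data *)

Inductive tree := Leaf | Node of tree & tree.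

Notation node := (Some true : letter).
Notation leaf := (Some false : letter).

(* Prefix notation, so that on a stack [Node] and its inverse are one push or pop. *)
Fixpoint ser (a : tree) : seq letter :=
  match a with
  | Leaf => [:: leaf]
  | Node l r => node :: ser l ++ ser r
  end.

(** * Cost calculus for programs *)

Definition execs p st T st' b := exists2 t, t <= T & exec p st t st' b.

Definition run p st T st' := exists b, execs p st T st' b.

Lemma execs_leq p st T T' st' b : T <= T' -> execs p st T st' b -> execs p st T' st' b.
Proof. by move=> le [t lt ?]; exists t => //; apply: leq_trans le. Qed.

Lemma run_leq p st T T' st' : T <= T' -> run p st T st' -> run p st T' st'.
Proof. by move=> le [b /(execs_leq le)]; exists b. Qed.

Lemma execs_run p st T st' b : execs p st T st' b -> run p st T st'.
Proof. by exists b. Qed.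

Lemma execs_ite p q1 q2 st st' b T T' st'' b' :
  execs p st T st' b -> execs (if b then q1 else q2) st' T' st'' b' ->
  execs (Ite p q1 q2) st (T + T') st'' b'.
Proof.
by move=> [t lt H] [t' lt' H']; exists (t + t'); [exact: leq_add | exact: exec_ite H H'].
Qed.

Lemma execs_seq p q st st' T T' st'' b' :
  run p st T st' -> execs q st' T' st'' b' -> execs (Seq p q) st (T + T') st'' b'.
Proof. by move=> [b H] H'; apply: execs_ite H _; case: (b). Qed.

Lemma run_seq p q st st' T T' st'' :
  run p st T st' -> run q st' T' st'' -> run (Seq p q) st (T + T') st''.
Proof. by move=> H [b' H']; exists b'; apply: execs_seq H H'. Qed.

Lemma execs_push r a st : execs (Push r a) st 2 (set st r (a :: get st r)) true.
Proof. by exists 2 => //; constructor. Qed.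

Lemma execs_pop r st : execs (Pop r) st 2 (set st r (behead (get st r))) true.
Proof. by exists 2 => //; constructor. Qed.

Lemma execs_ret b st : execs (Ret b) st 1 st b.
Proof. by exists 1 => //; constructor. Qed.

Lemma run_push r a st : run (Push r a) st 2 (set st r (a :: get st r)).
Proof. exact: execs_run (execs_push _ _ _). Qed.

Lemma run_pop r st : run (Pop r) st 2 (set st r (behead (get st r))).
Proof. exact: execs_run (execs_pop _ _). Qed.

Lemma execs_test r a q1 q2 st T st' b' :
  execs (if ohead (get st r) == Some a then q1 else q2) st T st' b' ->
  execs (Ite (Test r a) q1 q2) st (1 + T) st' b'.
Proof. by apply: execs_ite; exists 1 => //; constructor. Qed.

Lemma run_test r a q1 q2 st T st' :
  run (if ohead (get st r) == Some a then q1 else q2) st T st' ->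
  run (Ite (Test r a) q1 q2) st (1 + T) st'.
Proof. by move=> [b H]; exists b; apply: execs_test. Qed.

Lemma execs_while_true p st T st' T' st'' b :
  execs p st T st' true -> execs (While p) st' T' st'' b ->
  execs (While p) st (T + T') st'' b.
Proof.
by move=> [t lt H] [t' lt' H']; exists (t + t'); [exact: leq_add | exact: exec_while_true H H'].
Qed.

Lemma execs_while_false p st T st' : execs p st T st' false -> execs (While p) st T st' false.
Proof. by move=> [t lt H]; exists t => //; apply: exec_while_false. Qed.

(** A test recognizes a single letter, so each of the three letters has its own branch; an empty
    stack passes no test and ends the loop. The word arrives reversed. *)
Definition transfer x y :=
  While (Ite (Test x (Some true)) (Seq (Pop x) (Push y (Some true)))
        (Ite (Test x (Some false)) (Seq (Pop x) (Push y (Some false)))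
        (Ite (Test x None) (Seq (Pop x) (Push y None)) (Ret false)))).

Lemma run_transfer x y st : ord_reg x != ord_reg y ->
  run (transfer x y) st (7 * size (get st x) + 4)
    (set (set st x [::]) y (catrev (get st x) (get st y))).
Proof.
move=> xy; exists false; move E: (get st x) => s; elim: s st E => [|a s IH] st E.
  have -> : set (set st x [::]) y (catrev [::] (get st y)) = st.
    by have -> : set st x [::] = st; [rewrite -E set_get | exact: set_get].
  apply: execs_while_false; do 3 (apply: execs_test; rewrite E /=); exact: execs_ret.
set st1 := set st x s; set st2 := set st1 y (a :: get st1 y).
have E2 : get st2 x = s by rewrite get_set (negPf xy) get_set eqxx.
have M : execs (Seq (Pop x) (Push y a)) st 4 st2 true.
  by apply: (@execs_seq _ _ _ st1 2 2); [move: (run_pop x st); rewrite E | exact: execs_push].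
have {IH} := IH st2 E2.
have -> : set (set st2 x [::]) y (catrev s (get st2 y)) =
  set (set st x [::]) y (catrev (a :: s) (get st y)).
  by rewrite /st2 get_set eqxx get_set eq_sym (negPf xy) /=; move: xy; rewrite /st1; clear;
     case: st => ? ? ? ? ?; case: x; case: y; rewrite ?eqxx.
move=> H; have -> : 7 * size (a :: s) + 4 = 7 + (7 * size s + 4) by rewrite /= mulnS addnA.
apply: execs_while_true H; case: a E @st2 E2 M => [[]|] E st2 E2 M.
- by apply: (@execs_leq _ _ (1 + 4)) => //; apply: execs_test; rewrite E.
- apply: (@execs_leq _ _ (1 + (1 + 4))) => //.
  by do 2 (apply: execs_test; rewrite E /=).
- by do 3 (apply: execs_test; rewrite E /=).
Qed.

(** Serialized trees contain no separator, so two tests are enough. *)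
Definition copy_A_SB :=
  While (Ite (Test RA node) (Seq (Pop RA) (Seq (Push RS node) (Push RB node)))
        (Ite (Test RA leaf) (Seq (Pop RA) (Seq (Push RS leaf) (Push RB leaf)))
             (Ret false))).

Lemma run_copy i s a b k : all (predC1 None) a ->
  run copy_A_SB (Store i s a b k) (8 * size a + 3) (Store i (catrev a s) [::] (catrev a b) k).
Proof.
move=> aN; exists false; elim: a aN s b => [|a l IH] aN s b.
  apply: execs_while_false; do 2 apply: execs_test; exact: execs_ret.
have {aN} /andP[/= aN lN] := aN.
have {IH lN} H := IH lN (a :: s) (a :: b).
have -> : 8 * (size l).+1 + 3 = 8 + (8 * size l + 3) by rewrite mulnS addnA.
apply: execs_while_true H; case: a aN => [[]|] // _.
- apply: (@execs_leq _ _ (1 + (2 + (2 + 2)))) => //; apply: execs_test => /=.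
  apply: execs_seq; first exact: run_pop.
  by apply: execs_seq; [exact: run_push | exact: execs_push].
- apply: (@execs_leq _ _ (1 + (1 + (2 + (2 + 2))))) => //; do 2 apply: execs_test => /=.
  apply: execs_seq; first exact: run_pop.
  by apply: execs_seq; [exact: run_push | exact: execs_push].
Qed.

Definition clear_A :=
  While (Ite (Test RA node) (Pop RA) (Ite (Test RA leaf) (Pop RA) (Ret false))).

Lemma run_clear i s a b k : all (predC1 None) a ->
  run clear_A (Store i s a b k) (4 * size a + 3) (Store i s [::] b k).
Proof.
move=> aN; exists false; elim: a aN => [|a l IH] aN.
  apply: execs_while_false; do 2 apply: execs_test; exact: execs_ret.
have {aN} /andP[/= aN lN] := aN.
have -> : 4 * (size l).+1 + 3 = 4 + (4 * size l + 3) by rewrite mulnS addnA.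
apply: execs_while_true (IH lN); case: a aN => [[]|] // _.
- apply: (@execs_leq _ _ (1 + 2)) => //; apply: execs_test => /=; exact: execs_pop.
- do 2 apply: execs_test => /=; exact: execs_pop.
Qed.

(* [RK] counts, in unary, the subtrees that remain to be moved. *)
Definition take_loop :=
  While (Ite (Test RK node)
    (Seq (Pop RK)
      (Ite (Test RS node)
        (Seq (Pop RS) (Seq (Push RA node) (Seq (Push RK node) (Push RK node))))
        (Seq (Pop RS) (Push RA leaf))))
    (Ret false)).

Definition take_tree := Seq (Push RK node) take_loop.

(** An arbitrary continuation of the loop is part of the statement, so that the induction can chain
    subtrees: a [Node] trades one pending subtree for two. *)
Lemma execs_take_loop x i s a b k T st :
  execs take_loop (Store i s (catrev (ser x) a) b k) T st false ->
  execs take_loop (Store i (ser x ++ s) a b (node :: k)) (12 * size (ser x) + T) st false.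
Proof.
elim: x s a k T => [|l IHl r IHr] s a k T H.
  apply: execs_while_true H; apply: (@execs_leq _ _ (1 + (2 + (1 + (2 + 2))))) => //.
  apply: execs_test => /=; apply: execs_seq; first exact: run_pop.
  apply: execs_test => /=; apply: execs_seq; first exact: run_pop.
  exact: execs_push.
have -> : 12 * size (ser (Node l r)) + T =
    12 + (12 * size (ser l) + (12 * size (ser r) + T)) by rewrite /= size_cat; lia.
have -> : ser (Node l r) ++ s = node :: ser l ++ ser r ++ s by rewrite /= -catA.
have E : catrev (ser (Node l r)) a = catrev (ser r) (catrev (ser l) (node :: a)).
  by rewrite /= catrevE rev_cat -catA -!catrevE.
rewrite {}E in H.
apply: execs_while_true (IHl _ _ _ _ (IHr _ _ _ _ H)).
apply: (@execs_leq _ _ (1 + (2 + (1 + (2 + (2 + (2 + 2))))))) => //.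
apply: execs_test => /=; apply: execs_seq; first exact: run_pop.
apply: execs_test => /=; apply: execs_seq; first exact: run_pop.
apply: execs_seq; first exact: run_push.
apply: execs_seq; first exact: run_push.
exact: execs_push.
Qed.

Lemma run_take x i s a b :
  run take_tree (Store i (ser x ++ s) a b [::]) (12 * size (ser x) + 4)
    (Store i s (catrev (ser x) a) b [::]).
Proof.
apply: (@run_leq _ _ (2 + (12 * size (ser x) + 2))); first by lia.
apply: run_seq; first exact: run_push.
exists false; apply: execs_take_loop; apply: execs_while_false; apply: execs_test.
exact: execs_ret.
Qed.

Lemma ser_letters x : all (predC1 None) (ser x).
Proof. by elim: x => //= l Hl r Hr; rewrite all_cat Hl. Qed.

(** * Operations on the trees at the top of the stack *)

Notation stacks i s := (Store i s [::] [::] [::]).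

Definition drop_tree := Seq take_tree clear_A.

Lemma run_drop x i s :
  run drop_tree (stacks i (ser x ++ s)) (30 * size (ser x) + 30) (stacks i s).
Proof.
apply: run_leq; last first.
  apply: run_seq; first exact: run_take.
  by apply: run_clear; rewrite catrevE all_cat all_rev ser_letters.
by rewrite catrevE cats0 size_rev; move: (size _) => m; lia.
Qed.

Definition dup_tree :=
  Seq take_tree (Seq copy_A_SB (Seq (transfer RB RA) (transfer RA RS))).

Lemma run_dup x i s :
  run dup_tree (stacks i (ser x ++ s)) (40 * size (ser x) + 30)
    (stacks i (ser x ++ ser x ++ s)).
Proof.
apply: run_leq; last first.
  apply: run_seq; first exact: run_take.
  apply: run_seq; first by apply: run_copy; rewrite catrevE all_cat all_rev ser_letters.
  apply: run_seq; first by apply: run_transfer; rewrite -val_eqE /= !inordK.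
  rewrite /=.
  suff -> : ser x ++ ser x ++ s = catrev (catrev (catrev (catrev (ser x) [::]) [::]) [::])
      (catrev (catrev (ser x) [::]) s).
    by apply: run_transfer; rewrite -val_eqE /= !inordK.
  by rewrite !catrevE !cats0 !revK.
by rewrite /= !catrevE !cats0 !size_rev; move: (size (ser x)) => m; lia.
Qed.

(** The detour of the first tree through [RB] and [RK] makes its number of reversals even, and [RK]
    is empty whenever [take_tree] counts on it. *)
Definition swap_trees :=
  Seq take_tree (Seq (transfer RA RB) (Seq take_tree (Seq (transfer RB RK)
    (Seq (transfer RK RS) (transfer RA RS))))).

Lemma run_swap x y i s :
  run swap_trees (stacks i (ser x ++ ser y ++ s)) (40 * (size (ser x) + size (ser y)) + 40)
    (stacks i (ser y ++ ser x ++ s)).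
Proof.
apply: run_leq; last first.
  apply: run_seq; first exact: run_take.
  apply: run_seq; first by apply: run_transfer; rewrite -val_eqE /= !inordK.
  apply: run_seq; first exact: run_take.
  apply: run_seq; first by apply: run_transfer; rewrite -val_eqE /= !inordK.
  apply: run_seq; first by apply: run_transfer; rewrite -val_eqE /= !inordK.
  suff -> : ser y ++ ser x ++ s = catrev (catrev (ser y) [::])
      (catrev (catrev (catrev (catrev (ser x) [::]) [::]) [::]) s).
    by apply: run_transfer; rewrite -val_eqE /= !inordK.
  by rewrite !catrevE !cats0 !revK.
by rewrite /= !catrevE !cats0 !size_rev; move: (size (ser x)) => m; lia.
Qed.

Fixpoint push_word (w : seq letter) :=
  if w is a :: w' then Seq (push_word w') (Push RS a) else Ret true.

Lemma run_push_word w i s a b k :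
  run (push_word w) (Store i s a b k) (2 * size w + 1) (Store i (w ++ s) a b k).
Proof.
elim: w => [|c w IH] /=; first exact: execs_run (execs_ret _ _).
have -> : 2 * (size w).+1 + 1 = 2 * size w + 1 + 2 by lia.
apply: run_seq IH _; exact: run_push.
Qed.

(** Codes of different types are meant to coincide: a nonempty list has the code of the pair of its
    head and tail, [true] that of [[:: tt]], and [Some b] that of [[:: b]]. This lets [pt_cons],
    [pt_if] and the case analyses reuse programs without conversion. *)
Class Enc (A : Type) := enc : A -> tree.

Instance enc_unit : Enc unit := fun _ => Leaf.
Instance enc_bool : Enc bool := fun b => if b then Node Leaf Leaf else Leaf.
Instance enc_letter : Enc letter := fun a => if a is Some b then Node (enc b) Leaf else Leaf.
Instance enc_prod A B `{Enc A} `{Enc B} : Enc (A * B) := fun x => Node (enc x.1) (enc x.2).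
Instance enc_seq A `{Enc A} : Enc (seq A) :=
  fix F l := if l is a :: l' then Node (enc a) (F l') else Leaf.

(** * Sizes and polynomial bounds *)

Definition sz A `{Enc A} (x : A) : nat := size (ser (enc x)).

Lemma leq_pow2 m n d : m <= n -> m.+2 ^ d <= n.+2 ^ d.
Proof. by case: d => // d; rewrite leq_exp2r. Qed.

Lemma sz_pair A B `{Enc A} `{Enc B} (x : A) (y : B) : sz (x, y) = (sz x + sz y).+1.
Proof. by rewrite /sz /= size_cat. Qed.

Lemma sz_cons A `{Enc A} (a : A) (l : seq A) : sz (a :: l) = (sz a + sz l).+1.
Proof. by rewrite /sz /= size_cat. Qed.

Lemma sz_seq A `{Enc A} (l : seq A) : sz l = (\sum_(a <- l) (sz a).+1).+1.
Proof. by elim: l => [|a l IH]; rewrite ?big_nil // sz_cons IH big_cons addnS. Qed.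

Lemma sz_gt0 A `{Enc A} (x : A) : 0 < sz x.
Proof. by rewrite /sz; case: (enc x). Qed.

(** The base is at least 2, so constants and sums are absorbed by a larger exponent. *)
Definition pb A `{Enc A} (T : A -> nat) := exists d, forall x, T x <= (sz x).+2 ^ d.

Section PolynomialBounds.
Context (A : Type) `{Enc A}.
Implicit Types T U : A -> nat.

Lemma pb_leq U T : pb U -> (forall x, T x <= U x) -> pb T.
Proof. by move=> [d Ud] le; exists d => x; apply: leq_trans (le x) (Ud x). Qed.

Lemma pb_sz : pb (@sz A _).
Proof. by exists 1 => x; rewrite expn1 !leqW. Qed.

Lemma pb_const c : pb (fun _ : A => c).
Proof.
exists c => x; case: c => // c.
by apply: leq_trans (ltnW (ltn_expl c.+1 (isT : 1 < 2))) _; rewrite leq_exp2r.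
Qed.

Lemma pb_add T U : pb T -> pb U -> pb (fun x => T x + U x).
Proof.
move=> [d Td] [e Ue]; exists (d + e).+1 => x; rewrite expnS.
apply: (@leq_trans (2 * (sz x).+2 ^ (d + e))); last by rewrite leq_mul2r orbT.
by rewrite mul2n -addnn leq_add // (leq_trans (Td x), leq_trans (Ue x)) // leq_exp2l // ?leq_addr ?leq_addl.
Qed.

Lemma pb_mul T U : pb T -> pb U -> pb (fun x => T x * U x).
Proof. by move=> [d Td] [e Ue]; exists (d + e) => x; rewrite expnD leq_mul. Qed.

Lemma pb_exp T d : pb T -> pb (fun x => T x ^ d).
Proof. by move=> [e Te]; exists (e * d) => x; rewrite expnM; case: d => // d; rewrite leq_exp2r. Qed.

Lemma pb_succ T : pb T -> pb (fun x => (T x).+1).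
Proof. by move=> /(pb_add (pb_const 1)) /pb_leq; apply. Qed.

Lemma pb_comp B `{Enc B} (f : A -> B) (T : B -> nat) :
  pb (fun x => sz (f x)) -> pb T -> pb (fun x => T (f x)).
Proof.
move=> fb [d Td]; apply: pb_leq (fun x => Td (f x)).
by apply: pb_exp; do 2 apply: pb_succ.
Qed.

End PolynomialBounds.

(** The output bound accompanies the running time because a composition runs its second program on
    the output of the first. The untouched rest [s] of the stack lets a program run while other
    values are waiting below. *)
Definition PT A B `{Enc A} `{Enc B} (f : A -> B) :=
  pb (fun x => sz (f x)) /\
  exists p T, pb T /\ forall x i s,
    run p (stacks i (ser (enc x) ++ s)) (T x) (stacks i (ser (enc (f x)) ++ s)).

Lemma pt_sz A B `{Enc A} `{Enc B} (f : A -> B) : PT f -> pb (fun x => sz (f x)).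
Proof. by case. Qed.

Ltac pb_tac := repeat first
  [ exact: pb_const | exact: pb_sz | eassumption | solve [apply: pt_sz; eassumption]
  | apply: pb_add | apply: pb_mul | apply: pb_succ | apply: pb_exp ].

Section Combinators.
Context (X Y Z A : Type) `{Enc X} `{Enc Y} `{Enc Z} `{Enc A}.

Lemma pt_coerce (f : X -> Y) : (forall x, enc (f x) = enc x) -> PT f.
Proof.
move=> fE; split; first by apply: pb_leq (@pb_sz X _) _ => x; rewrite /sz fE.
exists (Ret true), (fun _ => 1); split; first exact: pb_const.
by move=> x i s; rewrite fE; apply: execs_run (execs_ret _ _).
Qed.

(** Programs see only codes, so a function may be replaced by another one with the same codes, even
    if its values have another type. *)
Lemma pt_eq (f : X -> Y) (g : X -> Z) : PT f -> (forall x, enc (f x) = enc (g x)) -> PT g.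
Proof.
move=> [fb [p [T [Tb Hp]]]] fg; split; first by apply: pb_leq fb _ => x; rewrite /sz fg.
by exists p, T; split => // x i s; rewrite -fg.
Qed.

Lemma pt_comp (f : X -> Y) (g : Y -> Z) : PT f -> PT g -> PT (fun x => g (f x)).
Proof.
move=> [fb [p [T [Tb Hp]]]] [gb [q [U [Ub Hq]]]]; split; first exact: pb_comp gb.
exists (Seq p q), (fun x => T x + U (f x)); split; first by apply: pb_add (pb_comp _ _).
by move=> x i s; apply: run_seq.
Qed.

Lemma pt_const (c : Y) : PT (fun _ : X => c).
Proof.
split; first exact: pb_const.
exists (Seq drop_tree (push_word (ser (enc c)))).
exists (fun x => 30 * sz x + 30 + (2 * sz c + 1)); split.
  by pb_tac.
by move=> x i s; apply: run_seq; [exact: run_drop | exact: run_push_word].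
Qed.

Lemma pt_pair (f : X -> Y) (g : X -> Z) : PT f -> PT g -> PT (fun x => (f x, g x)).
Proof.
move=> [fb [p [T [Tb Hp]]]] [gb [q [U [Ub Hq]]]]; split.
  by apply: pb_leq (pb_succ (pb_add fb gb)) _ => x; rewrite sz_pair.
exists (Seq dup_tree (Seq p (Seq swap_trees (Seq q (Seq swap_trees (Push RS node)))))).
exists (fun x => 40 * sz x + 30 + (T x + (40 * (sz (f x) + sz x) + 40 +
  (U x + (40 * (sz (g x) + sz (f x)) + 40 + 2))))); split.
  by pb_tac.
move=> x i s; apply: run_seq; first exact: run_dup.
apply: run_seq; first exact: Hp.
apply: run_seq; first exact: run_swap.
apply: run_seq; first exact: Hq.
apply: run_seq; first exact: run_swap.
by rewrite /= -catA; exact: run_push.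
Qed.

Lemma pt_proj1 : PT (@fst X Y).
Proof.
split; first by apply: pb_leq (@pb_sz (X * Y) _) _ => -[x y]; rewrite sz_pair /=; lia.
exists (Seq (Pop RS) (Seq swap_trees drop_tree)).
exists (fun x => 100 * sz x + 100); split.
  by pb_tac.
move=> [x y] i s; apply: run_leq; last first.
  apply: run_seq; first exact: run_pop.
  rewrite /= -catA; apply: run_seq; first exact: run_swap.
  exact: run_drop.
by rewrite sz_pair /sz; move: (size _) (size _) => m1 m2; lia.
Qed.

Lemma pt_proj2 : PT (@snd X Y).
Proof.
split; first by apply: pb_leq (@pb_sz (X * Y) _) _ => -[x y]; rewrite sz_pair /=; lia.
exists (Seq (Pop RS) drop_tree).
exists (fun x => 100 * sz x + 100); split.
  by pb_tac.
move=> [x y] i s; apply: run_leq; last first.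
  apply: run_seq; first exact: run_pop.
  by rewrite /= -catA; exact: run_drop.
by rewrite sz_pair /sz; move: (size _) (size _) => m1 m2; lia.
Qed.

End Combinators.

Lemma pt_id X `{Enc X} : PT (fun x : X => x).
Proof. exact: pt_coerce. Qed.

Lemma pt_fst X Y Z `{Enc X} `{Enc Y} `{Enc Z} (f : X -> Y * Z) : PT f -> PT (fun x => (f x).1).
Proof. by move=> Pf; apply: (@pt_comp X (Y * Z) Y _ _ _ f fst Pf); apply: pt_proj1. Qed.

Lemma pt_snd X Y Z `{Enc X} `{Enc Y} `{Enc Z} (f : X -> Y * Z) : PT f -> PT (fun x => (f x).2).
Proof. by move=> Pf; apply: (@pt_comp X (Y * Z) Z _ _ _ f snd Pf); apply: pt_proj2. Qed.

Lemma pt_case X Y A `{Enc X} `{Enc Y} `{Enc A}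
    (l : X -> seq A) (f : X -> Y) (g : X * (A * seq A) -> Y) :
  PT l -> PT f -> PT g ->
  PT (fun x => match l x with [::] => f x | a :: l' => g (x, (a, l')) end).
Proof.
move=> Pl [fb [p [T [[d Td] Hp]]]] [[e ge] [q [U [[d' Ud] Hq]]]].
apply: (@pt_comp X (seq A * X) Y _ _ _ (fun x => (l x, x))
  (fun y => match y.1 with [::] => f y.2 | a :: l' => g (y.2, (a, l')) end)).
  exact: pt_pair Pl (@pt_id X _).
split.
  move: fb => [d0 fd]; exists (d0 + e) => -[[|a l'] x]; rewrite /= sz_pair.
    apply: leq_trans (fd x) _; apply: (@leq_trans ((sz x).+2 ^ (d0 + e))).
      by rewrite leq_exp2l // leq_addr.
    by apply: leq_pow2; lia.
  apply: leq_trans (ge _) _; rewrite !sz_pair sz_cons.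
  apply: (@leq_trans ((((sz a + sz l').+1 + sz x).+1).+2 ^ e)); last first.
    by rewrite leq_exp2l // leq_addl.
  by apply: leq_pow2; lia.
(* Removing the [Node] of the pair exposes the list. If it is nonempty, its tree is that of
   [(a, l')], and a swap followed by a new [Node] gives [(x, (a, l'))]. *)
exists (Seq (Pop RS) (Ite (Test RS node)
   (Seq swap_trees (Seq (Push RS node) q)) (Seq (Pop RS) p))).
exists (fun y => 100 * sz y + 100 + (sz y).+2 ^ d + (sz y).+2 ^ d'); split.
  by pb_tac.
move=> [[|a l'] x] i s.
  apply: run_leq; last first.
    apply: run_seq; first exact: run_pop.
    apply: run_test => /=; apply: run_seq; first exact: run_pop.
    exact: Hp.
  have := Td x; rewrite sz_pair /= => h.
  have : (sz x).+2 ^ d <= ((sz ([::] : seq A) + sz x).+1).+2 ^ d.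
    by apply: leq_pow2; lia.
  by move: (_ ^ d) (_ ^ d) (_ ^ d') (T x) h => ? ? ? ?; lia.
apply: run_leq; last first.
  apply: run_seq; first exact: run_pop.
  apply: run_test => /=.
  rewrite (_ : _ :: _ = ser (Node (enc a) (enc l')) ++ ser (enc x) ++ s); last by rewrite /= -!catA.
  apply: run_seq; first exact: run_swap.
  apply: run_seq; first exact: run_push.
  rewrite [set _ _ _](_ : _ = stacks i (ser (enc (x, (a, l'))) ++ s));
    last by rewrite /= -!catA /= -!catA.
  exact: Hq.
have := Ud (x, (a, l')).
have -> : sz (x, (a, l')) = sz (a :: l', x) by rewrite !sz_pair sz_cons; lia.
rewrite (_ : size (ser (Node (enc a) (enc l'))) = (sz a + sz l').+1); last by rewrite /= size_cat.
rewrite -/(sz x); move: (_ ^ d) (_ ^ d') (U _) => u v w h.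
by rewrite sz_pair sz_cons; lia.
Qed.

(* The bound [B] on the accumulators is what makes iteration polynomial. *)
Lemma pt_foldl X S A `{Enc X} `{Enc S} `{Enc A} (B : X -> nat)
    (l : X -> seq A) (s0 : X -> S) (step : X * S * A -> S) :
  PT l -> PT s0 -> PT step -> pb B ->
  (forall x l1 l2, l x = l1 ++ l2 ->
     sz (foldl (fun s a => step (x, s, a)) (s0 x) l1) <= B x) ->
  PT (fun x => foldl (fun s a => step (x, s, a)) (s0 x) (l x)).
Proof.
move=> Pl Ps Pstep Bb HB.
pose F x l1 := foldl (fun s a => step (x, s, a)) (s0 x) l1.
have [Ib [pI [TI [TIb HI]]]] : PT (fun x => (l x, (x, s0 x))).
  by apply: pt_pair => //; apply: pt_pair Ps; apply: pt_id.
(* The body of the loop: its argument [((a, l2), (x, s))] has the same code as the loop state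
   [(a :: l2, (x, s))]. *)
have [_ [p [T [[d Td] Hp]]]] : PT (fun y : (A * seq A) * (X * S) =>
    (y.1.2, (y.2.1, step (y.2, y.1.1)))).
  apply: pt_pair; first by apply: pt_snd; apply: pt_fst; apply: pt_id.
  apply: pt_pair; first by apply: pt_fst; apply: pt_snd; apply: pt_id.
  apply: (@pt_comp _ (X * S * A) S _ _ _ (fun y : (A * seq A) * (X * S) => (y.2, y.1.1)) step) => //.
  by apply: pt_pair; [apply: pt_snd; apply: pt_id | do 2 apply: pt_fst; apply: pt_id].
have [_ [q [U [[e Ue] Hq]]]] : PT (fun y : seq A * (X * S) => y.2.2).
  by do 2 apply: pt_snd; apply: pt_id.
split; first by apply: pb_leq Bb _ => x; apply: HB (l x) [::] _; rewrite cats0.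
pose (W := fun x : X => (sz (l x) + (sz x + B x).+1).+1).
have Wb : pb W by rewrite /W; do 3 pb_tac; exact: pt_sz.
(* The root of the state is popped to look at the list below it, then pushed back. *)
pose loop := While (Seq (Pop RS) (Ite (Test RS node)
  (Seq (Push RS node) (Seq p (Ret true))) (Seq (Push RS node) (Ret false)))).
exists (Seq pI (Seq loop q)).
exists (fun x => TI x + (sz (l x) * (6 + (W x).+2 ^ d) + 6 + (W x).+2 ^ e)); split.
  by pb_tac; exact: pt_sz.
move=> x i s; apply: run_seq; first exact: HI.
have WE l1 l2 : l x = l1 ++ l2 -> sz (l2, (x, F x l1)) <= W x.
  move=> lE; rewrite !sz_pair /W ltnS leq_add //; last by rewrite ltnS leq_add // (HB x l1 l2).
  by rewrite lE !sz_seq big_cat /=; lia.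
(* Loop invariant: the state holds the remaining list and the fold of the part already read. *)
have L : forall l2 l1, l x = l1 ++ l2 ->
    run loop (stacks i (ser (enc (l2, (x, F x l1))) ++ s))
      (size l2 * (6 + (W x).+2 ^ d) + 6) (stacks i (ser (enc ([::] : seq A, (x, F x (l x)))) ++ s)).
  elim=> [|a l2 IH] l1 lE.
    rewrite lE cats0; exists false; apply: execs_while_false.
    apply: (@execs_leq _ _ (2 + (1 + (2 + 1)))) => //; apply: execs_seq; first exact: run_pop.
    apply: execs_test => /=; apply: execs_seq; first exact: run_push.
    exact: execs_ret.
  have lE' : l x = rcons l1 a ++ l2 by rewrite cat_rcons.
  have [b IH'] := IH _ lE'; exists b.
  apply: (@execs_leq _ _ (6 + (W x).+2 ^ d + (size l2 * (6 + (W x).+2 ^ d) + 6))).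
    by rewrite mulSn addnA.
  apply: execs_while_true IH'.
  apply: (@execs_leq _ _ (2 + (1 + (2 + (T ((a, l2), (x, F x l1)) + 1))))).
    have : T ((a, l2), (x, F x l1)) <= (W x).+2 ^ d.
      apply: leq_trans (Td _) _; apply: leq_pow2.
      by have := WE l1 (a :: l2) lE; rewrite !sz_pair sz_cons.
    by move: (T _) (_ ^ d) => ? ?; lia.
  apply: execs_seq; first exact: run_pop.
  apply: execs_test => /=; apply: execs_seq; first exact: run_push.
  apply: execs_seq (execs_ret true _).
  have := Hp ((a, l2), (x, F x l1)) i s.
  by rewrite /F foldl_rcons.
apply: run_seq.
  apply: run_leq (L (l x) [::] erefl); rewrite leq_add2r leq_mul2r; apply/orP; right.
  by rewrite sz_seq; elim: (l x) => //= a l' IH; rewrite big_cons; lia.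
apply: run_leq (Hq ([::], (x, F x (l x))) i s).
apply: leq_trans (Ue _) _; apply: leq_pow2.
by apply: (WE (l x) [::]); rewrite cats0.
Qed.

Definition enc_word : seq letter -> tree := enc.

Definition push_letter (a : letter) := Seq (push_word (ser (enc a))) (Push RS node).

(** The first transfer reverses the input, so that the list is built from its last letter on. *)
Definition load :=
  Seq (transfer RI RA) (Seq (Push RS leaf)
   (While (Ite (Test RA (Some true)) (Seq (Pop RA) (push_letter (Some true)))
          (Ite (Test RA (Some false)) (Seq (Pop RA) (push_letter (Some false)))
          (Ite (Test RA None) (Seq (Pop RA) (push_letter None)) (Ret false)))))).

Lemma run_load w :
  run load (Store w [::] [::] [::] [::]) (40 * size w + 40) (stacks [::] (ser (enc w))).
Proof.
apply: (@run_leq _ _ (7 * size w + 4 + (2 + (30 * size w + 4)))); first by lia.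
apply: run_seq; first by apply: run_transfer; rewrite -val_eqE /= !inordK.
apply: run_seq; first exact: run_push.
rewrite /= catrevE cats0.
suff L : forall l1 l2, execs (While (Ite (Test RA (Some true)) (Seq (Pop RA) (push_letter (Some true)))
          (Ite (Test RA (Some false)) (Seq (Pop RA) (push_letter (Some false)))
          (Ite (Test RA None) (Seq (Pop RA) (push_letter None)) (Ret false)))))
   (Store [::] (ser (enc_word l2)) (rev l1) [::] [::]) (30 * size l1 + 4) (stacks [::] (ser (enc_word (l1 ++ l2)))) false.
  by exists false; have := L w [::]; rewrite cats0; exact.
elim/last_ind => [|l1 a IH] l2.
  apply: execs_while_false; do 3 (apply: execs_test => /=); exact: execs_ret.
rewrite size_rcons rev_rcons cat_rcons.
have -> : 30 * (size l1).+1 + 4 = 30 + (30 * size l1 + 4) by lia.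
apply: execs_while_true (IH (a :: l2)).
have P : execs (push_letter a) (Store [::] (ser (enc_word l2)) (rev l1) [::] [::]) 15
    (Store [::] (ser (enc_word (a :: l2))) (rev l1) [::] [::]) true.
  apply: (@execs_leq _ _ (2 * size (ser (enc_letter a)) + 1 + 2)); first by case: a => [[]|].
  rewrite [ser (enc_word (_ :: _))]/=; apply: execs_seq; first exact: run_push_word.
  exact: execs_push.
have Q : execs (Seq (Pop RA) (push_letter a))
    (Store [::] (ser (enc_word l2)) (a :: rev l1) [::] [::]) 17
    (Store [::] (ser (enc_word (a :: l2))) (rev l1) [::] [::]) true.
  by apply: (@execs_seq _ _ _ _ 2 15) P; exact: run_pop.
case: a Q {P} => [[]|] Q.
- by apply: (@execs_leq _ _ (1 + 17)) => //; apply: execs_test.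
- by apply: (@execs_leq _ _ (1 + (1 + 17))) => //; do 2 apply: execs_test.
- by apply: (@execs_leq _ _ (1 + (1 + (1 + 17)))) => //; do 3 apply: execs_test.
Qed.

Lemma sz_letter (a : letter) : sz a <= 5.
Proof. by case: a => [[]|]. Qed.

Lemma sz_word (w : seq letter) : sz w <= (6 * size w).+1.
Proof.
by elim: w => // a w IH; rewrite sz_cons mulnS ltnS -[6]/(5.+1) addSnnS leq_add ?sz_letter.
Qed.

Theorem pt_machine (f : seq letter -> bool) : PT f ->
  exists (M : machine letter) (c d : nat), forall w,
    answers_within M (c * size w ^ d + c) w (f w).
Proof.
move=> [_ [p [T [[d Td] Hp]]]].
exists (machine_of (Seq load (Seq p (Test RS node)))).
(* For words of length [n > 0], [40 n + 41 <= 81 n^(d+1)] and [6 (n + 1) <= 12 n]; the additive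
   constant takes care of [n = 0]. *)
exists (81 + 12 ^ d.+1), d.+1 => w.
have szw : (sz w).+2 <= 6 * (size w).+1.
  by move: (sz w) (size w) (sz_word w) => m k; lia.
have [t let_ H] : execs (Seq load (Seq p (Test RS node))) (Store w [::] [::] [::] [::])
    (40 * size w + 40 + (T w + 1)) (stacks [::] (ser (enc (f w)))) (f w).
  apply: execs_seq; first exact: run_load.
  apply: execs_seq; first by have := Hp w [::] [::]; rewrite !cats0; exact.
  by exists 1 => //; have := exec_test RS node (stacks [::] (ser (enc (f w)))); case: (f w).
apply: exec_answers H _ _; apply: leq_trans let_ _;
  apply: leq_trans (_ : _ <= 40 * size w + 41 + (sz w).+2 ^ d.+1) _.
  have : T w <= (sz w).+2 ^ d.+1 by apply: leq_trans (Td w) _; rewrite leq_exp2l.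
  by move: (_ ^ _) (T w) (size w) => ? ? ?; lia.
apply: (@leq_trans (40 * size w + 41 + (6 * (size w).+1) ^ d.+1)).
  by rewrite leq_add2l leq_exp2r.
move: (size w) => n {szw}.
case: (posnP n) => [->|n0].
  by rewrite muln0 muln1 exp0n // muln0 !add0n leq_add // leq_exp2r.
have : n <= n ^ d.+1 by rewrite -{1}[n]expn1 leq_pexp2l.
have : (6 * n.+1) ^ d.+1 <= 12 ^ d.+1 * n ^ d.+1.
  by rewrite -expnMn leq_exp2r //; lia.
by move: ((6 * n.+1) ^ d.+1) (12 ^ d.+1) (n ^ d.+1) => ? ? ?; nia.
Qed.

(** * Lists and binary arithmetic *)

Lemma pt_cons X A `{Enc X} `{Enc A} (a : X -> A) (l : X -> seq A) :
  PT a -> PT l -> PT (fun x => a x :: l x).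
Proof. by move=> Pa Pl; apply: (pt_eq (pt_pair Pa Pl)). Qed.

Lemma pt_match X Y A `{Enc X} `{Enc Y} `{Enc A}
    (l : X -> seq A) (f : X -> Y) (g : X -> A -> seq A -> Y) :
  PT l -> PT f -> PT (fun y : X * (A * seq A) => g y.1 y.2.1 y.2.2) ->
  PT (fun x => match l x with [::] => f x | a :: l' => g x a l' end).
Proof. exact: (@pt_case X Y A _ _ _ l f (fun y => g y.1 y.2.1 y.2.2)). Qed.

Lemma pt_behead X A `{Enc X} `{Enc A} (l : X -> seq A) : PT l -> PT (fun x => behead (l x)).
Proof.
move=> Pl; apply: pt_match => //; first exact: pt_const.
by do 2 apply: pt_snd; apply: pt_id.
Qed.

Lemma pt_head X A `{Enc X} `{Enc A} (d : A) (l : X -> seq A) : PT l -> PT (fun x => head d (l x)).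
Proof.
move=> Pl; apply: pt_match => //; first exact: pt_const.
by apply: pt_fst; apply: pt_snd; apply: pt_id.
Qed.

Lemma pt_if X Y `{Enc X} `{Enc Y} (b : X -> bool) (f g : X -> Y) :
  PT b -> PT f -> PT g -> PT (fun x => if b x then f x else g x).
Proof.
move=> Pb Pf Pg.
apply: (@pt_eq X _ _ _ _ _ (fun x => match nseq (b x) tt with [::] => g x | a :: l' => f x end)).
  apply: pt_match => //; first by apply: (pt_eq Pb) => x; case: (b x).
  by apply: (@pt_comp (X * (unit * seq unit)) X Y _ _ _ fst) => //; apply: pt_fst; apply: pt_id.
by move=> x; case: (b x).
Qed.

Lemma pt_and X `{Enc X} (b c : X -> bool) : PT b -> PT c -> PT (fun x => b x && c x).
Proof. by move=> Pb Pc; apply: pt_if => //; apply: pt_const. Qed.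

Lemma pt_fold X S A `{Enc X} `{Enc S} `{Enc A} (B : X -> nat)
    (l : X -> seq A) (s0 : X -> S) (step : X -> S -> A -> S) :
  PT l -> PT s0 -> PT (fun y : X * S * A => step y.1.1 y.1.2 y.2) -> pb B ->
  (forall x l1 l2, l x = l1 ++ l2 -> sz (foldl (step x) (s0 x) l1) <= B x) ->
  PT (fun x => foldl (step x) (s0 x) (l x)).
Proof.
move=> Pl Ps Pstep Bb HB.
exact: (@pt_foldl X S A _ _ _ B l s0 (fun y => step y.1.1 y.1.2 y.2)).
Qed.

Lemma pt_rev X A `{Enc X} `{Enc A} (l : X -> seq A) : PT l -> PT (fun x => rev (l x)).
Proof.
move=> Pl; pose step (_ : X) (s : seq A) a := a :: s.
have stepE x l1 : foldl (step x) [::] l1 = rev l1.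
  by elim/last_ind: l1 => // l1 a IH; rewrite foldl_rcons IH rev_rcons.
apply: (@pt_eq X _ _ _ _ _ (fun x => foldl (step x) [::] (l x))); last by move=> x; rewrite stepE.
apply: (@pt_fold X (seq A) A _ _ _ (fun x => sz (l x))) => //.
- exact: pt_const.
- apply: pt_cons; first by apply: pt_snd; apply: pt_id.
  by apply: pt_snd; apply: pt_fst; apply: pt_id.
- exact: pt_sz.
- by move=> x l1 l2 ->; rewrite stepE !sz_seq big_rev big_cat /=; lia.
Qed.

Lemma size_sz A `{Enc A} (l : seq A) : size l <= sz l.
Proof. by elim: l => //= a l IH; rewrite sz_cons ltnS (leq_trans IH) // leq_addl. Qed.

Lemma pb_sum X A `{Enc X} `{Enc A} (l : X -> seq A) (T : X -> A -> nat) :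
  PT l -> pb (fun y : X * A => T y.1 y.2) -> pb (fun x => \sum_(a <- l x) T x a).
Proof.
move=> Pl [d Td].
apply: (@pb_leq _ _ (fun x => sz (l x) * ((sz x + sz (l x)).+1).+2 ^ d)).
  by pb_tac; exact: pt_sz.
move=> x; apply: (@leq_trans (size (l x) * ((sz x + sz (l x)).+1).+2 ^ d)); last first.
  by rewrite leq_mul2r size_sz orbT.
elim: (l x) => [|a l' IH]; first by rewrite big_nil.
rewrite big_cons /= mulSn leq_add //.
  apply: leq_trans (Td (x, a)) _; apply: leq_pow2; rewrite sz_pair sz_cons; lia.
apply: leq_trans IH _; rewrite leq_mul2l; apply/orP; right.
apply: leq_pow2; rewrite sz_cons; lia.
Qed.

Lemma pt_map X A Y `{Enc X} `{Enc A} `{Enc Y} (l : X -> seq A) (F : X -> A -> Y) :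
  PT l -> PT (fun y : X * A => F y.1 y.2) -> PT (fun x => [seq F x a | a <- l x]).
Proof.
move=> Pl PF; pose step (x : X) (s : seq Y) a := F x a :: s.
have stepE x l1 : foldl (step x) [::] l1 = rev [seq F x a | a <- l1].
  by elim/last_ind: l1 => // l1 a IH; rewrite foldl_rcons IH map_rcons rev_rcons.
apply: (@pt_eq X _ _ _ _ _ (fun x => rev (foldl (step x) [::] (l x)))); last by move=> x;
  rewrite stepE revK.
apply: pt_rev.
apply: (@pt_fold X (seq Y) A _ _ _ (fun x => (\sum_(a <- l x) (sz (F x a)).+1).+1)) => //.
- exact: pt_const.
- apply: pt_cons; last by apply: pt_snd; apply: pt_fst; apply: pt_id.
  apply: (@pt_comp _ (X * A) Y _ _ _ (fun y : X * seq Y * A => (y.1.1, y.2)) _ _ PF).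
  by apply: pt_pair; [do 2 apply: pt_fst | apply: pt_snd]; apply: pt_id.
- by apply: pb_succ; apply: pb_sum => //; apply: pb_succ; exact: (pt_sz PF).
- by move=> x l1 l2 ->; rewrite stepE sz_seq big_rev big_map big_cat /=; lia.
Qed.

Lemma pt_cat X A `{Enc X} `{Enc A} (l1 l2 : X -> seq A) :
  PT l1 -> PT l2 -> PT (fun x => l1 x ++ l2 x).
Proof.
move=> P1 P2; pose step (_ : X) (s : seq A) a := a :: s.
have stepE x l s : foldl (step x) s l = catrev l s by elim: l s => //= a l IH s; rewrite IH.
apply: (@pt_eq X _ _ _ _ _ (fun x => foldl (step x) (l2 x) (rev (l1 x)))); last first.
  by move=> x; rewrite stepE catrevE revK.
apply: (@pt_fold X (seq A) A _ _ _ (fun x => sz (l1 x) + sz (l2 x))) => //.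
- exact: pt_rev.
- apply: pt_cons; first by apply: pt_snd; apply: pt_id.
  by apply: pt_snd; apply: pt_fst; apply: pt_id.
- by apply: pb_add; apply: pt_sz.
- move=> x k1 k2 /(congr1 rev); rewrite revK stepE catrevE rev_cat => ->.
  by rewrite !sz_seq !big_cat /=; lia.
Qed.

Lemma pt_flatten X A `{Enc X} `{Enc A} (l : X -> seq (seq A)) :
  PT l -> PT (fun x => flatten (l x)).
Proof.
move=> Pl; pose step (_ : X) (s : seq A) a := s ++ a.
have stepE x k : foldl (step x) [::] k = flatten k.
  by elim/last_ind: k => // k a IH; rewrite foldl_rcons IH flatten_rcons.
apply: (@pt_eq X _ _ _ _ _ (fun x => foldl (step x) [::] (l x))); last by move=> x; rewrite stepE.
apply: (@pt_fold X (seq A) (seq A) _ _ _ (fun x => sz (l x))) => //.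
- exact: pt_const.
- by apply: pt_cat; [apply: pt_snd; apply: pt_fst | apply: pt_snd]; apply: pt_id.
- exact: pt_sz.
- move=> x k1 k2 ->; rewrite stepE; elim: k1 => [|a k1 IH] /=.
    by rewrite sz_seq big_nil; apply: sz_gt0.
  by rewrite sz_cons; move: IH; rewrite [sz (a ++ _)]sz_seq big_cat !sz_seq /=; lia.
Qed.

Lemma pt_filter X A `{Enc X} `{Enc A} (l : X -> seq A) (P : X -> A -> bool) :
  PT l -> PT (fun y : X * A => P y.1 y.2) -> PT (fun x => [seq a <- l x | P x a]).
Proof.
move=> Pl PP; apply: (@pt_eq X _ _ _ _ _ (fun x => flatten [seq if P x a then [:: a] else [::] | a <- l x])).
  apply: pt_flatten; apply: pt_map => //; apply: pt_if => //; last exact: pt_const.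
  by apply: pt_cons; [apply: pt_snd; apply: pt_id | apply: pt_const].
by move=> x; congr enc; elim: (l x) => //= a k <-; case: (P x a).
Qed.

Lemma pt_all X A `{Enc X} `{Enc A} (l : X -> seq A) (P : X -> A -> bool) :
  PT l -> PT (fun y : X * A => P y.1 y.2) -> PT (fun x => all (P x) (l x)).
Proof.
move=> Pl PP; pose step (x : X) s a := if s then P x a else false.
have stepE x k : foldl (step x) true k = all (P x) k.
  by elim/last_ind: k => // k a IH; rewrite foldl_rcons IH all_rcons andbC.
apply: (@pt_eq X bool _ _ _ _ (fun x => foldl (step x) true (l x))); last by move=> x;
  rewrite stepE.
apply: (@pt_fold X bool A _ _ _ (fun x => 3)) => //.
- exact: pt_const.
- apply: pt_if; [by apply: pt_snd; apply: pt_fst; apply: pt_id | | exact: pt_const].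
  apply: (@pt_comp _ (X * A) bool _ _ _ (fun y : X * bool * A => (y.1.1, y.2)) _ _ PP).
  by apply: pt_pair; [do 2 apply: pt_fst | apply: pt_snd]; apply: pt_id.
- exact: pb_const.
- by move=> x k1 k2 _; case: (foldl _ _ _).
Qed.

(* Binary digits, least significant first, without leading zeros. *)
Fixpoint digits_rec (k n : nat) : seq bool :=
  if k is k'.+1 then if n == 0 then [::] else odd n :: digits_rec k' n./2 else [::].

Definition digits (n : nat) : seq bool := digits_rec n n.

(** Without leading zeros the code is canonical, and its size is linear in the bit length. *)
Instance enc_nat : Enc nat := fun n => enc (digits n).

Definition horner2 (l : seq bool) : nat := foldl (fun v (d : bool) => d + v.*2) 0 l.

Lemma digits_recE k n : n <= k -> digits_rec k n = digits n.
Proof.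
elim/ltn_ind: n k => n IH k; rewrite /digits; case: n IH => [|n] IH; case: k => //= k nk.
rewrite !IH // ?uphalf_half; lia.
Qed.

Lemma digitsE n : digits n = if n == 0 then [::] else odd n :: digits n./2.
Proof.
by rewrite {1}/digits; case: n => //= n; rewrite digits_recE // uphalf_half; lia.
Qed.

Lemma digits_double (b : bool) n : digits (b + n.*2) =
  if (n == 0) && ~~ b then [::] else b :: digits n.
Proof.
rewrite digitsE; have -> : (b + n.*2 == 0) = (n == 0) && ~~ b by case: b n => [] [].
case: ifP => // _; rewrite oddD odd_double addbF half_bit_double.
by case: b.
Qed.

Lemma horner2_cons b l : horner2 (b :: l) = b * 2 ^ size l + horner2 l.
Proof.
rewrite /horner2 /= addn0.
suff E v k : foldl (fun v (d : bool) => d + v.*2) v k = v * 2 ^ size k + foldl (fun v (d : bool) => d + v.*2) 0 k by exact: E.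
elim: k v => [|c k IH] v /=; first by rewrite muln1 addn0.
rewrite IH [in RHS]IH expnS; lia.
Qed.

Lemma horner2_rcons l b : horner2 (rcons l b) = b + (horner2 l).*2.
Proof. by rewrite /horner2 foldl_rcons. Qed.

Lemma horner2_lt l : horner2 l < 2 ^ size l.
Proof. by elim: l => // b l IH; rewrite horner2_cons /= expnS; case: b; lia. Qed.

Lemma horner2_digits n : horner2 (rev (digits n)) = n.
Proof.
elim/ltn_ind: n => n IH; rewrite digitsE; case: eqP => [->|/eqP n0] //.
by rewrite rev_cons horner2_rcons IH ?odd_double_half //; lia.
Qed.

(** * Bit length *)

Definition blen n := size (digits n).

Lemma blen_lt n : n < 2 ^ blen n.
Proof. by rewrite /blen -size_rev -{1}(horner2_digits n) horner2_lt. Qed.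

Lemma blen_leq n k : n < 2 ^ k -> blen n <= k.
Proof.
rewrite /blen; elim: k n => [|k IH] n; first by case: n.
by rewrite digitsE; case: eqP => // _ h; rewrite /= ltnS IH //; move: h; rewrite expnS; lia.
Qed.

Lemma leq_blen : {homo blen : m n / m <= n}.
Proof. by move=> m n mn; apply: blen_leq; apply: leq_ltn_trans mn (blen_lt n). Qed.

Lemma blenD m n : blen (m + n) <= blen m + blen n.
Proof.
apply: blen_leq; rewrite expnD; have := blen_lt m; have := blen_lt n.
move: (2 ^ _) (2 ^ _) => a b; nia.
Qed.

Lemma blenM m n : blen (m * n) <= blen m + blen n.
Proof.
apply: blen_leq; rewrite expnD; have := blen_lt m; have := blen_lt n.
move: (2 ^ _) (2 ^ _) => a b; nia.
Qed.

Lemma blen_sz n : blen n <= sz n.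
Proof. exact: (size_sz (digits n)). Qed.

Lemma sz_bool (b : bool) : sz b <= 3.
Proof. by case: b. Qed.

Lemma sz_bools (l : seq bool) : sz l <= (4 * size l).+1.
Proof.
by elim: l => // b l IH; rewrite sz_cons mulnS ltnS -[4]/(3.+1) addSnnS leq_add ?sz_bool.
Qed.

Lemma sz_nat n : sz n <= (4 * blen n).+1.
Proof. exact: sz_bools. Qed.

Lemma pt_digits X `{Enc X} (n : X -> nat) : PT n -> PT (fun x => digits (n x)).
Proof. by move=> Pn; apply: (pt_eq Pn). Qed.

Lemma pt_of_digits X `{Enc X} (n : X -> nat) : PT (fun x => digits (n x)) -> PT n.
Proof. by move=> Pn; apply: (pt_eq Pn). Qed.

Lemma pt_odd X `{Enc X} (n : X -> nat) : PT n -> PT (fun x => odd (n x)).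
Proof.
move=> Pn; apply: (@pt_eq X bool bool _ _ _ (fun x => head false (digits (n x)))).
  by apply: pt_head; exact: pt_digits.
by move=> x; rewrite digitsE; case: eqP => // ->.
Qed.

Lemma pt_half X `{Enc X} (n : X -> nat) : PT n -> PT (fun x => (n x)./2).
Proof.
move=> /pt_digits /pt_behead Pn; apply: pt_of_digits; apply: (pt_eq Pn) => x.
by rewrite digitsE; case: eqP => // ->.
Qed.

Lemma pt_eq0 X `{Enc X} (n : X -> nat) : PT n -> PT (fun x => n x == 0).
Proof.
move=> /pt_digits Pn.
apply: (@pt_eq X bool _ _ _ _ (fun x => match digits (n x) with [::] => true | a :: l' => false end)).
  by apply: pt_match => //; apply: pt_const.
by move=> x; rewrite digitsE; case: eqP.
Qed.

Lemma pt_double X `{Enc X} (b : X -> bool) (n : X -> nat) :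
  PT b -> PT n -> PT (fun x => b x + (n x).*2).
Proof.
move=> Pb Pn; apply: pt_of_digits.
apply: (@pt_eq X _ _ _ _ _ (fun x => if (if n x == 0 then (if b x then false else true) else false)
   then [::] else b x :: digits (n x))).
  apply: pt_if; last by apply: pt_cons => //; apply: pt_digits.
    apply: pt_if; [exact: pt_eq0 | | exact: pt_const].
    by apply: pt_if => //; apply: pt_const.
  exact: pt_const.
by move=> x; rewrite digits_double; case: eqP => //=; case: (b x).
Qed.

Lemma pt_horner2 X `{Enc X} (l : X -> seq bool) : PT l -> PT (fun x => horner2 (l x)).
Proof.
move=> Pl; apply: (@pt_fold X nat bool _ _ _ (fun x => (4 * sz (l x)).+1)) => //.
- exact: pt_const.
- by apply: pt_double; [apply: pt_snd | apply: pt_snd; apply: pt_fst]; apply: pt_id.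
- by pb_tac; apply: pt_sz.
- move=> x l1 l2 lE; apply: leq_trans (sz_nat _) _; rewrite ltnS leq_mul2l /=.
  apply: leq_trans (blen_leq (horner2_lt l1)) _; apply: leq_trans (size_sz _).
  by rewrite lE size_cat leq_addr.
Qed.

Lemma pt_bool3 (f : bool -> bool -> bool -> bool * bool) X `{Enc X} (a b c : X -> bool) :
  PT a -> PT b -> PT c -> PT (fun x => f (a x) (b x) (c x)).
Proof.
move=> Pa Pb Pc.
apply: (@pt_eq X _ _ _ _ _ (fun x =>
  if a x then if b x then if c x then f true true true else f true true false
              else if c x then f true false true else f true false false
  else if b x then if c x then f false true true else f false true false
              else if c x then f false false true else f false false false)).
  by do ![apply: pt_if => // | exact: pt_const].
by move=> x; case: (a x); case: (b x); case: (c x).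
Qed.

(* [f x y c] is the digit to write and the next carry, when the current digits
   are [x] and [y] and the carry is [c]; the digits are produced in reverse. *)
Definition ripple_step (f : bool -> bool -> bool -> bool * bool)
    (s : nat * nat * (bool * seq bool)) : nat * nat * (bool * seq bool) :=
  let r := f (odd s.1.1) (odd s.1.2) s.2.1 in
  (s.1.1./2, s.1.2./2, (r.2, r.1 :: s.2.2)).

(** The list folded over is only a clock: [blen a + blen b + 1] rounds exhaust both numbers and
    absorb the last carry of a sum. *)
Definition ripple f a b :=
  (foldl (fun s (_ : bool) => ripple_step f s) (a, b, (false, [::]))
     (true :: digits a ++ digits b)).2.

Definition ripple_fuel a b := (blen a + blen b).+1.

Lemma foldl_ripple f s (l : seq bool) :
  foldl (fun s _ => ripple_step f s) s l = iter (size l) (ripple_step f) s.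
Proof. by elim: l s => // c l IH s; rewrite /= IH -iterSr. Qed.

Lemma rippleE f a b : ripple f a b =
  (iter (ripple_fuel a b) (ripple_step f) (a, b, (false, [::]))).2.
Proof. by rewrite /ripple foldl_ripple /= size_cat. Qed.

Lemma iter_ripple f a b c k : let s := iter k (ripple_step f) (a, b, c) in
  [/\ s.1.1 <= a, s.1.2 <= b & size s.2.2 = size c.2 + k].
Proof.
elim: k => [|k [IHa IHb IHc]] /=; first by rewrite addn0.
by split; [lia | lia | rewrite IHc addnS].
Qed.

Lemma pt_ripple f X `{Enc X} (a b : X -> nat) :
  PT a -> PT b -> PT (fun x => ripple f (a x) (b x)).
Proof.
move=> Pa Pb; apply: pt_snd.
have P1 : PT (fun x => true :: digits (a x) ++ digits (b x)).
  by apply: pt_cons; [exact: pt_const | apply: pt_cat; apply: pt_digits].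
apply: (@pt_fold X _ bool _ _ _ (fun x => 100 + 4 * sz (a x) + 4 * sz (b x) +
   4 * sz (true :: digits (a x) ++ digits (b x)))) => //.
- by apply: pt_pair; [apply: pt_pair | exact: pt_const].
- have Ps : PT (fun y : X * (nat * nat * (bool * seq bool)) * bool => y.1.2).
    by apply: pt_snd; apply: pt_fst; apply: pt_id.
  have Pr : PT (fun y : X * (nat * nat * (bool * seq bool)) * bool =>
     f (odd y.1.2.1.1) (odd y.1.2.1.2) y.1.2.2.1).
    apply: pt_bool3; [apply: pt_odd | apply: pt_odd | apply: pt_fst; exact: pt_snd].
      by do 2 apply: pt_fst.
    by apply: pt_snd; apply: pt_fst.
  apply: pt_pair; first by apply: pt_pair; apply: pt_half; [apply: pt_fst | apply: pt_snd];
    apply: pt_fst.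
  apply: pt_pair; first exact: pt_snd.
  apply: pt_cons; first exact: pt_fst Pr.
  by do 2 apply: pt_snd.
- by pb_tac.
- move=> x l1 l2 lE; rewrite foldl_ripple.
  have [] := iter_ripple f (a x) (b x) (false, [::]) (size l1).
  case: (iter _ _ _) => [[a' b'] [c' o]] /= /leq_blen la /leq_blen lb lo.
  have hs : size l1 <= sz (true :: digits (a x) ++ digits (b x)).
    by apply: leq_trans (size_sz _); rewrite lE size_cat leq_addr.
  rewrite !sz_pair; move: (sz_nat a') (sz_nat b') (sz_bool c') (sz_bools o) (blen_sz (a x)) (blen_sz (b x)).
  by move: la lb lo hs; move: (sz a') (sz b') (sz c') (sz o) (sz (a x)) (sz (b x)) (sz (_ :: _)) (size o) (size l1)
    (blen (a x)) (blen (b x)) (blen a') (blen b') => *; lia.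
Qed.

Definition add_digit x y c := (x (+) y (+) c, if x then y || c else y && c).

Definition sub_digit x y c := (x (+) y (+) c, if x then y && c else y || c).

Lemma rippleP f a b : let s := iter (ripple_fuel a b) (ripple_step f) (a, b, (false, [::])) in
  s.1.1 = 0 /\ s.1.2 = 0.
Proof.
have E k : let s := iter k (ripple_step f) (a, b, (false, [::])) in
    s.1.1 = a %/ 2 ^ k /\ s.1.2 = b %/ 2 ^ k.
  elim: k => [|k [IHa IHb]] /=; first by rewrite !divn1.
  by rewrite IHa IHb -!divn2 -!divnMA -!expnSr.
have [/= -> ->] := E (ripple_fuel a b).
by split; apply: divn_small; [apply: leq_trans (blen_lt a) _ | apply: leq_trans (blen_lt b) _];
   rewrite leq_exp2l // /ripple_fuel leqW // ?leq_addr ?leq_addl.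
Qed.

(** Invariant: after [k] rounds, the number written so far plus [2^k] times the rest of both numbers
    and the carry is [a + b]. The last carry is 0 because [a + b < 2^(blen a + blen b + 1)]. *)
Lemma addn_ripple a b : horner2 (ripple add_digit a b).2 = a + b.
Proof.
have E k : let s := iter k (ripple_step add_digit) (a, b, (false, [::])) in
    a + b = 2 ^ k * (s.1.1 + s.1.2 + s.2.1) + horner2 s.2.2.
  elim: k => [|k]; first by rewrite /= mul1n !addn0.
  have [_ _] := iter_ripple add_digit a b (false, [::]) k.
  rewrite iterS; case: (iter _ _ _) => [[x y] [c o]] /=.
  rewrite horner2_cons add0n => -> ->.
  rewrite expnS -{1}(odd_double_half x) -{1}(odd_double_half y).
  by case: (odd x); case: (odd y); case: c; rewrite /=; nia.
have [s1 s2] := rippleP add_digit a b.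
have [_ _ so] := iter_ripple add_digit a b (false, [::]) (ripple_fuel a b).
move: (E (ripple_fuel a b)); rewrite rippleE; move: s1 s2 so.
case: (iter _ _ _) => [[x y] [c o]] /= -> -> _ h; rewrite h.
suff -> : c = false by rewrite muln0.
apply: contraTF (leqnn (a + b)) => c1; rewrite -ltnNge [X in _ < X]h c1 muln1.
have := blen_lt a; have := blen_lt b; rewrite /ripple_fuel expnS expnD.
by move: (2 ^ _) (2 ^ _) => u v; nia.
Qed.

(** The invariant avoids subtraction by moving the borrow to the other side. The final borrow is set
    exactly when [a < b], where truncated subtraction gives 0. *)
Lemma subn_ripple a b :
  (if (ripple sub_digit a b).1 then 0 else horner2 (ripple sub_digit a b).2) = a - b.
Proof.
have E k : let s := iter k (ripple_step sub_digit) (a, b, (false, [::])) in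
    a + 2 ^ k * (s.1.2 + s.2.1) = b + 2 ^ k * s.1.1 + horner2 s.2.2.
  elim: k => [|k]; first by rewrite /= !mul1n !addn0 addnC.
  have [_ _] := iter_ripple sub_digit a b (false, [::]) k.
  rewrite iterS; case: (iter _ _ _) => [[x y] [c o]] /=.
  rewrite horner2_cons add0n => ->.
  rewrite expnS -{1}(odd_double_half x) -{1}(odd_double_half y).
  by case: (odd x); case: (odd y); case: c; rewrite /=; nia.
have [s1 s2] := rippleP sub_digit a b.
have [_ _ so] := iter_ripple sub_digit a b (false, [::]) (ripple_fuel a b).
move: (E (ripple_fuel a b)); rewrite rippleE; move: s1 s2 so.
case: (iter _ _ _) => [[x y] [c o]] /= -> ->; rewrite add0n muln0 addn0 => so.
have := horner2_lt o; rewrite so; case: c; first by rewrite muln1; lia.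
by rewrite muln0; lia.
Qed.

Lemma pt_addn X `{Enc X} (a b : X -> nat) : PT a -> PT b -> PT (fun x => a x + b x).
Proof.
move=> Pa Pb; apply: (@pt_eq X nat nat _ _ _ (fun x => horner2 (ripple add_digit (a x) (b x)).2)).
  by apply: pt_horner2; apply: pt_snd; apply: pt_ripple.
by move=> x; rewrite addn_ripple.
Qed.

Lemma pt_subn X `{Enc X} (a b : X -> nat) : PT a -> PT b -> PT (fun x => a x - b x).
Proof.
move=> Pa Pb; apply: (@pt_eq X nat nat _ _ _ (fun x =>
   if (ripple sub_digit (a x) (b x)).1 then 0 else horner2 (ripple sub_digit (a x) (b x)).2)).
  apply: pt_if; [apply: pt_fst; exact: pt_ripple | exact: pt_const |].
  by apply: pt_horner2; apply: pt_snd; apply: pt_ripple.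
by move=> x; rewrite subn_ripple.
Qed.

Lemma pt_muln X `{Enc X} (a b : X -> nat) : PT a -> PT b -> PT (fun x => a x * b x).
Proof.
move=> Pa Pb.
(* Horner's rule over the digits of [a], most significant first; [false +] gives the doubling the
   form that [pt_double] expects. *)
pose step (x : X) v (d : bool) := (if d then b x else 0) + (false + v.*2).
have stepE x l : foldl (step x) 0 l = horner2 l * b x.
  elim/last_ind: l => // l d IH; rewrite foldl_rcons horner2_rcons IH /step.
  by case: d; rewrite ?add0n ?add1n -!muln2 /=; nia.
apply: (@pt_eq X nat nat _ _ _ (fun x => foldl (step x) 0 (rev (digits (a x))))); last first.
  by move=> x; rewrite stepE horner2_digits.
apply: (@pt_fold X nat bool _ _ _ (fun x => 4 * (sz (a x) + sz (b x)) + 1)) => //.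
- by apply: pt_rev; apply: pt_digits.
- exact: pt_const.
- apply: pt_addn.
    apply: pt_if; [by apply: pt_snd; apply: pt_id | | exact: pt_const].
    apply: (@pt_comp _ X nat _ _ _ (fun y : X * nat * bool => y.1.1) b) => //.
    by do 2 apply: pt_fst; apply: pt_id.
  by apply: pt_double; [exact: pt_const | apply: pt_snd; apply: pt_fst; apply: pt_id].
- by pb_tac.
- move=> x l1 l2 lE; rewrite stepE addn1; apply: leq_trans (sz_nat _) _.
  rewrite ltnS leq_mul2l /=; apply: leq_trans (blenM _ _) _.
  apply: leq_add (blen_sz _); apply: leq_trans (blen_leq (horner2_lt l1)) _.
  apply: leq_trans (blen_sz (a x)); rewrite /blen -(size_rev (digits _)) lE size_cat leq_addr //.
Qed.

Lemma pt_leq X `{Enc X} (a b : X -> nat) : PT a -> PT b -> PT (fun x => a x <= b x).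
Proof. by move=> Pa Pb; apply: pt_eq0; apply: pt_subn. Qed.

Lemma pt_eqn X `{Enc X} (a b : X -> nat) : PT a -> PT b -> PT (fun x => a x == b x).
Proof.
move=> Pa Pb; apply: (@pt_eq X bool bool _ _ _ (fun x => (a x <= b x) && (b x <= a x))).
  by apply: pt_and; apply: pt_leq.
by move=> x; rewrite -eqn_leq.
Qed.

Lemma pt_prod X A `{Enc X} `{Enc A} (l : X -> seq A) (F : X -> A -> nat) :
  PT l -> PT (fun y : X * A => F y.1 y.2) -> PT (fun x => \prod_(a <- l x) F x a).
Proof.
move=> Pl PF; pose step (x : X) v a := v * F x a.
have stepE x k : foldl (step x) 1 k = \prod_(a <- k) F x a.
  by elim/last_ind: k => [|k a IH]; rewrite ?big_nil // foldl_rcons IH big_rcons.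
apply: (@pt_eq X nat nat _ _ _ (fun x => foldl (step x) 1 (l x))); last by move=> x; rewrite stepE.
apply: (@pt_fold X nat A _ _ _ (fun x => (4 * (\sum_(a <- l x) sz (F x a)).+1).+1)) => //.
- exact: pt_const.
- apply: pt_muln; first by apply: pt_snd; apply: pt_fst; apply: pt_id.
  apply: (@pt_comp _ (X * A) nat _ _ _ (fun y : X * nat * A => (y.1.1, y.2)) _ _ PF).
  by apply: pt_pair; [do 2 apply: pt_fst | apply: pt_snd]; apply: pt_id.
- have S : pb (fun x => \sum_(a <- l x) sz (F x a)) by apply: pb_sum => //; exact: (pt_sz PF).
  by pb_tac.
- move=> x k1 k2 ->; rewrite stepE; apply: leq_trans (sz_nat _) _; rewrite ltnS leq_mul2l /=.
  rewrite big_cat /= -addSn; apply: leq_trans (leq_addr _ _).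
  elim: k1 => [|a k IH]; first by rewrite !big_nil.
  rewrite !big_cons -addnS; apply: leq_trans (blenM _ _) _; exact: leq_add (blen_sz _) IH.
Qed.

(** * Integers, matrices and the Faddeev-LeVerrier test *)

Import Order.TTheory GRing.Theory Num.Theory.

Ltac pt_step :=
  match goal with
  | |- PT (fun x => x) => exact: pt_id
  | |- PT (fun x => ?c) => exact: pt_const
  | H : PT ?f |- PT ?g => constr_eq f g; exact: H
  | H : PT ?f |- PT (fun x => ?f (@?h x)) => apply: (@pt_comp _ _ _ _ _ _ h f _ H)
  | |- PT (@fst _ _) => exact: pt_proj1
  | |- PT (@snd _ _) => exact: pt_proj2
  | |- PT (fun x => fst _) => apply: pt_fst
  | |- PT (fun x => snd _) => apply: pt_snd
  | |- PT (fun x => (_, _)) => apply: pt_pair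
  | |- PT (fun x => _ :: _) => apply: pt_cons
  | |- PT (fun x => _ ++ _) => apply: pt_cat
  | |- PT (fun x => if _ then _ else _) => apply: pt_if
  | |- PT (fun x => andb _ _) => apply: pt_and
  | |- PT (fun x => addn _ _) => apply: pt_addn
  | |- PT (fun x => subn _ _) => apply: pt_subn
  | |- PT (fun x => muln _ _) => apply: pt_muln
  | |- PT (fun x => leq _ _) => apply: pt_leq
  | |- PT (fun x => @eq_op _ _ _) => apply: pt_eqn
  | |- PT (fun x => map _ _) => apply: pt_map
  | |- PT (fun x => filter _ _) => apply: pt_filter
  | |- PT (fun x => all _ _) => apply: pt_all
  | |- PT (fun x => flatten _) => apply: pt_flatten
  | |- PT (fun x => rev _) => apply: pt_rev
  | |- PT (fun x => behead _) => apply: pt_behead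
  | |- PT (fun x => head _ _) => apply: pt_head
  | |- PT (fun x => horner2 _) => apply: pt_horner2
  end.

Ltac pt_tac := repeat pt_step.

Definition ipos (z : int) : nat := if z is Posz n then n else 0.
Definition ineg (z : int) : nat := if z is Negz n then n.+1 else 0.

(** One of the two parts is always 0, so the code is canonical, and integer arithmetic reduces to
    that of naturals. *)
Instance enc_int : Enc int := fun z => enc (ipos z, ineg z).

Lemma intE z : z = ((ipos z)%:Z - (ineg z)%:Z)%R.
Proof. by case: z => n /=; rewrite ?subr0 // NegzE sub0r. Qed.

Lemma sz_int z : sz z <= 4 * blen `|z| + 3.
Proof.
have -> : sz z = (sz (ipos z) + sz (ineg z)).+1 by rewrite -sz_pair.
by have := sz_nat `|z|; case: z => n /=; have -> : sz 0 = 1 by []; lia.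
Qed.

Lemma blen_int z : blen `|z| <= sz z.
Proof.
have -> : sz z = (sz (ipos z) + sz (ineg z)).+1 by rewrite -sz_pair.
by have := blen_sz `|z|; case: z => n /=; lia.
Qed.

Lemma pt_ipos X `{Enc X} (z : X -> int) : PT z -> PT (fun x => ipos (z x)).
Proof.
move=> Pz; apply: (@pt_fst X nat nat _ _ _ (fun x => (ipos (z x), ineg (z x)))).
exact: (pt_eq Pz).
Qed.

Lemma pt_ineg X `{Enc X} (z : X -> int) : PT z -> PT (fun x => ineg (z x)).
Proof.
move=> Pz; apply: (@pt_snd X nat nat _ _ _ (fun x => (ipos (z x), ineg (z x)))).
exact: (pt_eq Pz).
Qed.

(** The two truncated differences [a - b] and [b - a] are the positive and the negative part of the
    result. *)
Lemma pt_diff X `{Enc X} (a b : X -> nat) :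
  PT a -> PT b -> PT (fun x => (a x)%:Z - (b x)%:Z)%R.
Proof.
move=> Pa Pb; apply: (@pt_eq X (nat * nat) int _ _ _ (fun x => (a x - b x, b x - a x))).
  by pt_tac.
move=> x; rewrite /enc /enc_int; congr enc; case: (leqP (b x) (a x)) => h.
  by rewrite subzn // (eqP h).
have -> : ((a x)%:Z - (b x)%:Z)%R = Negz (b x - a x).-1 by rewrite NegzE; lia.
by rewrite /= (eqP (ltnW h)); congr pair; lia.
Qed.

Lemma pt_posz X `{Enc X} (a : X -> nat) : PT a -> PT (fun x => Posz (a x)).
Proof.
move=> Pa; apply: (@pt_eq X int int _ _ _ (fun x => (a x)%:Z - 0%:Z)%R).
  by apply: pt_diff => //; exact: pt_const.
by move=> x; rewrite subr0.
Qed.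

Lemma pt_addz X `{Enc X} (a b : X -> int) : PT a -> PT b -> PT (fun x => a x + b x)%R.
Proof.
move=> Pa Pb; apply: (@pt_eq X int int _ _ _ (fun x =>
   (ipos (a x) + ipos (b x))%N%:Z - (ineg (a x) + ineg (b x))%N%:Z)%R).
  by apply: pt_diff; apply: pt_addn; (apply: pt_ipos || apply: pt_ineg).
by move=> x; congr enc; rewrite [in RHS](intE (a x)) [in RHS](intE (b x)) !PoszD; lia.
Qed.

Lemma pt_subz X `{Enc X} (a b : X -> int) : PT a -> PT b -> PT (fun x => a x - b x)%R.
Proof.
move=> Pa Pb; apply: (@pt_eq X int int _ _ _ (fun x =>
   (ipos (a x) + ineg (b x))%N%:Z - (ineg (a x) + ipos (b x))%N%:Z)%R).
  by apply: pt_diff; apply: pt_addn; (apply: pt_ipos || apply: pt_ineg).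
by move=> x; congr enc; rewrite [in RHS](intE (a x)) [in RHS](intE (b x)) !PoszD; lia.
Qed.

Lemma pt_mulz X `{Enc X} (a b : X -> int) : PT a -> PT b -> PT (fun x => a x * b x)%R.
Proof.
move=> Pa Pb; apply: (@pt_eq X int int _ _ _ (fun x =>
   (ipos (a x) * ipos (b x) + ineg (a x) * ineg (b x))%N%:Z
   - (ipos (a x) * ineg (b x) + ineg (a x) * ipos (b x))%N%:Z)%R).
  by apply: pt_diff; apply: pt_addn; apply: pt_muln; (apply: pt_ipos || apply: pt_ineg).
move=> x; congr enc; rewrite [in RHS](intE (a x)) [in RHS](intE (b x)) !PoszD !PoszM.
by ring.
Qed.

Lemma pt_ge0z X `{Enc X} (a : X -> int) : PT a -> PT (fun x => 0 <= a x)%R.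
Proof.
move=> Pa; apply: (@pt_eq X bool bool _ _ _ (fun x => ineg (a x) == 0)).
  by apply: pt_eqn; [apply: pt_ineg | exact: pt_const].
by move=> x; case: (a x).
Qed.

Lemma absz_leqD (x y : int) : `|(x + y)%R|%N <= `|x|%N + `|y|%N.
Proof. lia. Qed.

Lemma pt_sumz X A `{Enc X} `{Enc A} (l : X -> seq A) (F : X -> A -> int) :
  PT l -> PT (fun y : X * A => F y.1 y.2) -> PT (fun x => \sum_(a <- l x) F x a)%R.
Proof.
move=> Pl PF; pose step (x : X) (v : int) a := (v + F x a)%R.
have stepE x k : foldl (step x) 0%R k = (\sum_(a <- k) F x a)%R.
  by elim/last_ind: k => [|k a IH]; rewrite ?big_nil // foldl_rcons IH big_rcons.
apply: (@pt_eq X int int _ _ _ (fun x => foldl (step x) 0%R (l x))); last by move=> x;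
  rewrite stepE.
apply: (@pt_fold X int A _ _ _ (fun x => 4 * (\sum_(a <- l x) sz (F x a)) + 3)) => //.
- exact: pt_const.
- apply: pt_addz; first by pt_tac.
  apply: (@pt_comp _ (X * A) int _ _ _ (fun y : X * int * A => (y.1.1, y.2)) _ _ PF).
  by pt_tac.
- have S : pb (fun x => \sum_(a <- l x) sz (F x a)) by apply: pb_sum => //; exact: (pt_sz PF).
  by pb_tac.
- move=> x k1 k2 ->; rewrite stepE; apply: leq_trans (sz_int _) _; rewrite leq_add2r leq_mul2l /=.
  rewrite big_cat /=; apply: leq_trans (leq_addr _ _).
  elim: k1 => [|a k IH]; first by rewrite !big_nil.
  rewrite !big_cons; apply: leq_trans (leq_blen _) _; first exact: absz_leqD.
  apply: leq_trans (blenD _ _) _; exact: leq_add (blen_int _) IH.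
Qed.

(* A matrix is represented by the list of its entries, each with its position. *)
Definition mx_list := seq (nat * nat * int).

(** Lookup is phrased as a sum so that the program for sums serves it; missing entries read as 0. *)
Definition entry (A : mx_list) (i j : nat) : int :=
  (\sum_(e <- A) if (e.1.1 == i) && (e.1.2 == j) then e.2 else 0)%R.

Definition tabulate (L : seq nat) (f : nat -> nat -> int) : mx_list :=
  flatten [seq [seq (i, j, f i j) | j <- L] | i <- L].

Lemma pt_entry X `{Enc X} (A : X -> mx_list) (i j : X -> nat) :
  PT A -> PT i -> PT j -> PT (fun x => entry (A x) (i x) (j x)).
Proof. by move=> PA Pi Pj; apply: pt_sumz => //; pt_tac. Qed.

Lemma pt_tabulate X `{Enc X} (L : X -> seq nat) (f : X -> nat -> nat -> int) :
  PT L -> PT (fun y : X * nat * nat => f y.1.1 y.1.2 y.2) ->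
  PT (fun x => tabulate (L x) (f x)).
Proof. by move=> PL Pf; rewrite /tabulate; pt_tac. Qed.

Ltac pt_ring_step :=
  match goal with
  | _ => pt_step
  | |- PT (fun x => entry _ _ _) => apply: pt_entry
  | |- PT (fun x => tabulate _ _) => apply: pt_tabulate
  | |- PT (fun x => bigop.body _ _ _) => apply: pt_sumz
  | |- PT (fun x => Posz _) => apply: pt_posz
  | |- PT (fun x => GRing.add _ (GRing.opp _)) => apply: pt_subz
  | |- PT (fun x => GRing.add _ _) => apply: pt_addz
  | |- PT (fun x => GRing.mul _ _) => apply: pt_mulz
  | |- PT (fun x => Order.le _ _) => apply: pt_ge0z
  end.

Ltac pt_ring := repeat pt_ring_step.

Definition tr_mul (L : seq nat) (P A : mx_list) : int :=
  (\sum_(i <- L) \sum_(l <- L) entry P i l * entry A l i)%R.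

Lemma pt_tr_mul X `{Enc X} (L : X -> seq nat) (P A : X -> mx_list) :
  PT L -> PT P -> PT A -> PT (fun x => tr_mul (L x) (P x) (A x)).
Proof. by move=> PL PP PA; rewrite /tr_mul; pt_ring. Qed.

(* Faddeev-LeVerrier with the divisions cleared: [A] is [(k-1)!] times the usual
   auxiliary matrix, and [tr (P A)] is [k!] times the k-th elementary symmetric
   function of the eigenvalues of [P]. *)
Definition fl_next (L : seq nat) (P : mx_list) (k : nat) (A : mx_list) : mx_list :=
  tabulate L (fun i j => (if i == j then tr_mul L P A else 0)
                         - k%:Z * \sum_(l <- L) entry P i l * entry A l j)%R.

Definition fl_step (L : seq nat) (P : mx_list) (s : nat * mx_list * bool) :=
  (s.1.1.+1, fl_next L P s.1.1 s.1.2, if (0 <= tr_mul L P s.1.2)%R then s.2 else false).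

Definition fl_start (L : seq nat) : nat * mx_list * bool :=
  (1, tabulate L (fun i j => (if i == j then 1 else 0)%R), true).

(** [L] is both the index set and the clock that counts the rounds. *)
Definition psd_test (L : seq nat) (P : mx_list) : bool :=
  (foldl (fun s (_ : nat) => fl_step L P s) (fl_start L) L).2.

Definition norm1 (A : mx_list) : nat := \sum_(e <- A) `|e.2|%N.

Lemma absz_sum A (l : seq A) (F : A -> int) (c : nat) :
  (forall a, `|F a|%N <= c) -> `|(\sum_(a <- l) F a)%R|%N <= size l * c.
Proof.
move=> Fc; elim: l => [|a l IH]; first by rewrite big_nil.
by rewrite big_cons /= mulSn (leq_trans (absz_leqD _ _)) // leq_add.
Qed.

Lemma absz_entry A i j : `|entry A i j|%N <= norm1 A.
Proof.
rewrite /entry /norm1; elim: A => [|e A IH]; rewrite ?big_nil // !big_cons.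
by apply: leq_trans (absz_leqD _ _) _; apply: leq_add IH; case: ifP.
Qed.

Lemma norm1_tabulate L f c : (forall i j, `|f i j|%N <= c) ->
  norm1 (tabulate L f) <= size L * size L * c.
Proof.
move=> fc; rewrite /norm1 /tabulate big_flatten big_map /= -mulnA.
elim: {1 3}L => [|i k IH]; first by rewrite big_nil.
rewrite big_cons /= mulSn; apply: leq_add IH; rewrite big_map /=.
by elim: L => [|j L IH]; rewrite ?big_nil // big_cons /= mulSn leq_add.
Qed.

Lemma sz_tabulate L f c : (forall i j, `|f i j|%N <= c) ->
  sz (tabulate L f) <= (size L * size L * (2 * sz L + 4 * blen c + 10)).+1.
Proof.
move=> fc; rewrite [sz (tabulate _ _)]sz_seq ltnS /tabulate big_flatten big_map /= -mulnA.
have szin (k : seq nat) i k1 k2 : k = k1 ++ i :: k2 -> sz i <= sz k.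
  by move=> ->; rewrite !sz_seq big_cat big_cons /=; lia.
have E1 : forall k1 k2, L = k1 ++ k2 ->
    \sum_(i <- k2) \sum_(e <- [seq (i, j, f i j) | j <- L]) (sz e).+1 <=
    size k2 * (size L * (2 * sz L + 4 * blen c + 10)); last exact: (E1 [::]).
move=> k1 k2; elim: k2 k1 => [|i k2 IH] k1 Lk; first by rewrite big_nil.
rewrite big_cons /= mulSn; apply: leq_add; last by apply: (IH (rcons k1 i)); rewrite cat_rcons.
rewrite big_map; have szi := szin L i _ _ Lk.
have E2 : forall m1 m2, L = m1 ++ m2 -> \sum_(j <- m2) (sz (i, j, f i j)).+1 <=
    size m2 * (2 * sz L + 4 * blen c + 10); last exact: (E2 [::]).
move=> m1 m2; elim: m2 m1 => [|j m2 IH2] m1 Lm; first by rewrite big_nil.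
rewrite big_cons /= mulSn; apply: leq_add; last by apply: (IH2 (rcons m1 j)); rewrite cat_rcons.
have szj := szin L j _ _ Lm.
rewrite !sz_pair; have := sz_int (f i j); have := leq_blen (fc i j).
by move: (sz i) (sz j) (sz L) (sz (f i j)) (blen _) (blen _) szi szj => *; lia.
Qed.

(** With [n = size L] and [N = norm1 P], an entry of [P A] is at most [n * N * (n * n * c)]. The
    trace adds a factor [n], and so does the multiplier [k <= n]. *)
Lemma absz_fl_next L P k A c i j : norm1 A <= size L * size L * c -> k <= size L ->
  `|((if i == j then tr_mul L P A else 0)
     - k%:Z * \sum_(l <- L) entry P i l * entry A l j)%R|%N
  <= (2 * size L ^ 4 * norm1 P).+1 * c.
Proof.
move=> Ac kL; set n := size L; set N := norm1 P.
have E i' l' j' : `|(entry P i' l' * entry A l' j')%R|%N <= N * (n * n * c).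
  by rewrite abszM leq_mul ?absz_entry // (leq_trans (absz_entry _ _ _)).
have T : `|tr_mul L P A|%N <= n * (n * (N * (n * n * c))).
  by apply: absz_sum => i'; apply: absz_sum => l'.
have S : `|(\sum_(l <- L) entry P i l * entry A l j)%R|%N <= n * (N * (n * n * c)).
  exact: absz_sum.
apply: (@leq_trans (n * (n * (N * (n * n * c))) + n * (n * (N * (n * n * c))))).
  apply: leq_trans (absz_leqD _ _) _; rewrite abszN abszM; apply: leq_add.
    by case: ifP.
  by apply: leq_mul.
rewrite !expnS expn0 -/n -/N; move: n N c {E T S Ac kL} => n N c; nia.
Qed.

(** Each round multiplies the bound on the entries by a fixed factor, so their bit length grows only
    linearly with the number of rounds. *)
Lemma fl_state L P l1 l2 : L = l1 ++ l2 ->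
  let s := foldl (fun s _ => fl_step L P s) (fl_start L) l1 in
  s.1.1 = (size l1).+1 /\ exists2 f, s.1.2 = tabulate L f &
    forall i j, `|f i j|%N <= (2 * size L ^ 4 * norm1 P).+1 ^ size l1.
Proof.
elim/last_ind: l1 l2 => [|l1 a IH] l2 LE /=.
  split=> //; exists (fun i j => if i == j then 1 else 0)%R => // i j.
  by case: (i == j).
have [|] := IH (a :: l2); first by rewrite LE cat_rcons.
rewrite foldl_rcons size_rcons; case: (foldl _ _ _) => [[k A] b] /= -> [f -> fb].
split=> //; eexists; first reflexivity.
move=> i j; rewrite expnS; apply: absz_fl_next; first exact: norm1_tabulate.
by rewrite LE size_cat size_rcons leq_addr.
Qed.

Lemma blenX n k : blen (n ^ k) <= (k * blen n).+1.
Proof.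
elim: k => [|k IH]; first by rewrite expn0.
by rewrite expnS mulSn -addnS; apply: leq_trans (blenM _ _) _; rewrite leq_add2l.
Qed.

Lemma blen_id n : blen n <= n.
Proof. by apply: blen_leq; apply: ltn_expl. Qed.

Lemma blen_norm1 A : blen (norm1 A) <= sz A.
Proof.
rewrite /norm1; elim: A => [|e A IH]; first by rewrite big_nil.
rewrite big_cons sz_cons; apply: leq_trans (blenD _ _) _; rewrite -addSn; apply: leq_add IH.
by apply: leq_trans (blen_int _) _; case: e => p v; rewrite sz_pair /=; lia.
Qed.

Lemma pt_psd_test X `{Enc X} (L : X -> seq nat) (P : X -> mx_list) :
  PT L -> PT P -> PT (fun x => psd_test (L x) (P x)).
Proof.
move=> PL PP; rewrite /psd_test; apply: pt_snd.
(* [g] bounds the bit length of the factor by which the entries grow in one round. *)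
pose (g := fun x => 4 + (4 * sz (L x)).+1 + sz (P x)).
apply: (@pt_fold X (nat * mx_list * bool) nat _ _ _ (fun x => 4 * sz (L x) + 20 +
  sz (L x) * sz (L x) * (2 * sz (L x) + 4 * (sz (L x) * g x).+1 + 10)) L
  (fun x => fl_start (L x)) (fun x s (_ : nat) => fl_step (L x) (P x) s)) => //.
- by rewrite /fl_start; pt_ring.
- rewrite /fl_step /fl_next.
  have PT1 : PT (fun y : X * (nat * mx_list * bool) * nat => tr_mul (L y.1.1) (P y.1.1) y.1.2.1.2).
    by apply: pt_tr_mul; pt_ring.
  have PT2 : PT (fun y : X * (nat * mx_list * bool) * nat * nat * nat =>
      tr_mul (L y.1.1.1.1) (P y.1.1.1.1) y.1.1.1.2.1.2).
    by apply: pt_tr_mul; pt_ring.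
  apply: pt_pair; last by pt_ring.
  apply: pt_pair; first by rewrite /=;
    apply: pt_eq (_ : PT (fun y : X * (nat * mx_list * bool) * nat => 1 + y.1.2.1.1)) _ => //;
      pt_tac.
  by pt_ring.
- by rewrite /g; pb_tac.
- move=> x l1 l2 LE; have [] := fl_state (P x) LE.
  case: (foldl _ _ _) => [[k A] b] /= -> [f -> fb]; rewrite !sz_pair.
  have n_sz : size (L x) <= sz (L x) by exact: size_sz.
  have n_l1 : size l1 <= size (L x) by rewrite LE size_cat leq_addr.
  have kb : sz (size l1).+1 <= 4 * sz (L x) + 5.
    apply: leq_trans (sz_nat _) _; have := blen_id (size l1).+1.
    by move: n_sz n_l1; move: (sz (L x)) (size (L x)) (size l1) (blen _) => *; lia.
  have Ab := sz_tabulate (L x) fb.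
  have gb : blen ((2 * size (L x) ^ 4 * norm1 (P x)).+1 ^ size l1) <= (sz (L x) * g x).+1.
    apply: leq_trans (blenX _ _) _; rewrite ltnS leq_mul //.
      exact: leq_trans n_sz.
    rewrite -addn1; apply: leq_trans (blenD _ _) _; rewrite /g.
    apply: (@leq_trans (blen (2 * size (L x) ^ 4) + blen (norm1 (P x)) + 1)).
      by rewrite leq_add2r blenM.
    have := blen_norm1 (P x); have := blenM 2 (size (L x) ^ 4); have := blenX (size (L x)) 4.
    have := blen_id (size (L x)); have -> : blen 2 = 2 by [].
    by move: (blen _) (blen _) (blen _) (blen _) => *; lia.
  have bb := sz_bool b.
  apply: (@leq_trans ((4 * sz (L x) + 5 + (size (L x) * size (L x) *
     (2 * sz (L x) + 4 * (sz (L x) * g x).+1 + 10)).+1).+1 + 3).+1).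
    rewrite ltnS leq_add // ltnS leq_add //; apply: leq_trans Ab _.
    by rewrite ltnS leq_mul2l leq_add2r leq_add2l leq_mul2l gb !orbT.
  have : size (L x) * size (L x) * (2 * sz (L x) + 4 * (sz (L x) * g x).+1 + 10) <=
     sz (L x) * sz (L x) * (2 * sz (L x) + 4 * (sz (L x) * g x).+1 + 10).
    by rewrite leq_mul2r leq_mul // orbT.
  by move: (_ * _) (_ * (_ + 10)) => *; lia.
Qed.

(** * The decision procedure *)

Definition row_sum (L : seq nat) (H : mx_list) (i : nat) : int :=
  (\sum_(j <- L) entry H i j)%R.

Definition mx_sum (L : seq nat) (H : mx_list) : int := (\sum_(i <- L) row_sum L H i)%R.

(* Positive semidefinite iff [H] satisfies the reverse Cauchy-Schwarz
   inequality with respect to the all-ones vector. *)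
Definition lorentz_mx (L : seq nat) (H : mx_list) : mx_list :=
  tabulate L (fun i j => row_sum L H i * row_sum L H j - mx_sum L H * entry H i j)%R.

Definition triple := (nat * nat * nat)%type.

Definition coeff3 (A : seq (triple * nat)) (i j k : nat) : int :=
  (\sum_(e <- A) if [&& e.1.1.1 == i, e.1.1.2 == j & e.1.2 == k] then e.2%:Z else 0)%R.

(** For coefficients listed at sorted triples this is the third partial derivative: the permutations
    that fix the triple supply the factors 2 and 6 at repeated indices. *)
Definition deriv3 (A : seq (triple * nat)) (i j k : nat) : int :=
  (coeff3 A i j k + coeff3 A i k j + coeff3 A j i k
   + coeff3 A j k i + coeff3 A k i j + coeff3 A k j i)%R.

Definition lorentz_test (L : seq nat) (A : seq (triple * nat)) : bool :=
  all (fun k => psd_test L (lorentz_mx L (tabulate L (fun i j => deriv3 A i j k)))) L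
  && psd_test L (lorentz_mx L (tabulate L (fun i j => \sum_(k <- L) deriv3 A i j k)%R)).

Lemma pt_row_sum X `{Enc X} (L : X -> seq nat) (M : X -> mx_list) (i : X -> nat) :
  PT L -> PT M -> PT i -> PT (fun x => row_sum (L x) (M x) (i x)).
Proof. by move=> PL PM Pi; rewrite /row_sum; pt_ring. Qed.

Lemma pt_mx_sum X `{Enc X} (L : X -> seq nat) (M : X -> mx_list) :
  PT L -> PT M -> PT (fun x => mx_sum (L x) (M x)).
Proof. by move=> PL PM; rewrite /mx_sum; apply: pt_sumz => //; apply: pt_row_sum; pt_ring. Qed.

Lemma pt_lorentz_mx X `{Enc X} (L : X -> seq nat) (M : X -> mx_list) :
  PT L -> PT M -> PT (fun x => lorentz_mx (L x) (M x)).
Proof.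
move=> PL PM; apply: pt_tabulate => //.
apply: pt_subz; first by apply: pt_mulz; apply: pt_row_sum; pt_ring.
by apply: pt_mulz; [apply: pt_mx_sum | apply: pt_entry]; pt_ring.
Qed.

Lemma pt_coeff3 X `{Enc X} (A : X -> seq (triple * nat)) (i j k : X -> nat) :
  PT A -> PT i -> PT j -> PT k -> PT (fun x => coeff3 (A x) (i x) (j x) (k x)).
Proof. by move=> PA Pi Pj Pk; apply: pt_sumz => //; pt_ring. Qed.

Lemma pt_deriv3 X `{Enc X} (A : X -> seq (triple * nat)) (i j k : X -> nat) :
  PT A -> PT i -> PT j -> PT k -> PT (fun x => deriv3 (A x) (i x) (j x) (k x)).
Proof. by move=> PA Pi Pj Pk; rewrite /deriv3; do ![apply: pt_coeff3 => // | apply: pt_addz]. Qed.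

Lemma pt_lorentz_test X `{Enc X} (L : X -> seq nat) (A : X -> seq (triple * nat)) :
  PT L -> PT A -> PT (fun x => lorentz_test (L x) (A x)).
Proof.
move=> PL PA; apply: pt_and.
  apply: pt_all => //; apply: pt_psd_test; first by pt_ring.
  apply: pt_lorentz_mx; first by pt_ring.
  by apply: pt_tabulate; [|apply: pt_deriv3]; pt_ring.
apply: pt_psd_test => //; apply: pt_lorentz_mx => //; apply: pt_tabulate => //.
by apply: pt_sumz; [|apply: pt_deriv3]; pt_ring.
Qed.

(** Accumulation reverses each word, which puts the most significant bit first, as [horner2]
    wants. *)
Definition split_step (s : seq bool * seq (seq bool)) (a : letter) :=
  match a with Some b => (b :: s.1, s.2) | None => ([::], s.1 :: s.2) end.

(* The words ended by separators; each of them is reversed. *)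
Definition split_words (w : seq letter) : seq (seq bool) :=
  rev (foldl split_step ([::], [::]) w).2.

Lemma pt_split_words : PT split_words.
Proof.
rewrite /split_words; apply: pt_rev; apply: pt_snd.
apply: (@pt_fold (seq letter) _ letter _ _ _ (fun w => 3 + 10 * sz w) id (fun _ => ([::], [::])) (fun _ => split_step)).
- exact: pt_id.
- exact: pt_const.
- set X := (seq letter * (seq bool * seq (seq bool)) * letter)%type.
  (* [Some b] and [[:: b]] have the same code, so matching on a letter becomes matching on a
     list. *)
  have P1 : PT (fun y : X => if y.2 is Some b then [:: b] else [::]).
    by apply: (pt_eq (@pt_proj2 _ letter _ _)) => -[y [b|]].
  apply: (@pt_eq X _ _ _ _ _ (fun y : X =>
     match (if y.2 is Some b then [:: b] else [::]) with
     | [::] => ([::], y.1.2.1 :: y.1.2.2) | b :: l => (b :: y.1.2.1, y.1.2.2) end)).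
    by apply: pt_match => //; pt_tac.
  by move=> [y [b|]].
- by pb_tac.
- move=> w l1 l2 ->.
  have h : sz (foldl split_step ([::], [::]) l1) <= 3 + 10 * size l1; last first.
    apply: leq_trans h _; rewrite leq_add2l leq_mul2l /= (leq_trans _ (size_sz _)) //.
    by rewrite size_cat leq_addr.
  elim/last_ind: l1 => // l1 a; rewrite foldl_rcons size_rcons.
  case: (foldl _ _ _) => c o; rewrite !sz_pair; case: a => [b|] /=.
    by rewrite sz_pair sz_cons; have := sz_bool b; move: (sz b) (sz c) (sz o) => *; lia.
  by rewrite sz_pair sz_cons; have -> : sz ([::] : seq bool) = 1 by []; move: (sz c) (sz o) => *;
    lia.
Qed.

Definition index_list (u : seq bool) : seq nat := iota 0 (size u).

Lemma pt_index_list X `{Enc X} (u : X -> seq bool) : PT u -> PT (fun x => index_list (u x)).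
Proof.
move=> Pu; pose step (_ : X) (s : nat * seq nat) (_ : bool) := (1 + s.1, s.1 :: s.2).
have stepE x l : foldl (step x) (0, [::]) l = (size l, rev (iota 0 (size l))).
  elim/last_ind: l => // l b IH.
  by rewrite foldl_rcons IH size_rcons -addn1 iotaD rev_cat /step /= add1n addn1.
apply: (@pt_eq X _ _ _ _ _ (fun x => rev (foldl (step x) (0, [::]) (u x)).2)); last first.
  by move=> x; rewrite stepE revK.
apply: pt_rev; apply: pt_snd.
apply: (@pt_fold X _ bool _ _ _ (fun x => 10 + 5 * sz (u x) + sz (u x) * (5 * sz (u x)))) => //.
- exact: pt_const.
- by rewrite /step; pt_tac.
- by pb_tac.
- move=> x l1 l2 lE; rewrite stepE sz_pair [sz (rev _)]sz_seq big_rev.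
  have nm : size l1 <= sz (u x) by apply: leq_trans (size_sz _); rewrite lE size_cat leq_addr.
  have S m : m <= size l1 -> \sum_(i <- iota 0 m) (sz i).+1 <= m * (5 * size l1).
    elim: m => [|m IH] ml; first by rewrite big_nil.
    rewrite -addn1 iotaD big_cat /= big_cons big_nil mulnDl leq_add ?IH 1?ltnW //.
    have := sz_nat (0 + m); have := blen_id (0 + m); rewrite add0n.
    by move: ml; move: (size l1) (blen m) (sz m) => *; lia.
  have := S _ (leqnn _); have := sz_nat (size l1); have := blen_id (size l1).
  by move: nm; move: (size l1) (sz (u x)) (blen _) (sz (size l1)) (\sum_(i <- _) _) => *; nia.
Qed.

Definition index_triples (L : seq nat) : seq triple :=
  [seq t <- flatten [seq [seq (ij, k) | k <- L] | ij <- flatten [seq [seq (i, j) | j <- L] | i <- L]]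
  | (t.1.1 <= t.1.2) && (t.1.2 <= t.2)].

Lemma pt_index_triples X `{Enc X} (L : X -> seq nat) :
  PT L -> PT (fun x => index_triples (L x)).
Proof. by move=> PL; rewrite /index_triples; pt_tac. Qed.

Definition raw_entry := (triple * (seq bool * seq bool))%type.

Definition pair_step (s : seq (seq bool) * seq raw_entry) (t : triple) :=
  (behead (behead s.1), (t, (head [::] s.1, head [::] (behead s.1))) :: s.2).

Definition pair_words (B : seq (seq bool)) (T : seq triple) : seq raw_entry :=
  (foldl pair_step (B, [::]) T).2.

Lemma pt_pair_words X `{Enc X} (B : X -> seq (seq bool)) (T : X -> seq triple) :
  PT B -> PT T -> PT (fun x => pair_words (B x) (T x)).
Proof.
move=> PB PT_; apply: pt_snd.
apply: (@pt_fold X _ triple _ _ _ (fun x => 10 + sz (B x) + 10 * sz (T x)) T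
  (fun x => (B x, [::])) (fun _ => pair_step)) => //.
- by pt_tac.
- by rewrite /pair_step; pt_tac.
- by pb_tac.
- move=> x l1 l2 lE.
  have h : sz (foldl pair_step (B x, [::]) l1) <= sz (B x, [::] : seq raw_entry) + 10 * \sum_(t <- l1) (sz t).+1; last first.
    apply: leq_trans h _; rewrite sz_pair lE [sz (l1 ++ l2)]sz_seq big_cat /=.
    by have -> : sz ([::] : seq raw_entry) = 1; [|lia].
  elim/last_ind: l1 {l2 lE} => [|l1 t]; first by rewrite big_nil /= muln0 addn0.
  rewrite foldl_rcons big_rcons /=; case: (foldl _ _ _) => R o.
  rewrite /pair_step /= !sz_pair sz_cons !sz_pair.
  have E : sz (behead (behead R)) + sz (head [::] R) + sz (head [::] (behead R)) <= sz R + 2.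
    have n1 : sz ([::] : seq bool) = 1 by [].
    have n2 : sz ([::] : seq (seq bool)) = 1 by [].
    by case: R => [|r1 [|r2 R]] /=; rewrite ?sz_cons ?n1 ?n2; lia.
  move: E; move: (sz (B x) + _) (\sum_(_ <- l1) _) (sz t) (sz o) (sz R).
  by move: (sz (head [::] (behead R))) (sz (head [::] R)) (sz (behead (behead R))) => *; lia.
Qed.

(* Scaling by the product of all denominators makes the coefficients integral. *)
Definition cleared_entries (E : seq (triple * (nat * nat))) : seq (triple * nat) :=
  [seq (e.1, e.2.1 * \prod_(e' <- E)
     (if [&& e'.1.1.1 == e.1.1.1, e'.1.1.2 == e.1.1.2 & e'.1.2 == e.1.2] then 1 else e'.2.2)) | e <- E].

Definition decide_words (B : seq (seq bool)) : bool :=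
  let L := index_list (head [::] B) in
  lorentz_test L (cleared_entries
    [seq (e.1, (horner2 e.2.1, horner2 e.2.2)) | e <- pair_words (behead B) (index_triples L)]).

Definition decide (w : seq letter) : bool := decide_words (split_words w).

Lemma pt_cleared_entries X `{Enc X} (E : X -> seq (triple * (nat * nat))) :
  PT E -> PT (fun x => cleared_entries (E x)).
Proof. by move=> PE; rewrite /cleared_entries; pt_tac; apply: pt_prod; pt_tac. Qed.

Lemma pt_decide : PT decide.
Proof.
apply: (@pt_comp _ _ _ _ _ _ split_words decide_words); first exact: pt_split_words.
have PL : PT (fun B : seq (seq bool) => index_list (head [::] B)).
  by apply: pt_index_list; apply: pt_head; exact: pt_id.
apply: pt_lorentz_test => //; apply: pt_cleared_entries; apply: pt_map; last by pt_tac.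
by apply: pt_pair_words; [apply: pt_behead; exact: pt_id | apply: pt_index_triples].
Qed.

(** * Trilinear forms *)

Local Open Scope ring_scope.

Section BilinearForms.
Context (R : realFieldType) (I : Type).
Implicit Types (u v w : I -> R) (B : (I -> R) -> (I -> R) -> R).

Definition comb (a b : R) u v : I -> R := fun i => a * u i + b * v i.

Definition bilinear_sym B :=
  (forall a b u v w, B (comb a b u v) w = a * B u w + b * B v w) /\
  (forall u v, B u v = B v u).

Lemma bilinear_sym_comb B a b u v : bilinear_sym B ->
  B (comb a b u v) (comb a b u v) = a ^+ 2 * B u u + 2 * a * b * B u v + b ^+ 2 * B v v.
Proof. by move=> [Bl Bs]; rewrite Bl !(Bs _ (comb _ _ _ _)) !Bl (Bs v u); ring. Qed.

(** The vector [B(x,v) u - B(x,u) v] is [B]-orthogonal to [x]. Its value under the form, multiplied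
    by [B(u,u)], is a square plus [B(x,u)^2 (B(u,u) B(v,v) - B(u,v)^2)], and it is nonpositive. *)
Lemma reverse_cauchy_schwarz B x u v : bilinear_sym B ->
  (forall w, B x w = 0 -> B w w <= 0) -> 0 <= B u u -> B u u * B v v <= B u v ^+ 2.
Proof.
move=> Bb Bx; rewrite le_eqVlt => /orP[/eqP <-|uu]; first by rewrite mul0r sqr_ge0.
set a := B x v; set b := - B x u.
have : B x (comb a b u v) = 0.
  by case: Bb => Bl Bs; rewrite Bs Bl (Bs u) (Bs v) /a /b; ring.
move/Bx; rewrite bilinear_sym_comb //; set c := B u v; set d := B v v; set e := B u u in uu *.
have [b0|b0] := eqVneq b 0; last first.
  have : 0 < b ^+ 2 by rewrite lt_def sqr_ge0 sqrf_eq0 b0.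
  move=> b2 h; have : (a * e + b * c) ^+ 2 >= 0 by exact: sqr_ge0.
  move=> sq; suff : b ^+ 2 * (e * d - c ^+ 2) <= 0 by rewrite pmulr_rle0 // subr_le0.
  have : e * (a ^+ 2 * e + 2 * a * b * c + b ^+ 2 * d) <= 0 by rewrite pmulr_rle0.
  by move=> h2; nra.
have : B u u <= 0 by apply: Bx; move/eqP: b0; rewrite oppr_eq0 => /eqP.
by rewrite leNgt uu.
Qed.

Lemma psd_cauchy_schwarz B u v : bilinear_sym B -> (forall w, 0 <= B w w) ->
  B u v ^+ 2 <= B u u * B v v.
Proof.
move=> Bb Bp; have := Bp (comb (B v v) (- B u v) u v); rewrite bilinear_sym_comb //.
have := Bp v; rewrite le_eqVlt => /orP[/eqP v0|v0].
  have h t := Bp (comb 1 t u v); rewrite -v0 [B u u * 0]mulr0 => _.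
  have {}h t : 0 <= B u u + 2 * t * B u v.
    by have := h t; rewrite bilinear_sym_comb // -v0; nra.
  have [->|c0] := eqVneq (B u v) 0; first by rewrite expr0n.
  (* The parameter at which the affine function of [t] takes the value -1. *)
  have := h (- (B u u + 1) / (2 * B u v)).
  have -> : 2 * (- (B u u + 1) / (2 * B u v)) * B u v = - (B u u + 1) by field.
  by lra.
move=> h; have : 0 <= B v v * (B u u * B v v - B u v ^+ 2) by nra.
by rewrite pmulr_rge0 // subr_ge0.
Qed.

End BilinearForms.

(** * Symmetric trilinear forms with nonnegative coefficients *)

Section TrilinearForm.
Context (R : realFieldType) (n : nat) (tau : 'I_n -> 'I_n -> 'I_n -> R).
Hypothesis tau_sym12 : forall i j k, tau i j k = tau j i k.
Hypothesis tau_sym23 : forall i j k, tau i j k = tau i k j.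
Hypothesis tau_ge0 : forall i j k, 0 <= tau i j k.
Implicit Types u v w x : 'I_n -> R.

Definition tri u v w : R := \sum_i \sum_j \sum_k tau i j k * (u i * v j * w k).

Definition unit_fun (i : 'I_n) : 'I_n -> R := fun j => (i == j)%:R.

Definition ones : 'I_n -> R := fun _ => 1.

Definition lorentz (B : ('I_n -> R) -> ('I_n -> R) -> R) :=
  forall v, B ones ones * B v v <= B ones v ^+ 2.

Lemma tri_sym12 u v w : tri u v w = tri v u w.
Proof.
rewrite /tri exchange_big; apply: eq_bigr => i _; apply: eq_bigr => j _.
by apply: eq_bigr => k _; rewrite tau_sym12 (mulrC (u j)).
Qed.

Lemma tri_sym23 u v w : tri u v w = tri u w v.
Proof.
rewrite /tri; apply: eq_bigr => i _; rewrite exchange_big; apply: eq_bigr => j _.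
by apply: eq_bigr => k _; rewrite tau_sym23 -!mulrA (mulrC (v k)).
Qed.

Lemma tri_comb a b u u' v w : tri (comb a b u u') v w = a * tri u v w + b * tri u' v w.
Proof.
rewrite /tri !mulr_sumr -big_split; apply: eq_bigr => i _ /=.
rewrite !mulr_sumr -big_split; apply: eq_bigr => j _ /=.
by rewrite !mulr_sumr -big_split; apply: eq_bigr => k _ /=; rewrite /comb; ring.
Qed.

Lemma tri_bilinear x : bilinear_sym (tri x).
Proof.
split=> [a b u v w|u v]; last exact: tri_sym23.
by rewrite tri_sym12 tri_comb !(tri_sym12 _ x).
Qed.

Lemma tri_ge0 u v w : (forall i, 0 <= u i) -> (forall i, 0 <= v i) -> (forall i, 0 <= w i) ->
  0 <= tri u v w.
Proof. by move=> *; do 3 (apply: sumr_ge0 => ? _); rewrite !mulr_ge0. Qed.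

Lemma tri_unit i v w : tri (unit_fun i) v w = \sum_j \sum_k tau i j k * (v j * w k).
Proof.
rewrite /tri (bigD1 i) //= [X in _ + X]big1 ?addr0 => [|i' ii'].
  apply: eq_bigr => j _; apply: eq_bigr => k _.
  by rewrite /unit_fun eqxx mul1r.
apply: big1 => j _; apply: big1 => k _.
by rewrite /unit_fun eq_sym (negPf ii') !mul0r mulr0.
Qed.

Lemma tri_expand u v w : tri u v w = \sum_i u i * tri (unit_fun i) v w.
Proof.
apply: eq_bigr => i _; rewrite tri_unit mulr_sumr; apply: eq_bigr => j _.
by rewrite mulr_sumr; apply: eq_bigr => k _; ring.
Qed.

Lemma tri_unit_eq0 v w i : (forall j, 0 < v j) -> (forall j, 0 < w j) ->
  tri (unit_fun i) v w = 0 -> forall j k, tau i j k = 0.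
Proof.
move=> v0 w0; have v1 j : 0 <= v j by apply: ltW.
have w1 j : 0 <= w j by apply: ltW.
rewrite tri_unit => /eqP; rewrite psumr_eq0 => [/allP /= h j k|j _]; last first.
  by apply: sumr_ge0 => k _; rewrite !mulr_ge0.
have /= := h j (mem_index_enum j); rewrite psumr_eq0 => [/allP /= h'|k' _];
  last by rewrite !mulr_ge0.
have /= := h' k (mem_index_enum k); rewrite mulf_eq0 => /orP[/eqP //|].
by rewrite mulf_eq0 !gt_eqF.
Qed.

Lemma tri_eq0 u v w : (forall i, 0 < u i) -> (forall i, 0 < v i) -> (forall i, 0 < w i) ->
  tri u v w = 0 -> forall i j k, tau i j k = 0.
Proof.
move=> u0 v0 w0 /eqP; rewrite tri_expand psumr_eq0 => [/allP /= h i|i _]; last first.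
  apply: mulr_ge0; [exact: ltW | apply: tri_ge0 => // j; (exact: ler0n || exact: ltW)].
have := h i (mem_index_enum i); rewrite mulf_eq0 gt_eqF //= => /eqP.
exact: tri_unit_eq0.
Qed.

Lemma tri_gt0 x u v w : 0 < tri x x x ->
  (forall i, 0 < u i) -> (forall i, 0 < v i) -> (forall i, 0 < w i) -> 0 < tri u v w.
Proof.
move=> x0 u0 v0 w0; rewrite lt_def tri_ge0 ?andbT => [|i|i|i]; try exact: ltW.
apply: contraTneq x0 => /tri_eq0 h.
by rewrite /tri big1 ?ltxx // => i _; do 2 (apply: big1 => ? _); rewrite h ?mul0r.
Qed.

(** This moves the reference vector from [ones] to [x]: if [T(e_k, 1, 1) > 0], the form is
    nonpositive on the orthogonal complement of [ones]; otherwise all its coefficients vanish. *)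
Lemma lorentz_unit_cs k x v : (forall i, 0 < x i) -> lorentz (tri (unit_fun k)) ->
  tri (unit_fun k) x x * tri (unit_fun k) v v <= tri (unit_fun k) x v ^+ 2.
Proof.
move=> x0 lk; have e0 i : 0 <= unit_fun k i by apply: ler0n.
have := tri_ge0 (u := unit_fun k) (v := ones) (w := ones) e0 (fun _ => ler01) (fun _ => ler01).
rewrite le_eqVlt => /orP[/eqP /esym z|pos].
  have h := tri_unit_eq0 (fun _ => ltr01) (fun _ => ltr01) z;
    rewrite (_ : tri (unit_fun k) x x = 0) ?mul0r ?sqr_ge0 //.
  by rewrite tri_unit; apply: big1 => i _; apply: big1 => j _; rewrite h mul0r.
apply: (@reverse_cauchy_schwarz _ _ _ ones) (tri_bilinear _) _ _.
  by move=> w w0; have := lk w; rewrite w0 expr0n /= pmulr_rle0.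
by apply: tri_ge0 => // i; apply: ltW.
Qed.

(** * The weighted graph Laplacian at a positive point *)

Section LocalConcavity.
Variable x : 'I_n -> R.
Hypothesis x_gt0 : forall i, 0 < x i.
Hypothesis lorentz_units : forall k, lorentz (tri (unit_fun k)).
Hypothesis lorentz_ones : lorentz (tri ones).

Let x_ge0 i : 0 <= x i. Proof. exact: ltW. Qed.

Let x_neq0 i : x i != 0. Proof. by rewrite gt_eqF. Qed.

(** The degrees are chosen to make [x] harmonic: [laplace x] is 0. *)
Definition deg (i : 'I_n) : R := tri (unit_fun i) x x / x i.

Definition contract w (i : 'I_n) : R := tri (unit_fun i) w x.

Definition laplace w (i : 'I_n) : R := deg i * w i - contract w i.

Definition dirichlet u w : R := \sum_i u i * laplace w i.

Lemma tri_contract u w : tri x u w = \sum_i u i * contract w i.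
Proof. by rewrite tri_sym12 tri_sym23 tri_expand. Qed.

Lemma unit_fun_ge0 i j : 0 <= unit_fun i j. Proof. exact: ler0n. Qed.

Lemma deg_ge0 i : 0 <= deg i.
Proof.
by rewrite /deg divr_ge0 // tri_ge0 // => j; apply: unit_fun_ge0.
Qed.

Lemma deg_eq0 i : deg i = 0 -> forall j k, tau i j k = 0.
Proof.
move/eqP; rewrite /deg mulf_eq0 invr_eq0 (negPf (x_neq0 i)) orbF => /eqP.
exact: tri_unit_eq0.
Qed.

Lemma contract_deg0 w i : deg i = 0 -> contract w i = 0.
Proof.
move/deg_eq0 => h; rewrite /contract tri_unit; apply: big1 => j _; apply: big1 => k _.
by rewrite h mul0r.
Qed.

(** This is [M <= M D^-1 M]: the inequality for [T(e_k, -, -)] at the pair [x], [v] is weighted by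
    [x k] and summed over [k]. *)
Lemma tri_leq_contract v : tri x v v <= \sum_k contract v k ^+ 2 / deg k.
Proof.
rewrite tri_expand; apply: ler_sum => k _.
have [d0|d0] := eqVneq (deg k) 0.
  rewrite d0 invr0 mulr0 tri_unit big1 ?mulr0 // => j _; apply: big1 => l _.
  by rewrite deg_eq0 // mul0r.
have dp : 0 < deg k by rewrite lt_def d0 deg_ge0.
rewrite ler_pdivlMr // /deg mulrAC mulrA [x k * _]mulrC mulfK //.
have := lorentz_unit_cs v x_gt0 (lorentz_units k).
by rewrite (tri_sym23 _ x v) mulrC.
Qed.

Lemma dirichletE u w : dirichlet u w = \sum_i u i * deg i * w i - tri x u w.
Proof.
rewrite tri_contract -sumrB; apply: eq_bigr => i _.
by rewrite /laplace mulrBr mulrA.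
Qed.

Lemma dirichlet_sym : bilinear_sym dirichlet.
Proof.
have [tl ts] := tri_bilinear x; split=> [a b u v w|u v]; last first.
  by rewrite !dirichletE ts; congr (_ - _); apply: eq_bigr => i _; ring.
rewrite !dirichletE tl.
have -> : \sum_i comb a b u v i * deg i * w i =
    a * (\sum_i u i * deg i * w i) + b * (\sum_i v i * deg i * w i); last by ring.
by rewrite !mulr_sumr -big_split; apply: eq_bigr => i _ /=; rewrite /comb; ring.
Qed.

(** In the variables [w / x] this is the Dirichlet energy of a graph in which the edge [i j] has
    weight [tau i j k * x i * x j * x k], summed over [k]. In the proof the diagonal part is written
    once for each end of the edge. *)
Lemma dirichlet_sos w : 2 * dirichlet w w =
  \sum_i \sum_j \sum_k tau i j k * (x i * x j * x k * (w i / x i - w j / x j) ^+ 2).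
Proof.
pose S1 := \sum_i \sum_j \sum_k tau i j k * (w i ^+ 2 / x i * x j * x k).
pose S2 := \sum_i \sum_j \sum_k tau i j k * (w j ^+ 2 / x j * x i * x k).
have E1 : \sum_i w i * deg i * w i = S1.
  apply: eq_bigr => i _; rewrite /deg tri_unit.
  set S := \sum_j _; have -> : w i * (S / x i) * w i = (w i ^+ 2 / x i) * S by ring.
  rewrite mulr_sumr; apply: eq_bigr => j _; rewrite mulr_sumr; apply: eq_bigr => k _; ring.
have E2 : S2 = S1.
  rewrite /S2 exchange_big; apply: eq_bigr => i _; apply: eq_bigr => j _; apply: eq_bigr => k _.
  by rewrite tau_sym12.
have E3 : tri x w w = \sum_i \sum_j \sum_k tau i j k * (w i * w j * x k).
  by rewrite tri_sym12 tri_sym23.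
have -> : 2 * dirichlet w w = S1 + S2 - 2 * tri x w w by rewrite dirichletE E1 E2; ring.
rewrite E3 mulr_sumr -big_split -sumrB; apply: eq_bigr => i _ /=.
rewrite mulr_sumr -big_split -sumrB; apply: eq_bigr => j _ /=.
rewrite mulr_sumr -big_split -sumrB; apply: eq_bigr => k _ /=.
by field; rewrite !x_neq0.
Qed.

Lemma dirichlet_ge0 w : 0 <= dirichlet w w.
Proof.
rewrite -(pmulr_rge0 _ (ltr0n R 2)) dirichlet_sos.
by do 3 (apply: sumr_ge0 => ? _); rewrite mulr_ge0 // mulr_ge0 ?sqr_ge0 // !mulr_ge0.
Qed.

(* The inequality [L <= L D^-1 L]; indices with [deg k = 0] contribute [_ / 0 = 0]. *)
Lemma dirichlet_leq w : dirichlet w w <= \sum_k laplace w k ^+ 2 / deg k.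
Proof.
(* With [L = D - M], [L D^-1 L = D - 2 M + M D^-1 M], which exceeds [L] by [M D^-1 M - M]. *)
have -> : \sum_k laplace w k ^+ 2 / deg k =
    \sum_k (w k * deg k * w k - 2 * (w k * contract w k) + contract w k ^+ 2 / deg k).
  apply: eq_bigr => k _; rewrite /laplace; have [d0|d0] := eqVneq (deg k) 0.
    by rewrite d0 contract_deg0 // invr0; ring.
  by field.
rewrite big_split sumrB /= -mulr_sumr -tri_contract dirichletE.
have := tri_leq_contract w; lra.
Qed.

(** The energy of a harmonic vector is 0, hence so is each of its nonnegative terms. *)
Lemma harmonic_constant z : (forall k, laplace z k = 0) ->
  forall i j k, tau i j k != 0 -> z i / x i = z j / x j.
Proof.
move=> hz i j k t0.
have : 2 * dirichlet z z = 0.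
  by rewrite /dirichlet big1 ?mulr0 // => l _; rewrite hz mulr0.
rewrite dirichlet_sos => /eqP.
have P i' j' k' : 0 <= tau i' j' k' * (x i' * x j' * x k' * (z i' / x i' - z j' / x j') ^+ 2).
  by rewrite mulr_ge0 // mulr_ge0 ?sqr_ge0 // !mulr_ge0.
rewrite psumr_eq0 => [/allP /(_ i (mem_index_enum i)) /=|i' _];
  last by do 2 (apply: sumr_ge0 => ? _).
rewrite psumr_eq0 => [/allP /(_ j (mem_index_enum j)) /=|j' _]; last by apply: sumr_ge0 => ? _.
rewrite psumr_eq0 => [/allP /(_ k (mem_index_enum k)) /=|k' _] //.
by rewrite mulf_eq0 (negPf t0) mulf_eq0 sqrf_eq0 !mulf_eq0 !(negPf (x_neq0 _)) subr_eq0 => /eqP.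
Qed.

(* A proper level set of [z / x] would split the form [tri ones] into two nonzero
   blocks, which is incompatible with [lorentz_ones]. *)
Lemma harmonic_supported z : (forall k, laplace z k = 0) ->
  forall i j, deg i != 0 -> deg j != 0 -> z i / x i = z j / x j.
Proof.
move=> /harmonic_constant hz i j di dj.
(* [a] and [b] are the indicators of the level set of [z / x] through [i] and of its complement; no
   edge joins the two. *)
pose c := z i / x i; pose y l := z l / x l.
pose a l : R := (y l == c)%:R; pose b l : R := (y l != c)%:R.
have a0 l : 0 <= a l by exact: ler0n.
have b0 l : 0 <= b l by exact: ler0n.
have ab1 l : a l + b l = 1 by rewrite /a /b; case: eqP => _ /=; rewrite ?addr0 ?add0r.
have ab : tri ones a b = 0.
  rewrite tri_sym12 tri_sym23; apply: big1 => p _; apply: big1 => q _; apply: big1 => r _.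
  have [->|t0] := eqVneq (tau p q r) 0; first by rewrite mul0r.
  rewrite /a /b -(hz p q r t0 : y p = y q); case: eqP => _; rewrite ?mulr0 ?mul0r ?mulr0 //.
have onesE : ones =1 comb 1 1 a b by move=> l; rewrite /comb !mul1r ab1.
have [tl ts] := tri_bilinear ones.
have tri_ext u u' v : u =1 u' -> tri ones u v = tri ones u' v.
  move=> uu; apply: eq_bigr => p _; apply: eq_bigr => q _; apply: eq_bigr => r _.
  by rewrite uu.
have E1 : tri ones ones a = tri ones a a.
  by rewrite (tri_ext _ _ _ onesE) tl (ts b) ab; ring.
have E2 : tri ones ones ones = tri ones a a + tri ones b b.
  by rewrite (tri_ext _ _ _ onesE) tl !(ts _ ones) !(tri_ext _ _ _ onesE) !tl (ts b a) ab; ring.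
(* The inequality reads [(T(1,a,a) + T(1,b,b)) T(1,a,a) <= T(1,a,a)^2], which fails when both terms
   are positive. *)
have := lorentz_ones a; rewrite E1 E2.
(* A vertex of nonzero degree has an edge, whose other end lies in the same level set. *)
have pos l : deg l != 0 -> forall e : 'I_n -> R, (forall p, 0 <= e p) -> e l = 1 ->
    (forall p q, y p = y q -> e p = e q) -> 0 < tri ones e e.
  move=> dl e e0 el ey; rewrite lt_def tri_ge0 // andbT; apply: contraNneq dl.
  have P p q r : 0 <= tau p q r * (ones p * e q * e r) by rewrite !mulr_ge0.
  move/eqP; rewrite psumr_eq0 => [/allP /= h|p _]; last by do 2 (apply: sumr_ge0 => ? _).
  suff t0 q r : tau l q r = 0.
    by rewrite /deg tri_unit big1 ?mul0r // => q _; apply: big1 => r _; rewrite t0 mul0r.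
  have := h r (mem_index_enum r); rewrite psumr_eq0 => [/allP /= /(_ l (mem_index_enum l))|p _];
    last by apply: sumr_ge0.
  rewrite psumr_eq0 => [/allP /= /(_ q (mem_index_enum q))|p _] //.
  rewrite mul1r el mul1r mulf_eq0 tau_sym12 tau_sym23 => /orP[/eqP //|eq0].
  apply/eqP/negPn/negP => t0; move: eq0; rewrite -(ey l q) ?el ?oner_eq0 //.
  exact: hz t0.
have pa : 0 < tri ones a a.
  by apply: (pos i) => // [|p q pq]; rewrite /a /y ?eqxx // -/(y p) pq.
have pb (h : y j != c) : 0 < tri ones b b.
  apply: (pos j) => // [|p q pq]; last by rewrite /b pq.
  by rewrite /b h.
move=> h; apply/eqP; rewrite eq_sym; apply/negPn/negP => /pb.
by nra.
Qed.

Definition laplace_mx : 'M[R]_n :=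
  \matrix_(i, j) (deg i * (i == j)%:R - tri (unit_fun i) (unit_fun j) x).

Lemma laplace_mxE w i : laplace w i = \sum_j laplace_mx i j * w j.
Proof.
rewrite /laplace /contract (tri_sym12 _ w) tri_expand.
transitivity (\sum_j (deg i * (i == j)%:R * w j - w j * tri (unit_fun j) (unit_fun i) x)).
  rewrite sumrB; congr (_ - _).
  rewrite (bigD1 i) //= eqxx mulr1 big1 ?addr0 // => j ij.
  by rewrite eq_sym (negPf ij) mulr0 mul0r.
by apply: eq_bigr => j _; rewrite mxE tri_sym12; ring.
Qed.

Lemma laplace_mx_sym i j : laplace_mx i j = laplace_mx j i.
Proof.
rewrite !mxE tri_sym12; congr (_ - _); have [->//|ij] := eqVneq i j.
by rewrite !mulr0.
Qed.

(** Fredholm alternative: [L] is symmetric, so [D v] is in its range as soon as it is orthogonal to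
    the kernel. Kernel vectors are multiples of [x] where [deg] is nonzero, and the pairing of [D v]
    with [x] is [T(x, x, v)]. *)
Lemma laplace_solvable v : tri x x v = 0 -> exists w, forall k, laplace w k = deg k * v k.
Proof.
move=> xv; pose u := \row_k (deg k * v k).
have /submxP [w uw] : (u <= laplace_mx)%MS.
  rewrite submxE; apply/eqP/rowP => c; rewrite mxE [RHS]mxE.
  pose z k := cokermx laplace_mx k c.
  have hz k : laplace z k = 0.
    have := mulmx_coker laplace_mx => /matrixP /(_ k c); rewrite mxE [RHS]mxE => <-.
    exact: laplace_mxE.
  have [/existsP [i di]|] := boolP [exists i, deg i != 0]; last first.
    by rewrite negb_exists => /forallP h; apply: big1 => k _;
      rewrite mxE (eqP (negPn (h k))) !mul0r.
  transitivity ((z i / x i) * tri x x v); last by rewrite xv mulr0.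
  rewrite (tri_sym23 x) tri_sym12 tri_expand mulr_sumr; apply: eq_bigr => k _.
  rewrite mxE -/(z k); have [d0|dk] := eqVneq (deg k) 0.
    have -> : tri (unit_fun k) x x = deg k * x k by rewrite /deg divfK.
    by rewrite d0; ring.
  rewrite (harmonic_supported hz di dk) /deg; set t := tri _ _ _.
  by field; rewrite x_neq0.
exists (fun i => w 0 i) => k; have := congr1 (fun A : 'rV_n => A 0 k) uw; rewrite !mxE => ->.
rewrite laplace_mxE; apply: eq_bigr => j _.
by rewrite laplace_mx_sym mulrC.
Qed.

(* With [S = v D v] and [L w = D v], Cauchy-Schwarz for [L] gives
   [S^2 = (v L w)^2 <= (v L v) (w L w) <= (v L v) S], while [v L v = S - T(x, v, v)]. *)
Lemma tri_orthogonal_le0 v : tri x x v = 0 -> tri x v v <= 0.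
Proof.
move=> /laplace_solvable [w hw].
pose S := \sum_k v k * deg k * v k.
have S0 : 0 <= S by apply: sumr_ge0 => k _; rewrite mulrAC -expr2 mulr_ge0 ?sqr_ge0 ?deg_ge0.
have vw : dirichlet v w = S by apply: eq_bigr => k _; rewrite hw mulrA.
have ww : dirichlet w w <= S.
  apply: le_trans (dirichlet_leq w) _; apply: ler_sum => k _; rewrite hw.
  have [->|d0] := eqVneq (deg k) 0; first by rewrite invr0 !mulr0 mul0r.
  by rewrite le_eqVlt; apply/orP; left; apply/eqP; field.
have vv : dirichlet v v = S - tri x v v by rewrite dirichletE.
have := psd_cauchy_schwarz v w dirichlet_sym dirichlet_ge0; rewrite vw => cs.
have v0 := dirichlet_ge0 v; have {}cs : S ^+ 2 <= dirichlet v v * S by apply: le_trans cs _;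
  rewrite ler_wpM2l.
move: S0; rewrite le_eqVlt => /orP[/eqP S0|S0]; first by move: v0; rewrite vv -S0; lra.
suff : S <= dirichlet v v by rewrite vv; lra.
by rewrite -(ler_pM2r S0) -expr2.
Qed.


End LocalConcavity.

End TrilinearForm.

(** * Log concavity of cubic forms *)

Section LogConcavity.
Context (R : realType) (n : nat) (tau : 'I_n -> 'I_n -> 'I_n -> R).
Hypothesis tau_sym12 : forall i j k, tau i j k = tau j i k.
Hypothesis tau_sym23 : forall i j k, tau i j k = tau i k j.
Hypothesis tau_ge0 : forall i j k, 0 <= tau i j k.
Implicit Types u v w x y : 'I_n -> R.
Local Notation T := (tri tau).

Definition cubic x : R := T x x x.

Lemma tri_eq u u' v v' w w' : u =1 u' -> v =1 v' -> w =1 w' -> T u v w = T u' v' w'.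
Proof.
move=> uE vE wE; apply: eq_bigr => p _; apply: eq_bigr => q _; apply: eq_bigr => r _.
by rewrite uE vE wE.
Qed.

Lemma cubic_comb a b x y : cubic (comb a b x y) =
  a ^+ 3 * T x x x + 3 * a ^+ 2 * b * T x x y + 3 * a * b ^+ 2 * T x y y + b ^+ 3 * T y y y.
Proof.
have s12 := tri_sym12 tau_sym12; have s23 := tri_sym23 tau_sym23.
have bil u := tri_bilinear tau_sym12 tau_sym23 u.
rewrite /cubic tri_comb !bilinear_sym_comb //.
by rewrite (s12 y x x) (s23 x y x) (s12 y x y); ring.
Qed.

Lemma cubic_gt0 x y : (forall i, 0 < y i) -> 0 < cubic x -> 0 < cubic y.
Proof. by move=> y0 cx; apply: tri_gt0 cx _ _ _. Qed.

Lemma tri_local_cs x v :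
  (forall i, 0 < x i) -> (forall w, T x x w = 0 -> T x w w <= 0) ->
  T x x x * T x v v <= T x x v ^+ 2.
Proof.
move=> x0 loc; apply: (reverse_cauchy_schwarz _ (tri_bilinear tau_sym12 tau_sym23 x) loc).
by apply: tri_ge0 => // i; apply: ltW.
Qed.

Lemma ln_tangent (a g : R) : 0 < a -> 0 < g -> exp.ln a <= exp.ln g + (a / g - 1).
Proof.
move=> a0 g0; have ag : 0 < a / g by rewrite divr_gt0.
have -> : exp.ln a = exp.ln g + exp.ln (a / g).
  by rewrite -exp.lnM ?posrE // mulrC divfK ?gt_eqF.
rewrite lerD2l -[X in exp.ln X](addrNK 1) addrC; apply: exp.le_ln1Dx; lra.
Qed.

(* The mixed values [a], [b], [c], [d] form a log concave sequence, so Jensen's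
   inequality for the binomial weights reduces to the two outer ones. *)
Lemma ln_cubic_concave (a b c d t s : R) :
  0 < a -> 0 < b -> 0 < c -> 0 < d -> a * c <= b ^+ 2 -> b * d <= c ^+ 2 ->
  0 < t -> 0 < s -> t + s = 1 ->
  t * exp.ln a + s * exp.ln d <=
  exp.ln (t ^+ 3 * a + 3 * t ^+ 2 * s * b + 3 * t * s ^+ 2 * c + s ^+ 3 * d).
Proof.
move=> a0 b0 c0 d0 acb bdc t0 s0 ts1.
set g := (X in _ <= exp.ln X).
have g0 : 0 < g by rewrite /g !addr_gt0 // !mulr_gt0 // exprn_gt0.
have h1 : exp.ln a + exp.ln c <= 2 * exp.ln b.
  rewrite -exp.lnM ?posrE // mulr_natl -exp.lnXn // exp.ler_ln ?posrE ?mulr_gt0 ?exprn_gt0 //.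
have h2 : exp.ln b + exp.ln d <= 2 * exp.ln c.
  rewrite -exp.lnM ?posrE // mulr_natl -exp.lnXn // exp.ler_ln ?posrE ?mulr_gt0 ?exprn_gt0 //.
have ta := ln_tangent a0 g0; have tb := ln_tangent b0 g0.
have tc := ln_tangent c0 g0; have td := ln_tangent d0 g0.
move: h1 h2 ta tb tc td; set la := exp.ln a; set lb := exp.ln b; set lc := exp.ln c;
  set ld := exp.ln d.
set lg := exp.ln g => h1 h2 ta tb tc td.
(* Jensen's inequality through the tangent at [g]: the weights sum to [(t + s)^3 = 1], and [g] is
   the weighted mean. *)
have jensen : t ^+ 3 * la + 3 * t ^+ 2 * s * lb + 3 * t * s ^+ 2 * lc + s ^+ 3 * ld <= lg.
  have -> : lg = t ^+ 3 * (lg + (a / g - 1)) + 3 * t ^+ 2 * s * (lg + (b / g - 1)) +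
     3 * t * s ^+ 2 * (lg + (c / g - 1)) + s ^+ 3 * (lg + (d / g - 1)).
    have E i : t ^+ 3 * (lg + (a * i - 1)) + 3 * t ^+ 2 * s * (lg + (b * i - 1)) +
      3 * t * s ^+ 2 * (lg + (c * i - 1)) + s ^+ 3 * (lg + (d * i - 1)) =
      (t + s) ^+ 3 * (lg - 1) + g * i by rewrite /g; ring.
    by rewrite E divff ?gt_eqF // ts1; ring.
  by rewrite !lerD // ler_wpM2l // ?mulr_ge0 ?exprn_ge0 // ltW // exprn_gt0.
apply: le_trans jensen.
(* The concave sequence [la], [lb], [lc], [ld] lies above its chord. *)
have lb' : 2 * la + ld <= 3 * lb by lra.
have lc' : la + 2 * ld <= 3 * lc by lra.
have -> : t * la + s * ld = t ^+ 3 * la + t ^+ 2 * s * (2 * la + ld) + t * s ^+ 2 * (la + 2 * ld) + s ^+ 3 * ld.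
  have -> : t * la + s * ld = (t + s) ^+ 2 * (t * la + s * ld) by rewrite ts1; ring.
  by ring.
have A : t ^+ 2 * s * (2 * la + ld) <= t ^+ 2 * s * (3 * lb).
  by rewrite ler_wpM2l // mulr_ge0 ?exprn_ge0 ?ltW.
have B : t * s ^+ 2 * (la + 2 * ld) <= t * s ^+ 2 * (3 * lc).
  by rewrite ler_wpM2l // mulr_ge0 ?exprn_ge0 ?ltW.
lra.
Qed.

Lemma nonneg_limit (A B C : R) : (forall e, 0 < e <= 1 -> A <= B + e * C) -> A <= B.
Proof.
move=> h; rewrite leNgt; apply/negP => BA.
have [C0|C0] := leP C 0.
  have := h 1; rewrite ltr01 lexx => /(_ isT); lra.
(* For this [e] the hypothesis gives [A - B <= e C = (A - B) - e (A - B)], which is absurd. *)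
pose e := (A - B) / (A - B + C).
have p : 0 < A - B + C by lra.
have e0 : 0 < e by rewrite divr_gt0 // subr_gt0.
have e1 : e <= 1 by rewrite ler_pdivrMr //; lra.
have := h e; rewrite e0 e1 => /(_ isT).
have : e * (A - B + C) = A - B by rewrite /e divfK ?gt_eqF.
have : 0 < e * (A - B) by rewrite mulr_gt0 // subr_gt0.
lra.
Qed.

Lemma small_shift x v : (forall i, 0 < x i) ->
  exists2 h0, 0 < h0 <= 1 & forall h, `|h| <= h0 -> forall i, 0 < x i + h * v i.
Proof.
move=> x0; pose S := \sum_i `|v i| / x i.
have S0 : 0 <= S by apply: sumr_ge0 => i _; rewrite divr_ge0 // ltW.
exists (1 + S)^-1.
  by rewrite invr_gt0 invf_le1; lra.
move=> h hh i.
have vi : `|v i| / x i <= S.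
  by rewrite /S (bigD1 i) //= lerDl sumr_ge0 // => j _; rewrite divr_ge0 // ltW.
have : `|h * v i| < x i.
  rewrite normrM; have : `|h| * (`|v i| / x i) < 1.
    apply: (@le_lt_trans _ _ ((1 + S)^-1 * S)); first by apply: ler_pM => //;
      rewrite divr_ge0 // ltW.
    by rewrite mulrC ltr_pdivrMr; lra.
  by rewrite mulrA ltr_pdivrMr // mul1r.
by rewrite ltr_norml => /andP[]; lra.
Qed.

(** * From log concavity to the inequalities for the quadratic forms *)

Section Necessity.
Hypothesis midpoint : forall x y, (forall i, 0 < x i) -> (forall i, 0 < y i) ->
  cubic x * cubic y <= cubic (comb 2^-1 2^-1 x y) ^+ 2.

(** Second-order condition at [z]: since [T(z,z,v) = 0], the cubic at [z + h v] and [z - h v] is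
    [a + 3 h^2 c] plus or minus [h^3 d], and the product of the two values is at most [a^2].
    Dropping a square and dividing by [h^2] leaves [6 a c <= h^4 d^2]; then [h] tends to 0. *)
Lemma midpoint_local z v : (forall i, 0 < z i) -> T z z v = 0 -> T z v v <= 0.
Proof.
move=> z0 b0; have [h0 /andP[h0p h01] hP] := small_shift v z0.
have a0 : 0 <= T z z z by apply: tri_ge0 => // i; apply: ltW.
move: a0; rewrite le_eqVlt => /orP[/eqP a0|a0].
  rewrite /tri big1 // => i _; do 2 (apply: big1 => ? _).
  by rewrite (tri_eq0 tau_ge0 z0 z0 z0) ?mul0r.
set a := T z z z in a0; set c := T z v v; set d := T v v v.
suff : 6 * a * c <= 0 by rewrite pmulr_rle0 //; lra.
apply: (@nonneg_limit _ _ (d ^+ 2)) => e /andP[e0 e1]; rewrite add0r.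
pose h := h0 * e.
have hp : 0 < h by rewrite mulr_gt0.
have hle : h <= h0 by rewrite /h ger_pMr // ltW.
have pos t : `|t| <= h0 -> forall i, 0 < comb 1 t z v i.
  by move=> /hP th i; rewrite /comb mul1r.
have := midpoint (x := comb 1 h z v) (y := comb 1 (- h) z v).
have -> : cubic (comb 2^-1 2^-1 (comb 1 h z v) (comb 1 (- h) z v)) = a.
  by apply: tri_eq => i; rewrite /comb; field.
rewrite !cubic_comb b0 -/a -/c -/d.
have /pos p1 : `|h| <= h0 by rewrite gtr0_norm.
have /pos p2 : `|- h| <= h0 by rewrite normrN gtr0_norm.
move=> /(_ p1 p2) hh.
have {hh} : 6 * a * c <= h ^+ 4 * d ^+ 2.
  have h2 : 0 < h ^+ 2 by rewrite exprn_gt0.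
  rewrite -(ler_pM2l h2).
  have : 0 <= h ^+ 4 * c ^+ 2 by rewrite mulr_ge0 ?sqr_ge0 // exprn_ge0 // ltW.
  by move: hh; clear; lra.
move/le_trans; apply; rewrite ler_wpM2r ?sqr_ge0 //.
have h4 : h ^+ 4 <= h by rewrite exprS ger_pMr //; apply: exprn_ile1;
  [exact: ltW | exact: le_trans hle h01].
by apply: le_trans h4 _; rewrite /h -{2}[e]mul1r ler_wpM2r // ltW.
Qed.

Lemma midpoint_lorentz :
  (forall k, lorentz (T (unit_fun R k))) /\ lorentz (T (ones R (n := n))).
Proof.
have cs x v : (forall i, 0 < x i) -> T x (ones R (n := n)) (ones R (n := n)) * T x v v <= T x (ones R (n := n)) v ^+ 2.
  move=> x0; apply: (@reverse_cauchy_schwarz _ _ _ x).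
  - exact: tri_bilinear.
  - by move=> w; apply: midpoint_local.
  - by apply: tri_ge0 => // i; apply: ltW.
split=> [k|] v; last by apply: cs => i; apply: ltr01.
set o := ones R (n := n) in cs *; set e := unit_fun R k.
set p := T e o v; set q := T e o o; set r := T e v v.
set p' := T o o v; set q' := T o o o; set r' := T o v v.
(* The inequality at the interior point [e_k + t 1] is expanded in [t]; the absolute values bound
   the coefficients of [t] and [t^2]. *)
apply: (@nonneg_limit _ _ (`|2 * p * p' - q * r' - q' * r| + `|p' ^+ 2 - q' * r'|)) => t /andP[t0 t1].
have := cs (comb 1 t e o) v; rewrite !tri_comb -/p -/q -/r -/p' -/q' -/r' !mul1r => csx.
have {csx} : (q + t * q') * (r + t * r') <= (p + t * p') ^+ 2.
  by apply: csx => i; rewrite /comb !mul1r mulr1 ltr_wpDl // ler0n.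
have : t * (2 * p * p' - q * r' - q' * r) <= t * `|2 * p * p' - q * r' - q' * r|.
  by rewrite ler_wpM2l ?ler_norm // ltW.
have : t ^+ 2 * (p' ^+ 2 - q' * r') <= t * `|p' ^+ 2 - q' * r'|.
  apply: (@le_trans _ _ (t ^+ 2 * `|p' ^+ 2 - q' * r'|));
    first by rewrite ler_wpM2l ?ler_norm // sqr_ge0.
  by rewrite ler_wpM2r // expr2 ger_pMr.
by set m1 := `|_|; set m2 := `|_|; clear; nra.
Qed.
End Necessity.

Theorem log_concave_lorentz (kappa : R) (g : ('I_n -> R) -> R) :
  0 < kappa -> (forall x, g x = kappa * cubic x) ->
  (forall (x y : 'I_n -> R) (t : R),
    (forall i, 0 < x i) -> (forall i, 0 < y i) -> 0 < t < 1 ->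
    (t%:E * exp.lne (g x)%:E + (1 - t)%:E * exp.lne (g y)%:E
     <= exp.lne (g (fun i => t * x i + (1 - t) * y i)%R)%:E)%E)
  <-> (forall k, lorentz (T (unit_fun R k))) /\ lorentz (T (ones R (n := n))).
Proof.
move=> k0 gE; split=> [lc|[lu lo] x y t x0 y0 /andP[t0 t1]].
  (* Log concavity at midpoints already gives the second-order condition. *)
  apply: midpoint_lorentz => x y x0 y0.
  have m0 i : 0 < comb 2^-1 2^-1 x y i by rewrite /comb addr_gt0 // mulr_gt0 // invr_gt0.
  have : 0 <= cubic x by apply: tri_ge0 => // i; apply: ltW.
  rewrite le_eqVlt => /orP[/eqP <-|cx]; first by rewrite mul0r sqr_ge0.
  have cy := cubic_gt0 y0 cx; have cm := cubic_gt0 m0 cx.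
  have half : 1 - 2^-1 = 2^-1 :> R by field.
  have h01 : 0 < (2^-1 : R) < 1 by lra.
  have := lc x y 2^-1 x0 y0 h01; rewrite half !gE -/(comb 2^-1 2^-1 x y).
  rewrite !exp.lne_EFin ?mulr_gt0 // -!EFinM -EFinD lee_fin -mulrDr ler_pdivrMl //.
  rewrite -exp.lnM ?posrE ?mulr_gt0 // mulr_natl -exp.lnXn ?mulr_gt0 // exp.ler_ln ?posrE ?exprn_gt0 ?mulr_gt0 //.
  rewrite exprMn expr2 mulrACA ler_pM2l // mulr_gt0 //.
have : 0 <= cubic x by apply: tri_ge0 => // i; apply: ltW.
(* A cubic that vanishes at one positive point vanishes at all of them, and its logarithm is [-oo]
   throughout. *)
rewrite le_eqVlt => /orP[/eqP cx|cx].
  have z y' : (forall i, 0 < y' i) -> cubic y' = 0.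
    move=> y'0; apply/eqP; rewrite eq_le [X in _ && X]tri_ge0 ?andbT; [|by []|by move=> i;
      exact: ltW..].
    by rewrite leNgt; apply/negP => /(cubic_gt0 x0); rewrite -cx ltxx.
  rewrite !gE z // mulr0 exp.le0_lneNy //.
  by rewrite gt0_muleNy ?lte_fin // addNye leNye.
have cy := cubic_gt0 y0 cx.
have s0 : 0 < 1 - t by rewrite subr_gt0.
have m0 i : 0 < comb t (1 - t) x y i by rewrite /comb addr_gt0 // mulr_gt0.
have cm := cubic_gt0 m0 cx.
rewrite !gE -/(comb t (1 - t) x y) !exp.lne_EFin ?mulr_gt0 //.
rewrite -!EFinM -EFinD lee_fin !exp.lnM ?posrE // !mulrDr addrACA -mulrDl.
have -> : t + (1 - t) = 1 by ring.
rewrite mul1r lerD2l cubic_comb.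
have [x1 y1] : (forall i, 0 <= x i) /\ (forall i, 0 <= y i) by split=> i; apply: ltW.
have s12 := tri_sym12 tau_sym12; have s23 := tri_sym23 tau_sym23.
have loc z v : (forall i, 0 < z i) -> T z z z * T z v v <= T z z v ^+ 2.
  by move=> z0; apply: tri_local_cs => // w; apply: tri_orthogonal_le0.
have pos u v w := tri_gt0 tau_ge0 (u := u) (v := v) (w := w) cx.
apply: ln_cubic_concave => //; try exact: pos.
- exact: loc.
- by have := loc y x y0; rewrite (s12 y x x) (s23 x y x) (s23 y y x) (s12 y x y) mulrC; exact.
- by ring.
Qed.
End LogConcavity.

(** * Positive semidefiniteness by the Faddeev-LeVerrier recursion *)

(** The ring is arbitrary so that the recursion can be transported along morphisms: the machine
    computes over the integers, while diagonalization takes place over the complex numbers. *)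
Fixpoint fl_mx (R : comNzRingType) n (P : 'M[R]_n) (k : nat) : 'M[R]_n :=
  if k is k'.+1 then
    (\tr (P *m fl_mx P k'))%:M - k%:R *: (P *m fl_mx P k')
  else 1%:M.

Definition fl_trace (R : comNzRingType) n (P : 'M[R]_n) k := \tr (P *m fl_mx P k).

Lemma map_fl_mx (R S : comNzRingType) (f : {rmorphism R -> S}) n (P : 'M[R]_n) k :
  map_mx f (fl_mx P k) = fl_mx (map_mx f P) k.
Proof.
elim: k => [|k IH] /=; first by rewrite map_mx1.
by rewrite map_mxB map_scalar_mx map_mxZ -trace_map_mx !map_mxM IH rmorph_nat.
Qed.

Lemma map_fl_trace (R S : comNzRingType) (f : {rmorphism R -> S}) n (P : 'M[R]_n) k :
  f (fl_trace P k) = fl_trace (map_mx f P) k.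
Proof. by rewrite /fl_trace -trace_map_mx map_mxM map_fl_mx. Qed.

(** Traces are invariant under conjugation; this reduces the recursion to diagonal matrices. *)
Lemma fl_mx_conj (F : fieldType) n (U P : 'M[F]_n) k : U \in unitmx ->
  fl_mx (invmx U *m P *m U) k = invmx U *m fl_mx P k *m U.
Proof.
move=> Uu; elim: k => [|k IH] /=; first by rewrite mulmx1 mulVmx.
have E : invmx U *m P *m U *m (invmx U *m fl_mx P k *m U) = invmx U *m (P *m fl_mx P k) *m U.
  by rewrite !mulmxA mulmxK.
rewrite IH E mulmxBr mulmxBl mul_mx_scalar -scalemxAl mulVmx // -scalemxAr -scalemxAl.
by rewrite mxtrace_mulC mulmxA mulmxV // mul1mx scalemx1.
Qed.

Lemma fl_trace_conj (F : fieldType) n (U P : 'M[F]_n) k : U \in unitmx ->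
  fl_trace (invmx U *m P *m U) k = fl_trace P k.
Proof.
move=> Uu; rewrite /fl_trace fl_mx_conj // !mulmxA mulmxK //.
by rewrite mxtrace_mulC !mulmxA mulmxV // mul1mx.
Qed.

Lemma deriv_prod_uniq (R : comNzRingType) (I : eqType) (r : seq I) (F : I -> {poly R}) :
  uniq r -> (\prod_(i <- r) F i)^`() = \sum_(i <- r) (F i)^`() * \prod_(j <- r | j != i) F j.
Proof.
elim: r => [|i r IH] /=; first by rewrite !big_nil derivC.
move=> /andP[ir ru]; rewrite !big_cons derivM IH // eqxx /=; congr (_ * _ + _).
  rewrite big_seq [RHS]big_seq_cond; apply: eq_bigl => j; case: eqP => [->|_];
    by rewrite ?(negPf ir) ?andbT.
rewrite mulr_sumr; apply: eq_big_seq => l lr.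
rewrite big_cons; have -> : i != l by apply: contraNneq ir => ->.
by rewrite mulrCA.
Qed.

(** * Diagonal matrices and elementary symmetric functions *)

Section Diagonal.
Context (R : comNzRingType) (n : nat) (d : 'rV[R]_n).

(* Its coefficients are the elementary symmetric functions of [d]. *)
Definition elem_sym : {poly R} := \prod_i (1 + (d 0 i)%:P * 'X).

Definition elem_sym_but (i : 'I_n) : {poly R} := \prod_(j | j != i) (1 + (d 0 j)%:P * 'X).

Lemma coef0_elem_sym_prod (A : pred 'I_n) : (\prod_(j | A j) (1 + (d 0 j)%:P * 'X))`_0 = 1.
Proof.
elim/big_rec: _ => [|l p _ IH]; first by rewrite coefC.
by rewrite mulrDl mul1r coefD -mulrA coefCM coefXM mulr0 addr0.
Qed.

Lemma coef_elem_sym i k : elem_sym`_k.+1 = (elem_sym_but i)`_k.+1 + d 0 i * (elem_sym_but i)`_k.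
Proof.
by rewrite /elem_sym (bigD1 i) //= -/(elem_sym_but i) mulrDl mul1r coefD -mulrA coefCM coefXM.
Qed.

(** Both sides are the coefficient of degree [k] in the derivative of [elem_sym]: differentiating
    the factor of index [i] leaves [d_i] times the product of the others. *)
Lemma coef_deriv_elem_sym k : \sum_i d 0 i * (elem_sym_but i)`_k = k.+1%:R * elem_sym`_k.+1.
Proof.
have : elem_sym^`()`_k = \sum_i d 0 i * (elem_sym_but i)`_k.
  rewrite /elem_sym deriv_prod_uniq ?index_enum_uniq // coef_sum; apply: eq_bigr => i _.
  by rewrite derivD derivC add0r derivM derivC mul0r add0r derivX mulr1 coefCM.
by rewrite coef_deriv mulr_natl => <-.
Qed.

(** The recursion becomes [e_(k+1)(d without i) = e_(k+1)(d) - d_i e_k(d without i)], multiplied by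
    [(k+1)!]. *)
Lemma fl_mx_diag k : fl_mx (diag_mx d) k = diag_mx (\row_i (k`!%:R * (elem_sym_but i)`_k)).
Proof.
elim: k => [|k IH] /=.
  apply/matrixP => i j; rewrite !mxE; congr (_ *+ _).
  by rewrite mul1r coef0_elem_sym_prod.
rewrite IH mulmx_diag mxtrace_diag.
have E : \sum_i (\row_j (d 0 j * (\row_i (k`!%:R * (elem_sym_but i)`_k)) 0 j)) 0 i = k.+1`!%:R * elem_sym`_k.+1.
  rewrite factS natrM mulrAC -coef_deriv_elem_sym mulr_suml.
  by apply: eq_bigr => i _; rewrite !mxE; ring.
rewrite E; apply/matrixP => i j; rewrite !mxE; have [->|_] := eqVneq i j;
  last by rewrite mulr0n mulr0 subr0.
by rewrite !mulr1n (coef_elem_sym j) factS natrM; ring.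
Qed.

Lemma fl_trace_diag k : fl_trace (diag_mx d) k = k.+1`!%:R * elem_sym`_k.+1.
Proof.
rewrite /fl_trace fl_mx_diag mulmx_diag mxtrace_diag.
rewrite factS natrM mulrAC -coef_deriv_elem_sym mulr_suml.
by apply: eq_bigr => i _; rewrite !mxE; ring.
Qed.

Lemma size_elem_sym : (size elem_sym <= n.+1)%N.
Proof.
apply: leq_trans (size_poly_prod_leq _ _) _ => /=.
rewrite leq_subLR addnS ltnS; apply: (@leq_trans (\sum_(i < n) 2)%N).
  apply: leq_sum => i _; apply: leq_trans (size_polyD _ _) _; rewrite geq_max size_poly1 /=.
  by apply: leq_trans (size_polyMleq _ _) _; rewrite size_polyX addn2 /= ltnS size_polyC_leq1.
by rewrite sum_nat_const !card_ord; lia.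
Qed.

End Diagonal.

(** A negative [d_i] would give the positive root [-1 / d_i], whereas nonnegative coefficients with
    constant term 1 make the value there at least 1. *)
Lemma elem_sym_sign (F : numFieldType) n (d : 'rV[F]_n) : (forall i, d 0 i \is Num.real) ->
  (forall k, (k < n)%N -> 0 <= (elem_sym d)`_k.+1) <-> (forall i, 0 <= d 0 i).
Proof.
move=> dr; split=> [h i|h k _]; last first.
  move: k.+1; rewrite /elem_sym; elim/big_rec: _ => [|i p _ IH] m; first by rewrite coefC;
    case: ifP.
  rewrite mulrDl mul1r coefD -mulrA coefCM coefXM addr_ge0 ?IH // mulr_ge0 ?h //.
  by case: ifP.
rewrite real_leNgt ?real0 //; apply/negP => di.
pose t := - (d 0 i)^-1.
have t0 : 0 < t by rewrite oppr_gt0 invr_lt0.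
have : (elem_sym d).[t] = 0.
  rewrite /elem_sym horner_prod (bigD1 i) //= !hornerE /t mulrN mulfV ?lt_eqF // subrr mul0r //.
suff : 1 <= (elem_sym d).[t] by move=> h1 h2; move: h1; rewrite h2 ler10.
rewrite (horner_coef_wide _ (size_elem_sym d)) big_ord_recl /= coef0_elem_sym_prod expr0 mulr1 lerDl.
by apply: sumr_ge0 => k _; rewrite mulr_ge0 ?h //= exprn_ge0 // ltW.
Qed.

Section Spectral.
Local Open Scope sesquilinear_scope.
Context (R : rcfType).
Local Notation C := R[i].
Local Notation toC := (@real_complex R).

Theorem fl_trace_psd n (P : 'M[R]_n) : P^T = P ->
  (forall k, (k < n)%N -> 0 <= fl_trace P k) <-> (forall v : 'rV[R]_n, 0 <= (v *m P *m v^T) 0 0).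
Proof.
move=> Psym; pose Pc := map_mx toC P.
have toC_real x : toC x \is Num.real by apply/complex_realP; exists x.
have Pherm : Pc \is hermsymmx.
  by apply/is_hermitianmxP; rewrite expr0 scale1r; apply/matrixP => i j;
    rewrite !mxE conj_Creal // -{1}Psym mxE.
have dreal := hermitian_spectral_diag_real Pherm.
have /orthomx_spectralP := hermitian_normalmx Pherm.
have Uu := spectral_unitarymx Pc; have Uun := spectral_unit Pc.
move: (spectralmx Pc) (spectral_diag Pc) dreal Uu Uun => U d dreal Uu Uun PE.
have d_real i : d 0 i \is Num.real by apply: (mxOverP dreal).
have trE k : toC (fl_trace P k) = k.+1`!%:R * (elem_sym d)`_k.+1.
  by rewrite map_fl_trace -/Pc PE fl_trace_conj // fl_trace_diag.
have sgn k : (0 <= fl_trace P k) = (0 <= (elem_sym d)`_k.+1).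
  by rewrite -ler0c [X in 0 <= X](trE k) pmulr_rge0 // ltr0n fact_gt0.
have -> : (forall k, (k < n)%N -> 0 <= fl_trace P k) <-> (forall i, 0 <= d 0 i).
  rewrite -elem_sym_sign //; split=> h k kn; [rewrite -sgn | rewrite sgn]; exact: h.
split=> [d0 v|psd i].
  rewrite -ler0c.
  pose w := map_mx toC v *m U ^t*.
  have -> : ((v *m P *m v^T) 0 0)%:C%C = \sum_i d 0 i * (w 0 i * (w 0 i)^*).
    have vE : (map_mx toC v)^T = (map_mx toC v) ^t*.
      by apply/matrixP => a b; rewrite !mxE conj_Creal.
    have wE : U *m (map_mx toC v)^T = w ^t*.
      by rewrite vE /w trmx_mul map_mxM trmxCK.
    have -> : ((v *m P *m v^T) 0 0)%:C%C = (map_mx toC (v *m P *m v^T)) 0 0 by rewrite [RHS]mxE.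
    rewrite !map_mxM -map_trmx -/Pc PE (invmx_unitary Uu) !mulmxA -/w -mulmxA wE.
    rewrite mul_mx_diag mxE; apply: eq_bigr => k _; rewrite !mxE; ring.
  by apply: sumr_ge0 => i _; rewrite mulr_ge0 // mul_conjC_ge0.
(* The eigenvalue is real, hence a root of the real characteristic polynomial; this yields a real
   eigenvector at which the form can be tested. *)
have /complex_realP [l dl] := d_real i.
have : eigenvalue Pc (d 0 i).
  apply/eigenvalueP; exists (row i U).
    rewrite -row_mul PE !mulmxA mulmxV // mul1mx mul_diag_mx; apply/rowP => j; rewrite !mxE //.
  by apply: contraTneq Uun => r0; rewrite -row_free_unit; apply/row_freePn; exists i;
    rewrite r0 sub0mx.
rewrite eigenvalue_root_char dl -map_char_poly => ev.
have {ev} : root (char_poly P) l by rewrite -(fmorph_root toC).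
rewrite -eigenvalue_root_char => /eigenvalueP [v vP v0].
have := psd v; rewrite vP -scalemxAl mxE ler0c.
have vv : 0 < (v *m v^T) 0 0.
  rewrite lt_def mxE; under eq_bigr do rewrite mxE -expr2.
  rewrite sumr_ge0 => [|k _]; last exact: sqr_ge0.
  rewrite andbT psumr_eq0 => [|k _]; last exact: sqr_ge0.
  apply: contra v0 => /allP h; apply/eqP/rowP => k; rewrite [RHS]mxE.
  by have /= := h k (mem_index_enum k); rewrite sqrf_eq0 => /eqP.
by rewrite pmulr_lge0.
Qed.
End Spectral.

(** * Correctness of the matrix tests *)

Lemma sum_iota (V : nmodType) n (F : nat -> V) : \sum_(i <- iota 0 n) F i = \sum_(i < n) F i.
Proof. by rewrite -[X in iota 0 X]subn0 -/(index_iota 0 n) big_mkord. Qed.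

Definition to_mx n (A : mx_list) : 'M[int]_n := \matrix_(i, j) entry A i j.

Lemma entry_tabulate n f i j : (i < n)%N -> (j < n)%N ->
  entry (tabulate (iota 0 n) f) i j = f i j.
Proof.
move=> lin ljn; rewrite /entry /tabulate big_flatten big_map sum_iota.
rewrite (bigD1 (Ordinal lin)) //= big_map sum_iota (bigD1 (Ordinal ljn)) //= !eqxx /=.
rewrite big1 ?addr0 => [|j' jj']; last first.
  by case: ifP => // /eqP E; rewrite -(inj_eq val_inj) /= E eqxx in jj'.
rewrite big1 ?addr0 // => i' ii'; rewrite big_map big1 // => j' _.
by case: ifP => //= /andP[/eqP E _]; rewrite -(inj_eq val_inj) /= E eqxx in ii'.
Qed.

Lemma to_mx_tabulate n f : to_mx n (tabulate (iota 0 n) f) = \matrix_(i, j) f i j.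
Proof. by apply/matrixP => i j; rewrite !mxE entry_tabulate. Qed.

Lemma tr_mul_mx n P A : tr_mul (iota 0 n) P A = \tr (to_mx n P *m to_mx n A).
Proof.
rewrite /tr_mul sum_iota; apply: eq_bigr => i _; rewrite sum_iota mxE.
by apply: eq_bigr => l _; rewrite !mxE.
Qed.

Lemma to_mx_fl_next n P k A :
  to_mx n (fl_next (iota 0 n) P k A) =
  (\tr (to_mx n P *m to_mx n A))%:M - k%:R *: (to_mx n P *m to_mx n A).
Proof.
rewrite /fl_next to_mx_tabulate; apply/matrixP => i j; rewrite tr_mul_mx !mxE.
congr (_ - _); first by rewrite -(inj_eq val_inj) /=; case: eqP => _; rewrite ?mulr1n ?mulr0n.
by rewrite sum_iota natz; congr (_ * _); apply: eq_bigr => l _; rewrite !mxE.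
Qed.

Lemma psd_testE n P : psd_test (iota 0 n) P <->
  (forall k, (k < n)%N -> 0 <= fl_trace (to_mx n P) k).
Proof.
have E (l : seq nat) : let s := foldl (fun s _ => fl_step (iota 0 n) P s) (fl_start (iota 0 n)) l in
  [/\ s.1.1 = (size l).+1, to_mx n s.1.2 = fl_mx (to_mx n P) (size l) &
      s.2 = all (fun k => 0 <= fl_trace (to_mx n P) k) (iota 0 (size l))].
  elim/last_ind: l => [|l a].
    split=> //=; rewrite to_mx_tabulate; apply/matrixP => i j; rewrite !mxE.
    by rewrite -(inj_eq val_inj) /=; case: eqP.
  have iE : iota 0 (size l).+1 = iota 0 (size l) ++ [:: size l] by rewrite -addn1 iotaD.
  rewrite foldl_rcons size_rcons iE; case: (foldl _ _ _) => [[k A] b] /= [-> EA ->].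
  rewrite all_cat /= andbT tr_mul_mx EA; split=> //; first by rewrite to_mx_fl_next EA.
  by rewrite /fl_trace; case: (0 <= _); rewrite ?andbT ?andbF.
have [_ _] := E (iota 0 n); rewrite /psd_test => ->; rewrite size_iota.
split=> [/allP h k kn|h]; first by apply: h; rewrite mem_iota.
by apply/allP => k; rewrite mem_iota => /h.
Qed.

Section LorentzTest.
Context (R : realType) (n : nat).

Lemma psd_lorentz (H : mx_list) (B : ('I_n -> R) -> ('I_n -> R) -> R) :
  (forall i j, (i < n)%N -> (j < n)%N -> entry H i j = entry H j i) ->
  (forall u v, B u v = \sum_(i < n) \sum_(j < n) (entry H i j)%:~R * (u i * v j)) ->
  psd_test (iota 0 n) (lorentz_mx (iota 0 n) H) <-> lorentz B.
Proof.
move=> Hsym BE; set L := iota 0 n.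
pose r (i : 'I_n) : R := (row_sum L H i)%:~R; pose s : R := (mx_sum L H)%:~R.
have rE i : r i = \sum_(j < n) (entry H i j)%:~R by rewrite /r /row_sum sum_iota rmorph_sum.
have sE : s = \sum_i r i by rewrite /s /mx_sum sum_iota rmorph_sum.
have [P Pdef PE] : exists2 P, to_mx n (lorentz_mx L H) = P &
    forall i j, P i j = row_sum L H i * row_sum L H j - mx_sum L H * entry H i j.
  by eexists; [reflexivity | move=> i j; rewrite to_mx_tabulate mxE].
pose PR := map_mx (intr : int -> R) P.
have Psym : PR^T = PR.
  by apply/matrixP => i j; rewrite !mxE !PE (Hsym i j) // mulrC.
rewrite psd_testE Pdef.
have -> : (forall k, (k < n)%N -> 0 <= fl_trace P k) <-> (forall k, (k < n)%N -> 0 <= fl_trace PR k).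
  by split=> h k /h; rewrite -(map_fl_trace (intr : {rmorphism int -> R})) ler0z.
rewrite fl_trace_psd //.
have B11 : B (ones R (n := n)) (ones R (n := n)) = s.
  rewrite BE sE; apply: eq_bigr => i _; rewrite rE; apply: eq_bigr => j _.
  by rewrite !mulr1.
have B1v v : B (ones R (n := n)) v = \sum_j r j * v j.
  rewrite BE exchange_big; apply: eq_bigr => j _; rewrite rE mulr_suml; apply: eq_bigr => i _.
  by rewrite mul1r (Hsym i j).
(* The quadratic form of the tested matrix is the defect in the reverse Cauchy-Schwarz inequality
   for [ones] and [v]. *)
have Q (v : 'rV[R]_n) : (v *m PR *m v^T) 0 0 =
    B (ones R (n := n)) (v 0) ^+ 2 - B (ones R (n := n)) (ones R (n := n)) * B (v 0) (v 0).
  rewrite B11 B1v BE mxE expr2 mulr_suml mulr_sumr -sumrB.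
  rewrite (eq_bigr (fun j => \sum_i v 0 i * PR i j * v 0 j)); last first.
    by move=> j _; rewrite !mxE mulr_suml.
  rewrite exchange_big; apply: eq_bigr => i _ /=; rewrite mulr_sumr mulr_sumr -sumrB.
  apply: eq_bigr => j _; rewrite mxE PE rmorphB !rmorphM /= -/s -/(r i) -/(r j).
  by rewrite /r; ring.
split=> h v.
  have := h (\row_i v i); rewrite Q subr_ge0.
  have E u : B u ((\row_i v i) 0) = B u v.
    by rewrite !BE; apply: eq_bigr => i _; apply: eq_bigr => j _; rewrite mxE.
  by rewrite !E; have -> : B ((\row_i v i) 0) v = B v v; [rewrite !BE; apply: eq_bigr => i _;
    apply: eq_bigr => j _; rewrite mxE|].
by rewrite Q subr_ge0.
Qed.

Variable A : seq (triple * nat).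

Definition tensor (i j k : 'I_n) : R := (deriv3 A i j k)%:~R.

Lemma deriv3_sym12 i j k : deriv3 A i j k = deriv3 A j i k.
Proof. by rewrite /deriv3; ring. Qed.

Lemma deriv3_sym23 i j k : deriv3 A i j k = deriv3 A i k j.
Proof. by rewrite /deriv3; ring. Qed.

Lemma tensor_sym12 i j k : tensor i j k = tensor j i k.
Proof. by rewrite /tensor deriv3_sym12. Qed.

Lemma tensor_sym23 i j k : tensor i j k = tensor i k j.
Proof. by rewrite /tensor deriv3_sym23. Qed.

Lemma tensor_ge0 i j k : 0 <= tensor i j k.
Proof.
have c0 a b c : 0 <= coeff3 A a b c by apply: sumr_ge0 => e _; case: ifP.
by rewrite ler0z /deriv3 !addr_ge0.
Qed.

Lemma lorentz_testE : lorentz_test (iota 0 n) A <->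
  (forall k, lorentz (tri tensor (unit_fun R k))) /\ lorentz (tri tensor (ones R (n := n))).
Proof.
have E1 (k : 'I_n) : psd_test (iota 0 n) (lorentz_mx (iota 0 n)
    (tabulate (iota 0 n) (fun i j => deriv3 A i j k))) <-> lorentz (tri tensor (unit_fun R k)).
  apply: psd_lorentz => [i j lin ljn|u v].
    by rewrite !entry_tabulate // deriv3_sym12.
  rewrite tri_unit; apply: eq_bigr => i _; apply: eq_bigr => j _.
  by rewrite entry_tabulate // /tensor deriv3_sym12 deriv3_sym23.
have E2 : psd_test (iota 0 n) (lorentz_mx (iota 0 n)
    (tabulate (iota 0 n) (fun i j => \sum_(k <- iota 0 n) deriv3 A i j k))) <->
    lorentz (tri tensor (ones R (n := n))).
  apply: psd_lorentz => [i j lin ljn|u v].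
    by rewrite !entry_tabulate //; apply: eq_bigr => k _; rewrite deriv3_sym12.
  rewrite (tri_sym12 tensor_sym12) (tri_sym23 tensor_sym23); apply: eq_bigr => i _;
    apply: eq_bigr => j _.
  rewrite entry_tabulate // sum_iota rmorph_sum mulr_suml; apply: eq_bigr => k _.
  by rewrite mulr1.
rewrite /lorentz_test -E2; split=> [/andP[/allP h1 h2]|[h1 h2]].
  by split=> // k; apply/E1; apply: h1; rewrite mem_iota add0n ltn_ord.
apply/andP; split=> //; apply/allP => k; rewrite mem_iota add0n /= => kn.
by apply/(E1 (Ordinal kn)); apply: h1.
Qed.
End LorentzTest.

(** * Decoding the input *)

Lemma nth_digits k i : nth false (digits k) i = odd (k %/ 2 ^ i).
Proof.
elim: i k => [|i IH] k; rewrite digitsE; case: eqP => [->|_]; rewrite ?nth_nil ?div0n //=.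
  by rewrite divn1.
by rewrite IH -divn2 -divnMA expnS.
Qed.

Lemma blenE k : blen k = up_log 2 k.+1.
Proof.
apply/eqP; rewrite eqn_leq blen_leq ?up_logP //=.
by apply: up_log_min => //; apply: blen_lt.
Qed.

Lemma bitsE k : bits k = [seq Some b | b <- digits k].
Proof.
rewrite /bits; apply: (@eq_from_nth _ None); first by rewrite size_mkseq size_map -blenE.
move=> i; rewrite size_mkseq -blenE => ik.
by rewrite nth_mkseq -?blenE // (nth_map false) // nth_digits.
Qed.

Lemma foldl_split_block c o (d : seq bool) w :
  foldl split_step (c, o) ([seq Some b | b <- d] ++ None :: w) =
  foldl split_step ([::], catrev d c :: o) w.
Proof. by elim: d c => //= b d IH c; rewrite IH. Qed.

Definition rat_words (q : rat) := [:: rev (digits `|numq q|); rev (digits `|denq q|)].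

Lemma foldl_split_rats o (cs : seq rat) :
  foldl split_step ([::], o) (flatten (map encode_rat cs)) =
  ([::], catrev (flatten (map rat_words cs)) o).
Proof.
elim: cs o => //= q cs IH o.
rewrite /encode_rat !bitsE -!catA /= foldl_split_block -catA /= foldl_split_block.
by rewrite IH !catrevE !cats0.
Qed.

Lemma split_words_encode n (g : {mpoly rat[n]}) :
  split_words (encode_cubic g) = nseq n true :: flatten (map rat_words (cubic_coeffs g)).
Proof.
rewrite /split_words /encode_cubic.
have -> : nseq n (Some true : letter) = [seq Some b | b <- nseq n true] by rewrite map_nseq.
rewrite foldl_split_block foldl_split_rats /= catrevE rev_cat revK /=.
rewrite !catrevE cats0; congr cons.
exact: rev_nseq.
Qed.

Lemma pair_words_flatten (S : Type) (ts : seq S) (cv : S -> rat) (tv : S -> triple) :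
  pair_words (flatten (map rat_words (map cv ts))) (map tv ts) =
  rev [seq (tv t, (rev (digits `|numq (cv t)|), rev (digits `|denq (cv t)|))) | t <- ts].
Proof.
rewrite /pair_words -[RHS]cats0; move: [::] => o; elim: ts o => //= t ts IH o.
by rewrite IH rev_cons cat_rcons.
Qed.

Section Coefficients.
Context (n : nat) (g : {mpoly rat[n]}).
Hypothesis g_ge0 : forall m : 'X_{1..n}, 0 <= g@_m.

Definition nat_triple (t : 'I_n * 'I_n * 'I_n) : triple := (t.1.1 : nat, t.1.2 : nat, t.2 : nat).

Definition tmon (t : 'I_n * 'I_n * 'I_n) : 'X_{1..n} := (U_(t.1.1) + U_(t.1.2) + U_(t.2))%MM.

Lemma index_triplesE : index_triples (iota 0 n) = map nat_triple (cubic_indices n).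
Proof.
rewrite /index_triples /cubic_indices -val_enum_ord; set e := enum 'I_n.
have -> : flatten [seq [seq (i, j) | j <- map val e] | i <- map val e] =
    map (fun ij : 'I_n * 'I_n => (val ij.1, val ij.2)) [seq (i, j) | i <- e, j <- e].
  rewrite map_flatten -!map_comp; congr flatten; apply: eq_map => i /=.
  by rewrite -!map_comp.
have E (ps : seq ('I_n * 'I_n)) :
    flatten [seq [seq (ij, k) | k <- map val e] | ij <- [seq (val ij.1, val ij.2) | ij <- ps]] =
    map nat_triple [seq (ij, k) | ij <- ps, k <- e].
  rewrite map_flatten -!map_comp; congr flatten; apply: eq_map => i /=.
  by rewrite -!map_comp.
by rewrite E filter_map.
Qed.

Lemma mem_cubic_indices t : (t \in cubic_indices n) = (t.1.1 <= t.1.2 <= t.2)%N.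
Proof.
rewrite mem_filter; case: t => [[i j] k]; rewrite [X in _ && X](_ : _ = true) ?andbT //.
apply/allpairsPdep; exists (i, j), k; rewrite mem_enum; split=> //.
by apply/allpairsPdep; exists i, j; rewrite !mem_enum.
Qed.

Lemma cubic_indices_uniq : uniq (cubic_indices n).
Proof.
by apply: filter_uniq; do 2 (apply: allpairs_uniq; rewrite ?enum_uniq //;
  last by move=> [? ?] [? ?] _ _ []  -> ->).
Qed.

(** Reversed because [pair_step] accumulates at the front; the sums and products taken over the list
    do not depend on its order. *)
Definition rat_entries : seq (triple * (nat * nat)) :=
  rev [seq (nat_triple t, (`|numq g@_(tmon t)|%N, `|denq g@_(tmon t)|%N)) | t <- cubic_indices n].

Definition common_den : nat := \prod_(t <- cubic_indices n) `|denq g@_(tmon t)|%N.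

Lemma decide_encode :
  decide (encode_cubic g) = lorentz_test (iota 0 n) (cleared_entries rat_entries).
Proof.
rewrite /decide split_words_encode /decide_words /= /index_list size_nseq index_triplesE.
rewrite pair_words_flatten map_rev -map_comp; congr (lorentz_test _ (cleared_entries (rev _))).
by apply: eq_map => t; rewrite /= !horner2_digits.
Qed.

Definition sorted_coeff (i j k : 'I_n) : rat :=
  if (i <= j <= k)%N then g@_(tmon (i, j, k)) else 0.

Lemma triple_eqE (t t' : 'I_n * 'I_n * 'I_n) :
  [&& t.1.1 == t'.1.1 :> nat, t.1.2 == t'.1.2 :> nat & t.2 == t'.2 :> nat] = (t == t').
Proof. by case: t t' => [[i j] k] [[i' j'] k']; rewrite -!pair_eqE /= -andbA. Qed.

Lemma coeff3_cleared (i j k : 'I_n) :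
  (coeff3 (cleared_entries rat_entries) i j k)%:~R = sorted_coeff i j k * common_den%:R :> rat.
Proof.
pose den t := `|denq g@_(tmon t)|%N.
pose F t := (`|numq g@_(tmon t)| * \prod_(t' <- cubic_indices n) (if t' == t then 1 else den t'))%N.
(* The numerator times the other denominators is the coefficient times all denominators. *)
have FE t : t \in cubic_indices n -> (F t)%:R = g@_(tmon t) * common_den%:R :> rat.
  move=> tin; rewrite /F /common_den !(bigD1_seq t tin cubic_indices_uniq) /= eqxx mul1n.
  rewrite (eq_bigr den) => [|t' /negPf ->] //; rewrite !natrM mulrA; congr (_ * _).
  set c := g@_(tmon t); have c0 : 0 <= c by apply: g_ge0.
  have dE : (`|denq c|%N)%:R = (denq c)%:~R :> rat by rewrite pmulrn gtz0_abs ?denq_gt0.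
  have nE : (`|numq c|%N)%:R = (numq c)%:~R :> rat.
    by rewrite pmulrn gez0_abs ?numq_ge0.
  by rewrite dE nE -{2}[c]divq_num_den divfK // intr_eq0 denq_neq0.
rewrite /coeff3 /cleared_entries big_map /rat_entries big_rev big_map rmorph_sum /=.
pose t0 := (i, j, k).
transitivity (\sum_(t <- cubic_indices n) if t == t0 then (F t)%:R else 0 : rat).
  apply: eq_bigr => t _; rewrite -[t == t0]triple_eqE /=; case: ifP => // _.
  rewrite pmulrn -/(F t); congr (_ * _)%N%:R; rewrite big_rev big_map; apply: eq_bigr => t' _ /=.
  by rewrite triple_eqE.
rewrite /sorted_coeff -[(i <= j <= k)%N](mem_cubic_indices t0); case: ifP => tin.
  rewrite (bigD1_seq t0 tin cubic_indices_uniq) /= eqxx FE // big1 ?addr0 //.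
  by move=> t /negPf ->.
rewrite mul0r big_seq big1 // => t tt; case: eqP => // tE; by rewrite -tE tt in tin.
Qed.
End Coefficients.

(** * Cubic monomials and sorted triples *)

Section Evaluation.
Context (R : realType) (n : nat) (p : {mpoly R[n]}).
Hypothesis p_homog : p \is 3.-homog.

Definition seq_mon (s : seq 'I_n) : 'X_{1..n} := (\sum_(i <- s) U_(i))%MM.

Lemma seq_monE s i : seq_mon s i = count_mem i s.
Proof.
rewrite /seq_mon mnm_sumE; elim: s => [|j s IH]; first by rewrite big_nil.
by rewrite big_cons IH mnm1E.
Qed.

Lemma mdeg_seq_mon d (m : 'X_{1..n}) : mdeg m = d -> exists2 s, size s = d & m = seq_mon s.
Proof.
elim: d m => [|d IH] m md.
  by exists [::] => //; move/eqP: md; rewrite mdeg_eq0 /seq_mon big_nil => /eqP.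
have [i mi] : exists i, m i != 0%N.
  apply/existsP; apply: contra_eqT md => /existsPn m0.
  by rewrite mdegE big1 // => i _; apply/eqP/negPn.
have mK : (m - U_(i) + U_(i))%MM = m by apply: submK; rewrite lep1mP.
have [|s ss sE] := IH (m - U_(i))%MM; first by move: md; rewrite -{1}mK mdegD mdeg1 addn1 => -[].
by exists (i :: s); rewrite /= ?ss // /seq_mon big_cons -/(seq_mon s) -sE -[LHS]mK addmC.
Qed.

Let ord_leq (i j : 'I_n) := (i <= j)%N.

Lemma tmonE t : tmon t = seq_mon [:: t.1.1; t.1.2; t.2].
Proof. by rewrite /seq_mon !big_cons big_nil /tmon addm0 addmA. Qed.

(** Exponents are multiplicities, and two sorted lists with the same multiplicities are equal. *)
Lemma tmon_inj : {in cubic_indices n &, injective (@tmon n)}.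
Proof.
move=> t t'; rewrite !mem_cubic_indices => st st'; rewrite !tmonE => E.
have : [:: t.1.1; t.1.2; t.2] = [:: t'.1.1; t'.1.2; t'.2].
  apply: (@sorted_eq _ ord_leq) => /=.
  - by move=> y x z; apply: leq_trans.
  - by move=> x y h; apply: val_inj; apply/eqP; rewrite eqn_leq.
  - by rewrite andbT.
  - by rewrite andbT.
  by apply/allP => i _; apply/eqP; rewrite -[LHS]seq_monE -[RHS]seq_monE E.
by case: t t' {st st' E} => [[i j] k] [[i' j'] k'] /= [-> -> ->].
Qed.

Lemma tmon_surj m : mdeg m = 3 -> exists2 t, t \in cubic_indices n & m = tmon t.
Proof.
move=> /mdeg_seq_mon [s ss ->].
have tot : total ord_leq by move=> i j; apply: leq_total.
have := sort_sorted tot s; have : perm_eq (sort ord_leq s) s by rewrite perm_sort.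
have := size_sort ord_leq s; rewrite ss.
case: (sort _ _) => [|a [|b [|c []]]] //= _ pm /andP[ab /andP[bc _]].
exists (a, b, c); first by rewrite mem_cubic_indices; apply/andP.
by rewrite tmonE /= /seq_mon; apply: perm_big; rewrite perm_sym.
Qed.

(** Sorted triples enumerate the monomials of degree 3 once each, and those outside the support
    contribute 0. *)
Lemma meval_cubic (x : 'I_n -> R) :
  p.@[x] = \sum_(t <- cubic_indices n) p@_(tmon t) * (x t.1.1 * x t.1.2 * x t.2).
Proof.
pose F m := p@_m * \prod_i x i ^+ m i.
transitivity (\sum_(m <- map (@tmon n) (cubic_indices n)) F m); last first.
  rewrite big_map; apply: eq_bigr => t _; rewrite /F -mevalX /tmon !mpolyXD !mevalM.
  by rewrite !mevalXU.
rewrite mevalE -[LHS]/(\sum_(m <- msupp p) F m); have u : uniq (map (@tmon n) (cubic_indices n)).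
  by rewrite map_inj_in_uniq ?cubic_indices_uniq //; apply: tmon_inj.
rewrite [RHS](bigID (fun m => m \in msupp p)) /= [X in _ + X]big1 ?addr0; last first.
  by move=> m /memN_msupp_eq0 pm; rewrite /F pm mul0r.
rewrite -[RHS]big_filter; apply: perm_big; apply: uniq_perm; rewrite ?filter_uniq ?msupp_uniq //.
move=> m; rewrite mem_filter; case mp: (m \in msupp p) => //=.
have /dhomogP /(_ m mp) /tmon_surj [t tin ->] := p_homog.
by rewrite map_f.
Qed.
End Evaluation.

(** * From the integer tensor back to the rational polynomial *)

Section Scaling.
Context (R : realType) (n : nat) (g : {mpoly rat[n]}).
Hypothesis g_homog : g \is 3.-homog.
Hypothesis g_ge0 : forall m : 'X_{1..n}, 0 <= g@_m.

Let A := cleared_entries (rat_entries g).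

Lemma common_den_gt0 : (0 < common_den g)%N.
Proof. by apply: prodn_gt0 => t; rewrite absz_gt0 denq_neq0. Qed.

Lemma map_mpoly_homog : map_mpoly (@ratr R) g \is 3.-homog.
Proof.
apply/dhomogP => m; rewrite mcoeff_msupp mcoeff_map_mpoly fmorph_eq0 -mcoeff_msupp.
by move: m; apply/dhomogP.
Qed.

(** Each of the six permuted copies of the coefficient tensor defines the same cubic, hence the
    factor 6. *)
Lemma cubic_tensorE x : cubic (tensor R A) x =
  (6 * common_den g)%:R * (map_mpoly (@ratr R) g).@[x].
Proof.
pose c i j k : R := (coeff3 A i j k)%:~R.
pose S (f : 'I_n -> 'I_n -> 'I_n -> R) := \sum_i \sum_j \sum_k f i j k * (x i * x j * x k).
have S12 f : S (fun i j k => f j i k) = S f.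
  by rewrite /S exchange_big; do 3 (apply: eq_bigr => ? _); ring.
have S23 f : S (fun i j k => f i k j) = S f.
  by rewrite /S; apply: eq_bigr => i _; rewrite exchange_big; do 2 (apply: eq_bigr => ? _); ring.
have SD f h : S (fun i j k => f i j k + h i j k) = S f + S h.
  by rewrite /S -big_split; apply: eq_bigr => i _; rewrite -big_split; apply: eq_bigr => j _;
     rewrite -big_split; apply: eq_bigr => k _; rewrite /= mulrDl.
have -> : cubic (tensor R A) x = S (fun i j k => c i j k + c i k j + c j i k + c j k i + c k i j + c k j i).
  by do 3 (apply: eq_bigr => ? _); rewrite /tensor /deriv3 !rmorphD.
rewrite !SD (S23 (fun i j k => c i j k)) (S12 (fun i j k => c i j k)).
have -> : S (fun i j k => c j k i) = S c by rewrite (S12 (fun i j k => c i k j)) S23.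
have -> : S (fun i j k => c k i j) = S c by rewrite (S23 (fun i j k => c j i k)) S12.
have -> : S (fun i j k => c k j i) = S c.
  by rewrite (S12 (fun i j k => c k i j)) (S23 (fun i j k => c j i k)) S12.
suff -> : S c = (common_den g)%:R * (map_mpoly (@ratr R) g).@[x] by rewrite natrM; ring.
rewrite (meval_cubic map_mpoly_homog) mulr_sumr big_filter big_mkcond /S.
rewrite big_allpairs big_allpairs [RHS]big_enum /=; apply: eq_bigr => i _.
rewrite [RHS]big_enum /=; apply: eq_bigr => j _; rewrite [RHS]big_enum /=; apply: eq_bigr => k _.
have := coeff3_cleared g_ge0 i j k; rewrite -/A => /(congr1 (@ratr R)).
rewrite ratr_int rmorphM /= ratr_nat /c => ->; rewrite /sorted_coeff mcoeff_map_mpoly.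
by case: ifP => _; rewrite ?rmorph0; ring.
Qed.

Lemma decide_log_concave :
  decide (encode_cubic g) <-> log_concave (map_mpoly (@ratr R) g).
Proof.
rewrite decide_encode (lorentz_testE R).
have D0 : 0 < (6 * common_den g)%:R :> R by rewrite ltr0n muln_gt0 common_den_gt0.
apply: iff_sym.
apply: (@log_concave_lorentz R n (tensor R A) _ _ _ (6 * common_den g)%:R^-1 (fun x => (map_mpoly (@ratr R) g).@[x])).
- exact: tensor_sym12.
- exact: tensor_sym23.
- exact: tensor_ge0.
- by rewrite invr_gt0.
- by move=> x; rewrite cubic_tensorE mulKf // gt_eqF.
Qed.
End Scaling.

Theorem corollary6p6 (R : realType) :
  exists (M : machine letter) (c d : nat),
    forall (n : nat) (g : {mpoly rat[n]}),
      g \is 3.-homog ->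
      (forall m : 'X_{1..n}, 0 <= g@_m) ->
      exists b : bool,
        answers_within M (c * size (encode_cubic g) ^ d + c)%N
          (encode_cubic g) b
        /\ (b <-> log_concave (map_mpoly (@ratr R) g)).
Proof.
have [M [c [d H]]] := pt_machine pt_decide.
exists M, c, d => n g g_homog g_ge0; exists (decide (encode_cubic g)); split=> //.
exact: decide_log_concave.
Qed.
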